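(* Let $\mathfrak{f}:\Sigma\to\mathfrak{Q}^{3}$ be an umbilic-free immersed surface in a three-dimensional space form $\mathfrak{Q}^{3}$ with tangent plane congruence $\mathfrak{t}:\Sigma\to\mathfrak{P}^{3}$, and let $f=\langle\mathfrak{f},\mathfrak{t}\rangle$ be its Legendre lift. Then $f$ is an $\Omega$-surface (respectively, an $\Omega_{0}$-surface) if and only if $\mathfrak{f}$ is an $\Omega$-surface (respectively, an $\Omega_{0}$-surface) in the sense of Demoulin, that is, in terms of curvature line coordinates $(u,v)$ there exist a function $U$ of $u$ only, a function $V$ of $v$ only, and $\epsilon\in\{1,i\}$ (respectively, $\epsilon=0$) such that $$\left(\frac{V}{U}\frac{\sqrt{E}}{\sqrt{G}}\frac{\kappa_{1,u}}{\kappa_{1}-\kappa_{2}}\right)_{v}+\epsilon^{2}\left(\frac{U}{V}\frac{\sqrt{G}}{\sqrt{E}}\frac{\kappa_{2,v}}{\kappa_{1}-\kappa_{2}}\right)_{u}=0.$$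
   Context: All objects are smooth. $\mathbb{R}^{4,2}$ is a six-dimensional real vector space with a symmetric bilinear form $(\cdot,\cdot)$ of signature $(4,2)$, $\mathcal{L}$ is its lightcone, and $\mathcal{Z}$ is the Grassmannian of its isotropic 2-dimensional subspaces. $\wedge^{2}\mathbb{R}^{4,2}$ is identified with $\mathfrak{o}(4,2)$ via $(a\wedge b)c=(a,c)b-(b,c)a$. $\Sigma$ is a 2-dimensional manifold, $\underline{\mathbb{R}}^{4,2}=\Sigma\times\mathbb{R}^{4,2}$ with trivial connection $d$; $\Gamma$ denotes sections and $\Omega^{k}(E)$ the $E$-valued $k$-forms. Space forms: let $\mathfrak{q},\mathfrak{p}\in\mathbb{R}^{4,2}$ be non-zero with $\mathfrak{q}\perp\mathfrak{p}$ and $|\mathfrak{p}|^{2}=\pm1$. Then $\mathfrak{Q}^{3}=\{y\in\mathcal{L}:(y,\mathfrak{q})=-1,(y,\mathfrak{p})=0\}$ is a three-dimensional space form of curvature $-|\mathfrak{q}|^{2}$, and $\mathfrak{P}^{3}=\{y\in\mathcal{L}:(y,\mathfrak{q})=0,(y,\mathfrak{p})=-1\}$ is its space of (oriented) hyperplanes. The tangent plane congruence $\mathfrak{t}:\Sigma\to\mathfrak{P}^{3}$ of an immersion $\mathfrak{f}$ satisfies $(\mathfrak{t},\mathfrak{f})=0=(\mathfrak{t},d\mathfrak{f})$, and in curvature line coordinates $(u,v)$ the principal curvatures are given by $\mathfrak{t}_{u}+\kappa_{1}\mathfrak{f}_{u}=0=\mathfrak{t}_{v}+\kappa_{2}\mathfrak{f}_{v}$.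 $E=(\mathfrak{f}_{u},\mathfrak{f}_{u})$, $G=(\mathfrak{f}_{v},\mathfrak{f}_{v})$. Umbilic-free means $\kappa_{1}\neq\kappa_{2}$ everywhere. The functions $U,V$ are nowhere zero, the statement is local (on domains of curvature line coordinates), and the labelling of the curvature directions (which of the two is labelled by $u,\kappa_{1},E$ and which by $v,\kappa_{2},G$) may be interchanged. $f=\langle\mathfrak{f},\mathfrak{t}\rangle:\Sigma\to\mathcal{Z}$ is a rank 2 subbundle of $\underline{\mathbb{R}}^{4,2}$. For $\eta\in\Omega^{1}(f\wedge f^{\perp})$ define the 2-tensor $q(X,Y)=\mathrm{tr}(f\to f,\ \sigma\mapsto\eta(X)d_{Y}\sigma)$. $f$ is Lie applicable if there is a closed $\eta\in\Omega^{1}(f\wedge f^{\perp})$ with $[\eta\wedge\eta]=0$ (where $[\eta\wedge\eta](X,Y)=2[\eta(X),\eta(Y)]$) and $q$ non-zero; it is an $\Omega$-surface (respectively $\Omega_{0}$-surface) if moreover $q$ is non-degenerate (respectively degenerate) on a dense open subset of $\Sigma$. Standing assumption: the signature of $q$ is constant on $\Sigma$. *)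

(* Defs.v *)
From HB Require Import structures.
From mathcomp Require Import all_boot all_order all_algebra.
From mathcomp Require Import all_classical all_reals all_analysis.
From mathcomp.real_closed Require Export complex.

Set Implicit Arguments.
Unset Strict Implicit.
Unset Printing Implicit Defensive.

Import Order.TTheory GRing.Theory Num.Theory.
Import numFieldNormedType.Exports.

Local Open Scope classical_set_scope.
Local Open Scope ring_scope.

(** Points of the plane and tangent vectors are row vectors ['rV[R]_2]; the
    coordinates are [u = p 0 0] and [v = p 0 1], and an index [i : 'I_2] selects
    one of them. *)

Definition partial (R : realType) (W : normedModType R) (i : 'I_2)
    (F : 'rV[R]_2 -> W) (p : 'rV[R]_2) : W :=
  'D_(delta_mx 0 i) F p.

Fixpoint class_C (R : realType) (W : normedModType R) (k : nat)
    (D : set 'rV[R]_2) (F : 'rV[R]_2 -> W) : Prop :=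
  match k with
  | 0%N => forall p, D p -> {for p, continuous F}
  | k'.+1 => (forall i p, D p -> derivable F p (delta_mx 0 i)) /\
             (forall i, class_C k' D (partial i F))
  end.

Definition smooth (R : realType) (W : normedModType R) (D : set 'rV[R]_2)
    (F : 'rV[R]_2 -> W) : Prop :=
  forall k, class_C k D F.

Definition smooth1 (R : realType) (I : set R) (g : R -> R) : Prop :=
  forall n x, I x -> derivable (derive1n n g) x 1.

(** The last clause says that the coordinate lines meet [D] in intervals: on
    such a domain a function that is locally independent of one coordinate is a
    function of the other coordinate only. *)
Definition coordinate_domain (R : realType) (D : set 'rV[R]_2) : Prop :=
  [/\ open D, D !=set0, connected D &
      forall (i : 'I_2) p r, D p -> D r -> p 0 i = r 0 i ->
        forall t : R, 0 <= t <= 1 -> D (p + t *: (r - p))].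

(** Vectors of R^{4,2} are rows and an endomorphism is a matrix acting on the right:
    the value of [A] at [c] is [c *m A]. *)

Definition gram42 (R : realType) : 'M[R]_6 :=
  diag_mx (\row_(i < 6) (if (i < 4)%N then 1 else -1)).

Definition form42 (R : realType) (a b : 'rV[R]_6) : R :=
  (a *m gram42 R *m b^T) 0 0.

Definition lightcone (R : realType) : set 'rV[R]_6 :=
  [set y | y != 0 /\ form42 y y = 0].

Definition wedge (R : realType) (a b : 'rV[R]_6) : 'M[R]_6 :=
  gram42 R *m a^T *m b - gram42 R *m b^T *m a.

Lemma wedgeE (R : realType) (a b c : 'rV[R]_6) :
  c *m wedge a b = form42 a c *: b - form42 b c *: a.
Proof.
have H (x y : 'rV[R]_6) : c *m (gram42 R *m x^T *m y) = form42 x c *: y.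
  have -> : form42 x c = form42 c x.
    rewrite /form42 -[in LHS](trmxK (_ *m c^T)) mxE !trmx_mul trmxK.
    by rewrite tr_diag_mx mulmxA.
  by rewrite !mulmxA [c *m _ *m _]mx11_scalar mul_scalar_mx.
by rewrite /wedge mulmxBr !H.
Qed.

(** The reversed products account for the action on the right. *)
Definition lie_bracket (R : realType) (A B : 'M[R]_6) : 'M[R]_6 :=
  B *m A - A *m B.

(** Subspaces of R^{4,2} are row spaces of matrices. *)
Definition perp (R : realType) (m : nat) (S : 'M[R]_(m, 6)) : 'M[R]_6 :=
  kermx (gram42 R *m S^T).

Definition in_wedge (R : realType) (m n : nat) (S : 'M[R]_(m, 6))
    (T : 'M[R]_(n, 6)) (A : 'M[R]_6) : Prop :=
  exists (k : nat) (s t : 'I_k -> 'rV[R]_6),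
    [/\ forall l, (s l <= S)%MS, forall l, (t l <= T)%MS &
        A = \sum_(l < k) wedge (s l) (t l)].

Definition space_form_data (R : realType) (q0 p0 : 'rV[R]_6) : Prop :=
  [/\ q0 != 0, p0 != 0, form42 q0 p0 = 0 &
      form42 p0 p0 = 1 \/ form42 p0 p0 = -1].

Definition space_form (R : realType) (q0 p0 : 'rV[R]_6) : set 'rV[R]_6 :=
  [set y | [/\ lightcone y, form42 y q0 = -1 & form42 y p0 = 0]].

Definition hyperplanes (R : realType) (q0 p0 : 'rV[R]_6) : set 'rV[R]_6 :=
  [set y | [/\ lightcone y, form42 y q0 = 0 & form42 y p0 = -1]].

Definition immersed_in (R : realType) (D : set 'rV[R]_2) (M : set 'rV[R]_6)
    (fr : 'rV[R]_2 -> 'rV[R]_6) : Prop :=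
  [/\ smooth D fr, forall p, D p -> M (fr p) &
      forall p, D p -> row_free (\matrix_(i < 2) partial i fr p)].

Definition tangent_plane_congruence (R : realType) (D : set 'rV[R]_2)
    (P : set 'rV[R]_6) (fr tg : 'rV[R]_2 -> 'rV[R]_6) : Prop :=
  [/\ smooth D tg, forall p, D p -> P (tg p),
      forall p, D p -> form42 (tg p) (fr p) = 0 &
      forall p, D p -> forall i, form42 (tg p) (partial i fr p) = 0].

(** Rodrigues' equations: the coordinate directions are curvature directions,
    with principal curvatures [k1] along u and [k2] along v. *)
Definition curvature_line_coordinates (R : realType) (D : set 'rV[R]_2)
    (fr tg : 'rV[R]_2 -> 'rV[R]_6) (k1 k2 : 'rV[R]_2 -> R) : Prop :=
  [/\ smooth D k1, smooth D k2,
      forall p, D p -> partial 0 tg p + k1 p *: partial 0 fr p = 0 &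
      forall p, D p -> partial 1 tg p + k2 p *: partial 1 fr p = 0].

(** A rank 2 subbundle [f] of the trivial bundle is given by a frame
    [F : 'rV[R]_2 -> 'M[R]_(2, 6)]: the fibre at [p] is the row space of [F p]. *)

Definition legendre_lift (R : realType) (fr tg : 'rV[R]_2 -> 'rV[R]_6) :
    'rV[R]_2 -> 'M[R]_(2, 6) :=
  fun p => col_mx (fr p) (tg p).

(** An o(4,2)-valued 1-form is given by its components
    [eta 0 = eta(d/du)] and [eta 1 = eta(d/dv)]. *)
Definition form1_at (R : realType) (eta : 'I_2 -> 'rV[R]_2 -> 'M[R]_6)
    (p X : 'rV[R]_2) : 'M[R]_6 :=
  \sum_(i < 2) X 0 i *: eta i p.

(** q(X, Y) = tr (f -> f, sigma |-> eta(X) d_Y sigma).  When [F p] has rank 2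
    and the rows of [A] lie in its row space, [A *m pinvmx (F p)] is the
    coordinate matrix of the rows of [A] in the frame [F p]; so below is the
    matrix of the endomorphism in the frame.  As [eta(X)] takes values in
    f /\ f^perp it kills f, and the endomorphism does not depend on how vectors
    of f are extended to sections. *)
Definition q_tensor (R : realType) (F : 'rV[R]_2 -> 'M[R]_(2, 6))
    (eta : 'I_2 -> 'rV[R]_2 -> 'M[R]_6) (p X Y : 'rV[R]_2) : R :=
  \tr ('D_Y F p *m form1_at eta p X *m pinvmx (F p)).

Definition nondegenerate (R : realType) (b : 'rV[R]_2 -> 'rV[R]_2 -> R) : Prop :=
  forall X, (forall Y, b X Y = 0) -> X = 0.

(** [sig_pos b k] (resp. [sig_neg b k]): [b] is positive (resp. negative)
    definite on some subspace of dimension [k]; the signature of [b] is the pair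
    of the largest such [k]'s.  It is used for q only, which is symmetric. *)
Definition sig_pos (R : realType) (b : 'rV[R]_2 -> 'rV[R]_2 -> R) (k : nat) : Prop :=
  exists2 W : 'M[R]_(k, 2), row_free W &
    forall X, (X <= W)%MS -> X != 0 -> 0 < b X X.

Definition sig_neg (R : realType) (b : 'rV[R]_2 -> 'rV[R]_2 -> R) (k : nat) : Prop :=
  sig_pos (fun X Y => - b X Y) k.

Definition constant_signature (R : realType) (D : set 'rV[R]_2)
    (q : 'rV[R]_2 -> 'rV[R]_2 -> 'rV[R]_2 -> R) : Prop :=
  forall p r, D p -> D r -> forall k,
    (sig_pos (q p) k <-> sig_pos (q r) k) /\ (sig_neg (q p) k <-> sig_neg (q r) k).

(** The last clause is the standing assumption on the signature of q. *)
Definition lie_applicable_by (R : realType) (D : set 'rV[R]_2)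
    (F : 'rV[R]_2 -> 'M[R]_(2, 6)) (eta : 'I_2 -> 'rV[R]_2 -> 'M[R]_6) : Prop :=
  [/\ (forall i, smooth D (eta i)) /\
      (forall p, D p -> forall i, in_wedge (F p) (perp (F p)) (eta i p)),
      forall p, D p -> partial 0 (eta 1) p - partial 1 (eta 0) p = 0,
      forall p, D p -> forall X Y,
        2 *: lie_bracket (form1_at eta p X) (form1_at eta p Y) = 0,
      exists p X Y, D p /\ q_tensor F eta p X Y <> 0 &
      constant_signature D (q_tensor F eta)].

Definition on_dense_open_subset (R : realType) (D : set 'rV[R]_2)
    (P : 'rV[R]_2 -> Prop) : Prop :=
  exists O : set 'rV[R]_2,
    [/\ open O, O `<=` D, D `<=` closure O & forall p, O p -> P p].

Definition Omega_surface (R : realType) (D : set 'rV[R]_2)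
    (F : 'rV[R]_2 -> 'M[R]_(2, 6)) : Prop :=
  exists2 eta, lie_applicable_by D F eta &
    on_dense_open_subset D (fun p => nondegenerate (q_tensor F eta p)).

Definition Omega0_surface (R : realType) (D : set 'rV[R]_2)
    (F : 'rV[R]_2 -> 'M[R]_(2, 6)) : Prop :=
  exists2 eta, lie_applicable_by D F eta &
    on_dense_open_subset D (fun p => ~ nondegenerate (q_tensor F eta p)).

(** The equation for the labelling in which [i] is the index of the coordinate
    called u (with k1, E, U) and [j] that of the coordinate called v (with
    k2, G, V). *)
Definition demoulin_equation (R : realType) (D : set 'rV[R]_2)
    (fr : 'rV[R]_2 -> 'rV[R]_6) (i j : 'I_2) (k1 k2 : 'rV[R]_2 -> R)
    (eps : R[i]) (U V : R -> R) : Prop :=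
  let E (p : 'rV[R]_2) := form42 (partial i fr p) (partial i fr p) in
  let G (p : 'rV[R]_2) := form42 (partial j fr p) (partial j fr p) in
  let P (p : 'rV[R]_2) := V (p 0 j) / U (p 0 i) * (Num.sqrt (E p) / Num.sqrt (G p))
             * (partial i k1 p / (k1 p - k2 p)) in
  let Q (p : 'rV[R]_2) := U (p 0 i) / V (p 0 j) * (Num.sqrt (G p) / Num.sqrt (E p))
             * (partial j k2 p / (k1 p - k2 p)) in
  forall p, D p ->
    (partial j P p)%:C%C + eps ^+ 2 * (partial i Q p)%:C%C = 0.

Definition demoulin_labelled (R : realType) (D : set 'rV[R]_2)
    (fr : 'rV[R]_2 -> 'rV[R]_6) (i j : 'I_2) (k1 k2 : 'rV[R]_2 -> R)
    (eps : R[i]) : Prop :=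
  exists U V : R -> R,
    [/\ smooth1 [set p 0 i | p in D] U /\ smooth1 [set p 0 j | p in D] V,
        forall p, D p -> U (p 0 i) != 0, forall p, D p -> V (p 0 j) != 0 &
        demoulin_equation D fr i j k1 k2 eps U V].

Definition demoulin_surface (R : realType) (D : set 'rV[R]_2)
    (fr : 'rV[R]_2 -> 'rV[R]_6) (k1 k2 : 'rV[R]_2 -> R) (eps : R[i]) : Prop :=
  demoulin_labelled D fr 0 1 k1 k2 eps \/ demoulin_labelled D fr 1 0 k2 k1 eps.

(* Main.v *)
Require Import Defs.
From mathcomp Require Import all_boot all_order all_algebra.
From mathcomp Require Import all_classical all_reals all_analysis.
From mathcomp Require Import ring lra.
Import Order.TTheory GRing.Theory Num.Theory numFieldNormedType.Exports.
Set Implicit Arguments.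
Unset Strict Implicit.
Unset Printing Implicit Defensive.
Local Open Scope classical_set_scope.
Local Open Scope ring_scope.

(** Write f, t for the surface and its tangent plane congruence, (u, v) for the
    curvature line coordinates, E = (f_u, f_u), G = (f_v, f_v), d = k1 - k2, and
    s1 = t + k1 f, s2 = t + k2 f for the curvature spheres, which span the Legendre
    lift.  By Rodrigues' equations (s1)_u and (s2)_v are multiples of f; their
    compatibility gives (f_u, f_v) = 0, d f_uv = k2_u f_v - k1_v f_u, and the
    Codazzi equations E_v = - 2 k1_v E / d, G_u = 2 k2_u G / d [mixed_partial,
    partial_metric].  E and G are positive because the form has signature (4, 2)
    [null_pair_perp].

    Let eta be a closed 1-form with values in f /\ f^perp.  As f_uu and f_vv are
    independent modulo f^perp, closedness kills the components of eta(d_u) on f_v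
    and of eta(d_v) on f_u [off_diagonal].  Adding d (a f /\ t) for a suitable
    function a, which does not change q, brings eta into the normal form

      eta(d_u) = c s2 /\ f_u + e1 f /\ t,   eta(d_v) = b s1 /\ f_v + e2 f /\ t,

    for which q = c d E du^2 - b d G dv^2.  The remaining components of d eta = 0 say
    that q_uu depends on u only and q_vv on v only [diagonal_constant], that e1 and
    e2 are given by

      e1 = (b k1_u + c k2_u) / d,   e2 = - (b k1_v + c k2_v) / d

    [twist_gauge], and that (e1)_v = (e2)_u [twist_integrable].  Conversely these
    conditions make the normal form closed [normalized_form_closed], and
    [eta /\ eta] = 0 holds for it since eta(d_u) and eta(d_v) commute.

    Now let q_uu = al U^2 and q_vv = - be V^2 with constants al, be.  Substituting the
    Codazzi equations, (e1)_v - (e2)_u is a function without zeros times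

      be (V/U sqrt(E/G) k1_u / d)_v + al (U/V sqrt(G/E) k2_v / d)_u

    [twist_demoulin].  So Demoulin's equation with eps^2 = al / be is the
    integrability condition for a closed form with this q.

    Such constants and functions exist.  The signature of q is constant and D is
    connected: either q is non-degenerate everywhere, q_uu and q_vv have constant
    signs, and al = sign q_uu, be = - sign q_vv (eps = 1 or i); or q is degenerate
    and non-zero everywhere, the same entry of q vanishes throughout D, and this entry
    is made q_uu by the choice of the labelling, so that al = 0. *)

(** * Smooth functions of two variables *)

Section Calculus.
Variable R : realType.
Implicit Types (D : set 'rV[R]_2) (p : 'rV[R]_2) (i j : 'I_2).

Lemma open_near_eq (W : normedModType R) D (F G : 'rV[R]_2 -> W) p :
  open D -> (forall x, D x -> F x = G x) -> D p -> \near p, F p = G p.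
Proof.
move=> Do FG Dp; have : nbhs p D by exact: open_nbhs_nbhs.
by apply: filterS => x; exact: FG.
Qed.

Lemma eq_on_derivable (W : normedModType R) D (F G : 'rV[R]_2 -> W) p v :
  open D -> (forall x, D x -> F x = G x) -> D p ->
  derivable F p v -> derivable G p v.
Proof. by move=> Do FG Dp; apply: near_eq_derivable (open_near_eq Do FG Dp). Qed.

Lemma eq_on_derive (W : normedModType R) D (F G : 'rV[R]_2 -> W) p v :
  open D -> (forall x, D x -> F x = G x) -> D p -> 'D_v F p = 'D_v G p.
Proof. by move=> Do FG Dp; apply: near_eq_derive (open_near_eq Do FG Dp). Qed.

Lemma eq_on_continuous (W : normedModType R) D (F G : 'rV[R]_2 -> W) p :
  open D -> (forall x, D x -> F x = G x) -> D p ->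
  {for p, continuous F} -> {for p, continuous G}.
Proof.
move=> Do FG Dp Fc; have FGn := open_near_eq Do FG Dp.
rewrite /prop_for /continuous_at -(FG _ Dp).
by apply: cvg_trans Fc; exact: (near_eq_cvg FGn).
Qed.

Lemma class_C_ext (W : normedModType R) D (F G : 'rV[R]_2 -> W) k :
  open D -> (forall x, D x -> F x = G x) -> class_C k D F -> class_C k D G.
Proof.
move=> Do; elim: k F G => [|k IH] F G FG /=.
  by move=> Fc p Dp; exact: eq_on_continuous Do FG Dp (Fc p Dp).
move=> [dF cF]; split=> [i p Dp|i]; first exact: eq_on_derivable Do FG Dp (dF i p Dp).
by apply: IH (cF i) => x Dx; exact: eq_on_derive FG Dx.
Qed.

Lemma smooth_ext (W : normedModType R) D (F G : 'rV[R]_2 -> W) :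
  open D -> (forall x, D x -> F x = G x) -> smooth D F -> smooth D G.
Proof. by move=> Do FG sF k; exact: class_C_ext (sF k). Qed.

Lemma smooth_partial (W : normedModType R) D (F : 'rV[R]_2 -> W) i :
  smooth D F -> smooth D (partial i F).
Proof. by move=> sF k; have [_] := sF k.+1; exact. Qed.

Lemma smooth_derivable (W : normedModType R) D (F : 'rV[R]_2 -> W) i p :
  smooth D F -> D p -> derivable F p (delta_mx 0 i).
Proof. by move=> sF Dp; have [+ _] := sF 1%N; exact. Qed.

Lemma smooth_continuous (W : normedModType R) D (F : 'rV[R]_2 -> W) p :
  smooth D F -> D p -> {for p, continuous F}.
Proof. by move=> sF Dp; exact: (sF 0%N). Qed.

Lemma smooth_is_derive (W : normedModType R) D (F : 'rV[R]_2 -> W) i p :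
  smooth D F -> D p -> is_derive p (delta_mx 0 i) F (partial i F p).
Proof. by move=> sF Dp; apply: derivableP; exact: smooth_derivable sF Dp. Qed.

Lemma partial_mx m n (F : 'rV[R]_2 -> 'M[R]_(m, n)) i p :
  derivable F p (delta_mx 0 i) ->
  partial i F p = \matrix_(a, b) partial i (fun x => F x a b) p.
Proof. exact: derive_mx. Qed.

Lemma cvg_mx (T : Type) (FT : set_system T) {FF : Filter FT} m n
    (F : T -> 'M[R]_(m, n)) (M : 'M[R]_(m, n)) :
  (forall a b, F x a b @[x --> FT] --> M a b) -> F x @[x --> FT] --> M.
Proof.
move=> Fc; apply/cvgrPdist_le => /= e e0; near=> x.
rewrite /Num.Def.normr/= mx_normrE (bigmax_le _ (ltW e0))//= => i _.
rewrite !mxE/=; move: i; near: x; apply: filter_forall => /= i.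
exact: ((cvgrPdist_le _ _).1 (Fc i.1 i.2)).
Unshelve. all: by end_near. Qed.

Lemma continuous_mxP m n (F : 'rV[R]_2 -> 'M[R]_(m, n)) p :
  {for p, continuous F} <-> forall a b, {for p, continuous (fun x => F x a b)}.
Proof.
split=> [Fc a b|Fc]; last exact: (@cvg_mx _ (nbhs p) _ m n F (F p) Fc).
by apply: (@continuous_comp _ _ _ F (fun M => M a b)) => //; exact: coord_continuous.
Qed.

Lemma class_C_mxP m n D (F : 'rV[R]_2 -> 'M[R]_(m, n)) k : open D ->
  class_C k D F <-> forall a b, class_C k D (fun x => F x a b).
Proof.
move=> Do; elim: k F => [|k IH] F /=.
  split=> [Fc a b p Dp|Fc p Dp]; first exact: (continuous_mxP F p).1 (Fc p Dp) a b.
  by apply: (continuous_mxP F p).2 => a b; exact: Fc.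
split=> [[dF cF] a b|dF].
  split=> [i p Dp|i]; first exact: (derivable_mxP _ _ _).1 (dF i p Dp) a b.
  have /IH/(_ a b) := cF i; apply: class_C_ext => // x Dx.
  by rewrite partial_mx ?mxE //; exact: dF.
have dF' i p : D p -> derivable F p (delta_mx 0 i).
  by move=> Dp; apply: (derivable_mxP _ _ _).2 => a b; exact: (dF a b).1.
split=> // i; apply/IH => a b; have [_ /(_ i)] := dF a b.
by apply: class_C_ext => // x Dx; rewrite partial_mx ?mxE //; exact: dF'.
Qed.

Lemma smooth_mxP m n D (F : 'rV[R]_2 -> 'M[R]_(m, n)) : open D ->
  smooth D F <-> forall a b, smooth D (fun x => F x a b).
Proof.
move=> Do; split=> [sF a b k|sF k]; first by have /class_C_mxP := sF k; exact.
by apply/class_C_mxP => // a b; exact: sF.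
Qed.

Section Rules.
Variables (p v : 'rV[R]_2).
Implicit Types F G : 'rV[R]_2 -> R.

Lemma is_derive_csts (c : R) : is_derive p v (fun=> c) 0.
Proof. exact: is_derive_cst. Qed.

Lemma is_derive_add F G a b : is_derive p v F a -> is_derive p v G b ->
  is_derive p v (fun x => F x + G x) (a + b).
Proof. exact: is_deriveD. Qed.

Lemma is_derive_opp F a : is_derive p v F a ->
  is_derive p v (fun x => - F x) (- a).
Proof. exact: is_deriveN. Qed.

Lemma is_derive_mul F G a b : is_derive p v F a -> is_derive p v G b ->
  is_derive p v (fun x => F x * G x) (F p * b + G p * a).
Proof. exact: is_deriveM. Qed.

Lemma is_derive_inv F a : F p != 0 -> is_derive p v F a ->
  is_derive p v (fun x => (F x)^-1) (- a / F p ^+ 2).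
Proof.
move=> F0 [dF <-]; split; first exact: derivableV.
by rewrite deriveV // scaleNr mulNr mulrC.
Qed.

Lemma is_derive_exp2 F a : is_derive p v F a ->
  is_derive p v (fun x => F x ^+ 2) (2 * F p * a).
Proof.
move=> dF; apply: is_derive_eq (is_derive_mul dF dF) _.
by rewrite -mulrDl -mulr2n [2 * _]mulr_natl.
Qed.

(** The one-variable theory (chain rule, mean value theorem) applies to functions
    on the plane through their restrictions to lines. *)
Lemma is_derive_line (W : normedModType R) (F : 'rV[R]_2 -> W) (s : R) a :
  is_derive (p + s *: v) v F a <->
  is_derive s 1 (fun h : R => F (p + h *: v)) a.
Proof.
have E : (fun h : R => h^-1 *: (((fun h => F (p + h *: v)) \o shift s) (h *: 1) -
   F (p + s *: v))) = (fun h => h^-1 *: ((F \o shift (p + s *: v)) (h *: v) - F (p + s *: v))).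
  apply/funext => h /=; congr (_ *: (F _ - _)).
  by rewrite scalerDl [h *: 1]mulr1 addrCA addrA.
by split=> -[]; rewrite /derivable /derive ?E => dF <-; split;
  rewrite /derivable /derive ?E.
Qed.

Lemma is_derive_sqrt F a : 0 < F p -> is_derive p v F a ->
  is_derive p v (fun x => Num.sqrt (F x)) (a / (2 * Num.sqrt (F p))).
Proof.
have -> : F p = F (p + (0 : R) *: v) by rewrite scale0r addr0.
have E : p = p + (0 : R) *: v by rewrite scale0r addr0.
move=> F0 dF; have dl : is_derive (0 : R) 1 (fun h : R => F (p + h *: v)) a.
  by apply: (is_derive_line F 0 a).1; rewrite -E.
rewrite [X in is_derive X]E.
apply: (is_derive_line (fun x => Num.sqrt (F x)) 0 _).2.
rewrite mulrC; exact: is_derive1_comp (is_derive1_sqrt F0) dl.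
Qed.

End Rules.

Section SmoothAlgebra.
Variable D : set 'rV[R]_2.
Hypothesis Dopen : open D.
Implicit Types F G : 'rV[R]_2 -> R.

(** The partial derivatives of such an expression are again such expressions, so
    that all orders of differentiability are obtained by one induction. *)
Inductive smooth_expr : ('rV[R]_2 -> R) -> Prop :=
| expr_base F : smooth D F -> smooth_expr F
| expr_cst c : smooth_expr (fun=> c)
| expr_add F G : smooth_expr F -> smooth_expr G ->
    smooth_expr (fun p => F p + G p)
| expr_mul F G : smooth_expr F -> smooth_expr G ->
    smooth_expr (fun p => F p * G p)
| expr_inv F : smooth_expr F -> (forall p, D p -> F p != 0) ->
    smooth_expr (fun p => (F p)^-1)
| expr_sqrt F : smooth_expr F -> (forall p, D p -> 0 < F p) ->
    smooth_expr (fun p => Num.sqrt (F p)).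

Lemma smooth_expr_continuous F p : smooth_expr F -> D p -> {for p, continuous F}.
Proof.
move=> eF Dp; elim: eF => {F}.
- by move=> F sF; exact: smooth_continuous sF Dp.
- by move=> c; exact: cst_continuous.
- by move=> F G _ cF _ cG; exact: continuousD.
- by move=> F G _ cF _ cG; exact: continuousM.
- by move=> F _ cF F0; apply: continuousV => //; exact: F0.
- by move=> F _ cF _; apply: continuous_comp cF _; exact: sqrt_continuous.
Qed.

Lemma smooth_expr_derive F i : smooth_expr F ->
  exists2 G, smooth_expr G & forall p, D p -> is_derive p (delta_mx 0 i) F (G p).
Proof.
elim=> {F}.
- move=> F sF; exists (partial i F); first exact/expr_base/smooth_partial.
  by move=> p Dp; exact: smooth_is_derive.
- by move=> c; exists (fun=> 0) => [|p _]; [exact: expr_cst|exact: is_derive_csts].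
- move=> F G _ [F' eF' dF] _ [G' eG' dG]; exists (fun p => F' p + G' p).
    exact: expr_add.
  by move=> p Dp; apply: is_derive_add; [exact: dF|exact: dG].
- move=> F G eF [F' eF' dF] eG [G' eG' dG].
  exists (fun p => F p * G' p + G p * F' p).
    by apply: expr_add; exact: expr_mul.
  by move=> p Dp; apply: is_derive_mul; [exact: dF|exact: dG].
- move=> F eF [F' eF' dF] F0.
  exists (fun p => (-1 * F' p) * ((F p)^-1 * (F p)^-1)).
    apply: expr_mul; first by apply: expr_mul => //; exact: expr_cst.
    by apply: expr_mul; exact: expr_inv.
  move=> p Dp; apply: is_derive_eq (is_derive_inv (F0 p Dp) (dF p Dp)) _.
  by rewrite mulN1r expr2 invfM.
- move=> F eF [F' eF' dF] F0; exists (fun p => F' p * (2 * Num.sqrt (F p))^-1).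
    apply: expr_mul => //; apply: expr_inv => [|p Dp].
      by apply: expr_mul; [exact: expr_cst|exact: expr_sqrt].
    by rewrite mulf_neq0 ?pnatr_eq0 // gt_eqF // sqrtr_gt0 F0.
  by move=> p Dp; exact: is_derive_sqrt (F0 p Dp) (dF p Dp).
Qed.

Lemma smooth_exprW F : smooth_expr F -> smooth D F.
Proof.
move=> + k; elim: k F => [|k IH] F eF /=.
  by move=> p; exact: smooth_expr_continuous.
split=> i => [p Dp|]; have [G eG dG] := smooth_expr_derive i eF.
  by have [] := dG p Dp.
by apply: class_C_ext (IH G eG) => // p Dp; have [_ <-] := dG p Dp.
Qed.

Lemma smooth_cst (c : R) : smooth D (fun=> c).
Proof. exact/smooth_exprW/expr_cst. Qed.

Lemma smooth_add F G : smooth D F -> smooth D G -> smooth D (fun p => F p + G p).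
Proof. by move=> sF sG; apply/smooth_exprW/expr_add; exact: expr_base. Qed.

Lemma smooth_mul F G : smooth D F -> smooth D G -> smooth D (fun p => F p * G p).
Proof. by move=> sF sG; apply/smooth_exprW/expr_mul; exact: expr_base. Qed.

Lemma smooth_opp F : smooth D F -> smooth D (fun p => - F p).
Proof.
move=> sF; apply: (@smooth_ext _ _ (fun p => -1 * F p)) => //.
  by move=> p _; rewrite mulN1r.
exact/smooth_mul/sF/smooth_cst.
Qed.

Lemma smooth_inv F : smooth D F -> (forall p, D p -> F p != 0) ->
  smooth D (fun p => (F p)^-1).
Proof. by move=> sF F0; apply/smooth_exprW/expr_inv => //; exact: expr_base. Qed.

Lemma smooth_sqrt F : smooth D F -> (forall p, D p -> 0 < F p) ->
  smooth D (fun p => Num.sqrt (F p)).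
Proof. by move=> sF F0; apply/smooth_exprW/expr_sqrt => //; exact: expr_base. Qed.

Lemma smooth_sum (I : Type) (r : seq I) (H : I -> 'rV[R]_2 -> R) :
  (forall l, smooth D (H l)) -> smooth D (fun p => \sum_(l <- r) H l p).
Proof.
move=> sH; elim: r => [|l r IH].
  by apply: (@smooth_ext _ _ (fun=> 0)); [|move=> x _; rewrite big_nil|exact: smooth_cst].
apply: (@smooth_ext _ _ (fun x => H l x + \sum_(l <- r) H l x)) => //.
  by move=> x _; rewrite big_cons.
exact: smooth_add.
Qed.

Lemma smooth_cstmx m n (A : 'M[R]_(m, n)) : smooth D (fun=> A).
Proof. by apply/smooth_mxP => // a b; exact: smooth_cst. Qed.

Lemma smooth_addmx m n (A B : 'rV[R]_2 -> 'M[R]_(m, n)) :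
  smooth D A -> smooth D B -> smooth D (fun p => A p + B p).
Proof.
move=> /smooth_mxP sA /smooth_mxP sB; apply/smooth_mxP => // a b.
apply: (@smooth_ext _ _ (fun p => A p a b + B p a b)) => //.
  by move=> x _; rewrite mxE.
by apply: smooth_add; [exact: sA|exact: sB].
Qed.

Lemma smooth_scalemx m n F (A : 'rV[R]_2 -> 'M[R]_(m, n)) :
  smooth D F -> smooth D A -> smooth D (fun p => F p *: A p).
Proof.
move=> sF /smooth_mxP sA; apply/smooth_mxP => // a b.
apply: (@smooth_ext _ _ (fun p => F p * A p a b)) => //.
  by move=> x _; rewrite mxE.
by apply: smooth_mul => //; exact: sA.
Qed.

Lemma smooth_oppmx m n (A : 'rV[R]_2 -> 'M[R]_(m, n)) :
  smooth D A -> smooth D (fun p => - A p).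
Proof.
move=> sA; apply: (@smooth_ext _ _ (fun p => (-1) *: A p)) => //.
  by move=> p _; rewrite scaleN1r.
exact/smooth_scalemx/sA/smooth_cst.
Qed.

Lemma smooth_trmx m n (A : 'rV[R]_2 -> 'M[R]_(m, n)) :
  smooth D A -> smooth D (fun p => (A p)^T).
Proof.
move=> /smooth_mxP sA; apply/smooth_mxP => // a b.
apply: (@smooth_ext _ _ (fun p => A p b a)) => //.
  by move=> x _; rewrite mxE.
exact: sA.
Qed.

Lemma smooth_mulmx m n l (A : 'rV[R]_2 -> 'M[R]_(m, n))
    (B : 'rV[R]_2 -> 'M[R]_(n, l)) :
  smooth D A -> smooth D B -> smooth D (fun p => A p *m B p).
Proof.
move=> /smooth_mxP sA /smooth_mxP sB; apply/smooth_mxP => // a b.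
apply: (@smooth_ext _ _ (fun p => \sum_c A p a c * B p c b)) => //.
  by move=> x _; rewrite mxE.
by apply: smooth_sum => c; apply: smooth_mul; [exact: sA|exact: sB].
Qed.

Lemma smooth_form42 (a b : 'rV[R]_2 -> 'rV[R]_6) :
  smooth D a -> smooth D b -> smooth D (fun p => form42 (a p) (b p)).
Proof.
move=> sa sb; apply: (smooth_mxP _ Dopen).1; apply: smooth_mulmx.
  by apply: smooth_mulmx => //; exact: smooth_cstmx.
exact: smooth_trmx.
Qed.

Lemma smooth_wedge (a b : 'rV[R]_2 -> 'rV[R]_6) :
  smooth D a -> smooth D b -> smooth D (fun p => wedge (a p) (b p)).
Proof.
move=> sa sb; apply: smooth_addmx; last apply: smooth_oppmx;
  by do 2?[apply: smooth_mulmx => //]; try exact: smooth_trmx; exact: smooth_cstmx.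
Qed.

End SmoothAlgebra.

Section MatrixRules.
Variables (p v : 'rV[R]_2).

Lemma is_derive_mxP m n (F : 'rV[R]_2 -> 'M[R]_(m, n)) (A : 'M[R]_(m, n)) :
  is_derive p v F A <->
  forall a b, is_derive p v (fun x => F x a b) (A a b).
Proof.
split=> [[dF <-] a b|dF].
  by rewrite derive_mx // mxE; apply: derivableP; exact: (derivable_mxP _ _ _).1.
have d : derivable F p v.
  by apply: (derivable_mxP _ _ _).2 => a b; have [] := dF a b.
split=> //; rewrite derive_mx //; apply/matrixP => a b; rewrite mxE.
by have [] := dF a b.
Qed.

Lemma is_derive_addmx m n (F G : 'rV[R]_2 -> 'M[R]_(m, n)) A B :
  is_derive p v F A -> is_derive p v G B ->
  is_derive p v (fun x => F x + G x) (A + B).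
Proof. exact: is_deriveD. Qed.

Lemma is_derive_oppmx m n (F : 'rV[R]_2 -> 'M[R]_(m, n)) A :
  is_derive p v F A -> is_derive p v (fun x => - F x) (- A).
Proof. exact: is_deriveN. Qed.

Lemma is_derive_sums (I : Type) (r : seq I) (H : I -> 'rV[R]_2 -> R) (h : I -> R) :
  (forall l, is_derive p v (H l) (h l)) ->
  is_derive p v (fun x => \sum_(l <- r) H l x) (\sum_(l <- r) h l).
Proof.
move=> dH; elim: r => [|l r IH].
  rewrite big_nil (_ : (fun x => _) = (fun=> 0)); first exact: is_derive_csts.
  by apply/funext => x; rewrite big_nil.
rewrite big_cons (_ : (fun x => _) = (fun x => H l x + \sum_(l <- r) H l x)).
  exact: is_derive_add.
by apply/funext => x; rewrite big_cons.
Qed.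

Lemma is_derive_mulmx m n l (F : 'rV[R]_2 -> 'M[R]_(m, n))
    (G : 'rV[R]_2 -> 'M[R]_(n, l)) A B :
  is_derive p v F A -> is_derive p v G B ->
  is_derive p v (fun x => F x *m G x) (A *m G p + F p *m B).
Proof.
move=> /is_derive_mxP dF /is_derive_mxP dG; apply/is_derive_mxP => a b.
rewrite (_ : (fun x => _) = (fun x => \sum_c F x a c * G x c b)); last first.
  by apply/funext => x; rewrite mxE.
rewrite !mxE -big_split /=; apply: is_derive_sums => c.
apply: is_derive_eq (is_derive_mul (dF a c) (dG c b)) _.
by rewrite addrC [G p c b * _]mulrC.
Qed.

Lemma is_derive_trmx m n (F : 'rV[R]_2 -> 'M[R]_(m, n)) A :
  is_derive p v F A -> is_derive p v (fun x => (F x)^T) A^T.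
Proof.
move=> /is_derive_mxP dF; apply/is_derive_mxP => a b; rewrite mxE.
by rewrite (_ : (fun x => _) = (fun x => F x b a)) //; apply/funext => x; rewrite mxE.
Qed.

Lemma is_derive_scalemx m n (F : 'rV[R]_2 -> R) (G : 'rV[R]_2 -> 'M[R]_(m, n)) a B :
  is_derive p v F a -> is_derive p v G B ->
  is_derive p v (fun x => F x *: G x) (a *: G p + F p *: B).
Proof.
move=> dF /is_derive_mxP dG; apply/is_derive_mxP => i j.
rewrite (_ : (fun x => _) = (fun x => F x * G x i j)); last first.
  by apply/funext => x; rewrite mxE.
rewrite !mxE; apply: is_derive_eq (is_derive_mul dF (dG i j)) _.
by rewrite addrC [G p i j * _]mulrC.
Qed.

Lemma is_derive_cstmx m n (A : 'M[R]_(m, n)) : is_derive p v (fun=> A) 0.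
Proof. exact: is_derive_cst. Qed.

Lemma is_derive_form42 (a b : 'rV[R]_2 -> 'rV[R]_6) da db :
  is_derive p v a da -> is_derive p v b db ->
  is_derive p v (fun x => form42 (a x) (b x)) (form42 da (b p) + form42 (a p) db).
Proof.
move=> dera derb.
have := is_derive_mulmx (is_derive_mulmx dera (is_derive_cstmx (gram42 R)))
   (is_derive_trmx derb).
rewrite mulmx0 addr0 => /is_derive_mxP /(_ 0 0).
by rewrite mxE.
Qed.

Lemma is_derive_wedge (a b : 'rV[R]_2 -> 'rV[R]_6) da db :
  is_derive p v a da -> is_derive p v b db ->
  is_derive p v (fun x => wedge (a x) (b x)) (wedge da (b p) + wedge (a p) db).
Proof.
have H (c d : 'rV[R]_2 -> 'rV[R]_6) dc dd : is_derive p v c dc ->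
   is_derive p v d dd -> is_derive p v (fun x => gram42 R *m (c x)^T *m d x)
     (gram42 R *m dc^T *m d p + gram42 R *m (c p)^T *m dd).
  move=> derc derd; apply: is_derive_mulmx => //.
  have := is_derive_mulmx (is_derive_cstmx (gram42 R)) (is_derive_trmx derc).
  by rewrite mul0mx add0r.
move=> dera derb; have := is_derive_addmx (H _ _ _ _ dera derb)
  (is_derive_oppmx (H _ _ _ _ derb dera)).
by move/is_derive_eq; apply; rewrite /wedge opprD [X in _ + X]addrC addrACA.
Qed.

End MatrixRules.

End Calculus.
Arguments is_derive_line {R p v W}.

(** * Directional and mixed derivatives *)

Section Analysis.
Variable R : realType.
Implicit Types (D : set 'rV[R]_2) (p : 'rV[R]_2) (i j : 'I_2).

Lemma mvt01 (g dg : R -> R) :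
  (forall s : R, 0 <= s <= 1 -> is_derive s 1 g (dg s)) ->
  exists2 s : R, 0 <= s <= 1 & g 1 - g 0 = dg s.
Proof.
move=> dG; have [||s s01 ->] := @MVT_segment _ g dg 0 1 ler01.
- by move=> s; rewrite in_itv /= => /andP[s0 s1]; apply: dG; rewrite !ltW.
- apply: derivable_within_continuous => s; rewrite in_itv /= => s01.
  by have [] := dG s s01.
by exists s; [move: s01; rewrite in_itv|rewrite subr0 mulr1].
Qed.

Lemma is_derive_scale_dir (F : 'rV[R]_2 -> R) p v (h a : R) :
  is_derive p v F a -> is_derive p (h *: v) F (h * a).
Proof.
have E w : p = p + (0 : R) *: w by rewrite scale0r addr0.
rewrite {1}(E v) => /(is_derive_line F 0 a).1 dF.
rewrite (E (h *: v)); apply: (is_derive_line F 0 _).2.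
have dh : is_derive (0 : R) 1 (fun s : R => s * h) h.
  have := is_deriveM (is_derive_id (0 : R) 1) (is_derive_cst h (0 : R) 1).
  by move/is_derive_eq; apply; rewrite scaler0 add0r [_ *: _]mulr1.
have dF' : is_derive ((0 : R) * h) 1 (fun s : R => F (p + s *: v)) a by rewrite mul0r.
rewrite mulrC; have := @is_derive1_comp _ (fun s : R => F (p + s *: v)) ( *%R^~ h) 0 a h dF' dh.
by rewrite (_ : _ \o _ = (fun s : R => F (p + s *: (h *: v)))) //;
  apply/funext => s /=; rewrite scalerA.
Qed.

Lemma mvt_line D (F : 'rV[R]_2 -> R) p i (h : R) :
  smooth D F -> (forall s : R, 0 <= s <= 1 -> D (p + s *: (h *: delta_mx 0 i))) ->
  exists2 s : R, 0 <= s <= 1 &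
    F (p + h *: delta_mx 0 i) - F p =
    h * partial i F (p + s *: (h *: delta_mx 0 i)).
Proof.
move=> sF sD.
have [|s s01] := @mvt01 (fun s => F (p + s *: (h *: delta_mx 0 i)))
  (fun s => h * partial i F (p + s *: (h *: delta_mx 0 i))).
  move=> s s01; apply: (is_derive_line F s _).1; apply: is_derive_scale_dir.
  exact: smooth_is_derive sF (sD s s01).
by rewrite scale1r scale0r addr0 => E; exists s.
Qed.

Lemma nbhs_box p (P : set 'rV[R]_2) : nbhs p P ->
  exists2 r : R, 0 < r & forall x : 'rV[R]_2, (forall i, `|x 0 i - p 0 i| < r) -> P x.
Proof.
move=> /nbhs_ballP[r /= r0 rP]; exists r => // x xp; apply: rP; split=> // a b.
by rewrite ord1 /ball /= distrC; exact: xp.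
Qed.

Lemma delta_row i j : (delta_mx 0 i : 'rV[R]_2) 0 j = (j == i)%:R.
Proof. by rewrite mxE eqxx. Qed.

Lemma row2E (v : 'rV[R]_2) : v = v 0 0 *: delta_mx 0 0 + v 0 1 *: delta_mx 0 1.
Proof.
by rewrite {1}[v]row_sum_delta !big_ord_recl big_ord0 addr0; congr (_ + _ *: delta_mx 0 _);
  [congr (v 0 _)|]; apply/val_inj.
Qed.

Lemma cases2 (P : 'I_2 -> Prop) : P 0 -> P 1 -> forall i, P i.
Proof.
move=> P0 P1 [[|[|n]] Hn] //; [rewrite (_ : Ordinal _ = 0)|rewrite (_ : Ordinal _ = 1)] => //;
  exact/val_inj.
Qed.

Lemma coord_shift p i (a : R) j :
  (p + a *: delta_mx 0 i) 0 j = p 0 j + a * (j == i)%:R.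
Proof. by rewrite !mxE eqxx. Qed.

Lemma normM01 (s a : R) : 0 <= s <= 1 -> `|s * a| <= `|a|.
Proof.
by move=> /andP[s0 s1]; rewrite normrM ger0_norm // ler_piMl.
Qed.

Lemma difference_quotient (h a b X Y u w z : R) : h != 0 ->
  u - w = h * a * X -> z - u = h * b * Y -> h^-1 *: (z - w) = a * X + b * Y.
Proof.
move=> h0 Eu Ez; apply: (mulfI h0); rewrite [h^-1 *: _]/(h^-1 * _) mulVKf //.
have -> : z - w = (z - u) + (u - w) by ring.
by rewrite Eu Ez; ring.
Qed.

Lemma gradient_estimate (a b A B X Y e : R) : 0 < e ->
  `|A - X| <= e / (`|a| + `|b| + 1) -> `|B - Y| <= e / (`|a| + `|b| + 1) ->
  `|a * A + b * B - (a * X + b * Y)| <= e.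
Proof.
move=> e0; set M := _ + 1 => AX BY.
have M0 : 0 < M by rewrite ltr_wpDl // addr_ge0.
have -> : a * A + b * B - (a * X + b * Y) = a * (A - X) + b * (B - Y) by ring.
apply: le_trans (ler_normD _ _) _; rewrite !normrM.
apply: (@le_trans _ _ (`|a| * (e / M) + `|b| * (e / M))).
  by apply: lerD; rewrite ler_wpM2l.
rewrite -mulrDl mulrA ler_pdivrMr // mulrC ler_wpM2l ?ltW //.
by rewrite /M ltrDl.
Qed.

(** Continuous partial derivatives make every directional derivative linear in the
    direction: the increment along v is split into two increments along the
    axes, and the mean value theorem applies to each. *)
Lemma is_derive_gradient D (F : 'rV[R]_2 -> R) p (v : 'rV[R]_2) :
  open D -> smooth D F -> D p ->
  is_derive p v F (v 0 0 * partial 0 F p + v 0 1 * partial 1 F p).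
Proof.
move=> Do sF Dp; set L := (X in is_derive _ _ _ X).
have main : (fun h : R => h^-1 *: (F (h *: v + p) - F p)) @ 0^' --> L.
  apply/cvgrPdist_le => /= e e0.
  pose M : R := `|v 0 0| + `|v 0 1| + 1.
  have M0 : (0 : R) < M by rewrite ltr_wpDl // addr_ge0.
  have eM : 0 < e / M by rewrite divr_gt0.
  have near_d i : \forall x \near p, `|partial i F p - partial i F x| <= e / M.
    have /cvgrPdist_le := smooth_continuous (smooth_partial i sF) Dp.
    exact.
  have nD : nbhs p D by exact: open_nbhs_nbhs.
  have [r r0 rP] := nbhs_box (filterI nD (filterI (near_d 0) (near_d 1))).
  near=> h.
  have h0 : h != 0 by near: h; exact: nbhs_dnbhs_neq.
  have hr : `|h| < r / M by near: h; apply: dnbhs0_lt; rewrite divr_gt0.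
  have hM : `|h| * M < r by rewrite -ltr_pdivlMr.
  have hv i : `|h * v 0 i| < r.
    apply: le_lt_trans hM; rewrite normrM ler_wpM2l // /M.
    by move: i; apply: cases2; have := normr_ge0 (v 0 0);
      have := normr_ge0 (v 0 1); lra.
  have hp : p + (h * v 0 0) *: delta_mx 0 0 + (h * v 0 1) *: delta_mx 0 1 = h *: v + p.
    by rewrite -addrA addrC [v in RHS]row2E scalerDr !scalerA.
  have in0 (s : R) : 0 <= s <= 1 ->
    forall i, `|(p + s *: ((h * v 0 0) *: delta_mx 0 0)) 0 i - p 0 i| < r.
    move=> s01; apply: cases2; rewrite scalerA coord_shift [_ + _ - _]addrAC subrr add0r.
      by rewrite mulr1; apply: le_lt_trans (normM01 _ s01) (hv 0).
    by rewrite mulr0 normr0.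
  have in1 (s : R) : 0 <= s <= 1 -> forall i,
    `|(p + (h * v 0 0) *: delta_mx 0 0 + s *: ((h * v 0 1) *: delta_mx 0 1)) 0 i - p 0 i| < r.
    move=> s01; apply: cases2; rewrite scalerA !coord_shift.
      by rewrite mulr1 mulr0 addr0 [_ + _ - _]addrAC subrr add0r.
    rewrite mulr0 addr0 mulr1 [_ + _ - _]addrAC subrr add0r.
    exact: le_lt_trans (normM01 _ s01) (hv 1).
  have [|s s01 Es] := @mvt_line D F p 0 (h * v 0 0) sF.
    by move=> s s01; have [] := rP _ (in0 s s01).
  have [|t t01 Et] := @mvt_line D F (p + (h * v 0 0) *: delta_mx 0 0) 1 (h * v 0 1) sF.
    by move=> t t01; have [] := rP _ (in1 t t01).
  have [_ [d0 _]] := rP _ (in0 s s01).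
  have [_ [_ d1]] := rP _ (in1 t t01).
  move: Es Et d0 d1; rewrite hp.
  set X := partial 0 F (p + s *: _); set Y := partial 1 F (_ + t *: _).
  move=> Es Et d0 d1.
  rewrite (difference_quotient h0 Es Et).
  exact: gradient_estimate e0 d0 d1.
split; first by apply/cvg_ex; exists L.
exact: cvg_lim main.
Unshelve. all: by end_near. Qed.

Lemma second_difference_sym (h a b c d a' X Y : R) : 0 < h -> a' = a ->
  a - b - (c - d) = h * (h * X) -> a' - c - (b - d) = h * (h * Y) -> X = Y.
Proof.
move=> h0 -> EX EY; apply: (mulfI (lt0r_neq0 h0)); apply: (mulfI (lt0r_neq0 h0)).
by rewrite -EX -EY; ring.
Qed.

Lemma close_values_eq (A B y x : R) :
  `|A - y| < `|A - B| / 2 -> `|B - x| < `|A - B| / 2 -> x = y -> A = B.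
Proof.
move=> Ay Bx xy; move: Bx; rewrite xy distrC => Bx.
by have := ler_distD y A B; move: (`|A - B|) (`|A - y|) (`|y - B|) Ay Bx => u v w; lra.
Qed.

Lemma add_addK (a b c : R) : a + b + c - a = b + c.
Proof. ring. Qed.

(** The left-hand side is unchanged when i and j are exchanged, whereas the
    right-hand side then contains the derivatives in the other order. *)
Lemma second_difference D (F : 'rV[R]_2 -> R) p i j (h : R) :
  smooth D F -> 0 < h -> i != j ->
  (forall x : 'rV[R]_2, (forall l, `|x 0 l - p 0 l| <= h) -> D x) ->
  exists2 x : 'rV[R]_2, (forall l, `|x 0 l - p 0 l| <= h) &
    F (p + h *: delta_mx 0 i + h *: delta_mx 0 j) - F (p + h *: delta_mx 0 i)
     - (F (p + h *: delta_mx 0 j) - F p) = h * (h * partial j (partial i F) x).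
Proof.
move=> sF h0 ij inD.
have box (s t : R) : 0 <= s <= 1 -> 0 <= t <= 1 ->
    forall l, `|(p + s *: (h *: delta_mx 0 i) + t *: (h *: delta_mx 0 j)) 0 l - p 0 l| <= h.
  move=> s01 t01 l; rewrite !scalerA !coord_shift.
  rewrite add_addK.
  have [->|li] := eqVneq l i.
    by rewrite (negbTE ij) mulr1 mulr0 addr0 -[leRHS](gtr0_norm h0); exact: normM01.
  rewrite mulr0 add0r -[leRHS](gtr0_norm h0).
  by case: (l == j); rewrite ?mulr1 ?mulr0 ?normr0 //; exact: normM01.
have [|s s01 Es] := @mvt01
  (fun s => F (p + h *: delta_mx 0 j + s *: (h *: delta_mx 0 i)) -
            F (p + s *: (h *: delta_mx 0 i)))
  (fun s => h * partial i F (p + h *: delta_mx 0 j + s *: (h *: delta_mx 0 i)) -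
            h * partial i F (p + s *: (h *: delta_mx 0 i))).
  have dline (q : 'rV[R]_2) (s : R) : D (q + s *: (h *: delta_mx 0 i)) ->
      is_derive s 1 (fun s : R => F (q + s *: (h *: delta_mx 0 i)))
        (h * partial i F (q + s *: (h *: delta_mx 0 i))).
    move=> Dq; apply: (is_derive_line F s _).1; apply: is_derive_scale_dir.
    exact: smooth_is_derive sF Dq.
  move=> s s01; apply: is_deriveB.
    apply: dline; apply: inD => l.
    by have := box s 1 s01; rewrite scale1r addrAC ler01 lexx; exact.
  apply: dline; apply: inD => l.
  by have := box s 0 s01; rewrite scale0r addr0 ler01 lexx; exact.
have [|t t01 Et] := @mvt_line D (partial i F) (p + s *: (h *: delta_mx 0 i)) j h (smooth_partial i sF).
  by move=> t t01; apply: inD; exact: box.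
exists (p + s *: (h *: delta_mx 0 i) + t *: (h *: delta_mx 0 j)); first exact: box.
move: Es; rewrite scale1r scale0r !addr0 => Es.
rewrite [p + h *: delta_mx 0 i + h *: _]addrAC Es -Et mulrBr.
by rewrite [p + h *: delta_mx 0 j + _]addrAC.
Qed.

(** Both mixed derivatives are limits of the same second difference quotient. *)
Lemma schwarz D (F : 'rV[R]_2 -> R) p i j : open D -> smooth D F -> D p ->
  partial i (partial j F) p = partial j (partial i F) p.
Proof.
move=> Do sF Dp; have [->//|ij] := eqVneq i j.
pose A : R := partial i (partial j F) p; pose B : R := partial j (partial i F) p.
rewrite -/A -/B.
have [//|AB] := eqVneq A B.
have e0 : 0 < `|A - B| / 2 by rewrite divr_gt0 // normr_gt0 subr_eq0.
have near_d k l : \forall x \near p,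
    `|partial k (partial l F) p - partial k (partial l F) x| < `|A - B| / 2.
  have /cvgrPdist_lt := smooth_continuous (smooth_partial k (smooth_partial l sF)) Dp.
  exact.
have nD : nbhs p D by exact: open_nbhs_nbhs.
have [r r0 rP] := nbhs_box (filterI nD (filterI (near_d i j) (near_d j i))).
have h0 : 0 < r / 2 by rewrite divr_gt0.
have hr (y : R) : `|y| <= r / 2 -> `|y| < r.
  by move=> /le_lt_trans; apply; clear -r0; lra.
have inD (x : 'rV[R]_2) : (forall l, `|x 0 l - p 0 l| <= r / 2) -> D x.
  by move=> xp; have [] := rP x (fun l => hr _ (xp l)).
(* The two points x and y are close to p, and the values there are equal. *)
have [x xp Ex] := second_difference sF h0 ij inD.
have ji : j != i by rewrite eq_sym.
have [y yp Ey] := second_difference sF h0 ji inD.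
have [_ [dy _]] := rP y (fun l => hr _ (yp l)).
have [_ [_ dx]] := rP x (fun l => hr _ (xp l)).
have E : partial j (partial i F) x = partial i (partial j F) y.
  by apply: (second_difference_sym h0 _ Ex Ey); congr (F _); rewrite addrAC.
by have := close_values_eq dy dx E.
Qed.

Lemma schwarz_mx D m n (F : 'rV[R]_2 -> 'M[R]_(m, n)) p i j :
  open D -> smooth D F -> D p ->
  partial i (partial j F) p = partial j (partial i F) p.
Proof.
move=> Do sF Dp; have sE a b := (smooth_mxP F Do).1 sF a b.
have H k l a b : partial k (partial l F) p a b = partial k (partial l (fun x => F x a b)) p.
  rewrite partial_mx; last by apply: smooth_derivable Dp; exact: smooth_partial.
  rewrite mxE; apply: (@eq_on_derive _ _ D) => // x Dx.
  by rewrite partial_mx ?mxE //; exact: smooth_derivable Dx.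
apply/matrixP => a b; have E := schwarz i j Do (sE a b) Dp.
exact: etrans (H i j a b) (etrans E (esym (H j i a b))).
Qed.

End Analysis.

(** * Functions of one coordinate and connectedness *)

Section OneVariable.
Variable R : realType.
Implicit Types (D : set 'rV[R]_2) (p r : 'rV[R]_2) (i j : 'I_2).

Lemma other_index i j l : i != j -> l != i -> l = j.
Proof.
by move: i j l; do 3!apply: cases2.
Qed.

(** The segment from p to r is part of a coordinate line, so it stays in D, and F
    has derivative zero along it. *)
Lemma coordinate_only D (F : 'rV[R]_2 -> R) i j p r :
  coordinate_domain D -> smooth D F -> i != j ->
  (forall x, D x -> partial i F x = 0) -> D p -> D r -> p 0 j = r 0 j ->
  F p = F r.
Proof.
move=> [_ _ _ Dseg] sF ij F0 Dp Dr pr.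
have E : r = p + (r 0 i - p 0 i) *: delta_mx 0 i.
  apply/rowP => l; rewrite coord_shift.
  have [->|/(other_index ij) ->] := eqVneq l i; first by rewrite mulr1 addrC subrK.
  by rewrite mulr0 addr0.
have E' : (r 0 i - p 0 i) *: delta_mx 0 i = r - p.
  by rewrite {2}E [_ - p]addrAC subrr add0r.
have [|s s01] := @mvt_line _ D F p i (r 0 i - p 0 i) sF.
  by move=> s s01; rewrite E'; exact: Dseg pr _ s01.
rewrite -E F0 ?mulr0; first by move/eqP; rewrite subr_eq0 => /eqP.
by rewrite E'; exact: Dseg pr _ s01.
Qed.

(** On the line through p in the direction j, the function g of the coordinate is
    the restriction of F; so g inherits the derivatives of F, of all orders in
    the next lemma. *)
Lemma is_derive_coord D (F : 'rV[R]_2 -> R) (g : R -> R) j p :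
  open D -> smooth D F -> (forall x, D x -> F x = g (x 0 j)) -> D p ->
  is_derive (p 0 j) 1 g (partial j F p).
Proof.
move=> Do sF Fg Dp.
have nD : nbhs p D by exact: open_nbhs_nbhs.
have [r r0 rP] := nbhs_box nD.
(* The base point of the line is chosen so that its parameter is the coordinate j. *)
pose q := p - p 0 j *: delta_mx 0 j.
have qE (h : R) : q + h *: delta_mx 0 j = p + (h - p 0 j) *: delta_mx 0 j.
  by rewrite scalerBl addrA [RHS]addrAC.
have dF : is_derive (p 0 j) 1 (fun h : R => F (q + h *: delta_mx 0 j)) (partial j F p).
  apply: (is_derive_line F _ _).1.
  by rewrite qE subrr scale0r addr0; exact: smooth_is_derive.
apply: near_eq_is_derive dF.
near=> h.
have hr : `|h - p 0 j| < r.
  by rewrite distrC; near: h; apply: cvgr_dist_lt => //; exact: cvg_id.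
rewrite Fg qE.
  by rewrite coord_shift eqxx mulr1 addrC subrK.
apply: rP => l; rewrite coord_shift addrAC subrr add0r.
by case: (l == j); rewrite ?mulr1 ?mulr0 ?normr0.
Unshelve. all: by end_near. Qed.

Lemma smooth1_of_smooth D (F : 'rV[R]_2 -> R) (g : R -> R) j :
  open D -> smooth D F -> (forall x, D x -> F x = g (x 0 j)) ->
  smooth1 [set x 0 j | x in D] g.
Proof.
move=> Do sF Fg.
have iter_sF n : smooth D (iter n (partial j) F).
  by elim: n => //= n IH; exact: smooth_partial.
have iter_g n x : D x -> iter n (partial j) F x = (derive1n n g) (x 0 j).
  elim: n x => [|n IH] x Dx; first by rewrite derive1n0 -Fg.
  rewrite derive1nS derive1E /=.
  by have [_ ->] := is_derive_coord Do (iter_sF n) IH Dx.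
move=> n _ [x Dx <-].
by have [] := is_derive_coord Do (iter_sF n) (iter_g n) Dx.
Qed.

Lemma smooth_of_smooth1 D (g : R -> R) j : open D ->
  smooth1 [set x 0 j | x in D] g -> smooth D (fun x => g (x 0 j)).
Proof.
move=> Do sg k.
suff : forall n, class_C k D (fun x : 'rV[R]_2 => (derive1n n g) (x 0 j)) by move/(_ 0%N).
elim: k => [|k IH] n /=.
  move=> p Dp; apply: (@continuous_comp _ _ _ (fun x : 'rV[R]_2 => x 0 j)).
    exact: coord_continuous.
  by apply/differentiable_continuous/derivable1_diffP/sg; exists p.
have dg l p : D p -> is_derive p (delta_mx 0 l)
    (fun x : 'rV[R]_2 => (derive1n n g) (x 0 j)) ((j == l)%:R * (derive1n n.+1 g) (p 0 j)).
  move=> Dp; rewrite [X in is_derive X](_ : p = p + (0 : R) *: delta_mx 0 l);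
    last by rewrite scale0r addr0.
  apply: (is_derive_line (fun x : 'rV[R]_2 => (derive1n n g) (x 0 j)) 0 _).2.
  have -> : (fun h : R => (derive1n n g) ((p + h *: delta_mx 0 l) 0 j)) =
    (derive1n n g) \o (fun h : R => p 0 j + h * (j == l)%:R).
    by apply/funext => h /=; rewrite coord_shift.
  have dl : is_derive (0 : R) 1 (fun h : R => p 0 j + h * (j == l)%:R) (j == l)%:R.
    pose c : R := (j == l)%:R; pose a : R := p 0 j.
    have := is_deriveD (is_derive_cst a (0 : R) 1)
      (is_deriveM (is_derive_id (0 : R) 1) (is_derive_cst c (0 : R) 1)).
    by move/is_derive_eq; apply; rewrite scaler0 !add0r [_ *: _]mulr1.
  have Dg : is_derive (p 0 j + (0 : R) * (j == l)%:R) 1 (derive1n n g) ((derive1n n.+1 g) (p 0 j)).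
    rewrite mul0r addr0 derive1nS derive1E; apply: derivableP.
    by apply: sg; exists p.
  rewrite mulrC.
  exact: (@is_derive1_comp _ (derive1n n g) (fun h : R => p 0 j + h * (j == l)%:R) 0 _ _ Dg dl).
split=> l => [p Dp|]; first by have [] := dg l p Dp.
apply: (@class_C_ext _ _ _ (fun x : 'rV[R]_2 => (j == l)%:R * (derive1n n.+1 g) (x 0 j))) => //.
  by move=> p Dp; have [_ <-] := dg l p Dp.
case: (j == l).
  by apply: class_C_ext (IH n.+1) => // x _; rewrite mul1r.
by apply: class_C_ext (smooth_cst Do 0 k) => // x _; rewrite mul0r.
Qed.

Lemma partial_coord D (g : R -> R) i j p : open D -> i != j ->
  smooth1 [set x 0 j | x in D] g -> D p -> partial i (fun x => g (x 0 j)) p = 0.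
Proof.
move=> Do ij sg Dp.
have := smooth_is_derive i (smooth_of_smooth1 Do sg) Dp.
have Ep : p = p + (0 : R) *: delta_mx 0 i by rewrite scale0r addr0.
rewrite {1}Ep => /(is_derive_line (fun x : 'rV[R]_2 => g (x 0 j)) 0 _).1 [_].
rewrite (_ : (fun h : R => _) = cst (g (p 0 j))); first by rewrite derive_cst.
apply/funext => h; rewrite coord_shift eq_sym (negbTE ij) mulr0 addr0 //.
Qed.

Lemma function_of_coordinate D (F : 'rV[R]_2 -> R) i j :
  coordinate_domain D -> smooth D F -> i != j ->
  (forall x, D x -> partial i F x = 0) ->
  exists2 g : R -> R, smooth1 [set x 0 j | x in D] g &
    forall x, D x -> F x = g (x 0 j).
Proof.
move=> cD sF ij F0; have [Do _ _ _] := cD.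
pose g (y : R) := F (xget 0 [set x : 'rV[R]_2 | D x /\ x 0 j = y]).
have Fg x : D x -> F x = g (x 0 j).
  move=> Dx; rewrite /g; case: xgetP => [z _ [Dz zx]|/(_ x)[]//].
  by apply: (coordinate_only cD sF ij F0) => //; rewrite zx.
by exists g => //; exact: smooth1_of_smooth sF Fg.
Qed.

(** Two open sets that cover D and are disjoint on D cut D into open and closed
    pieces. *)
Lemma connected_cover D (A B : set 'rV[R]_2) : connected D -> open A -> open B ->
  D `<=` A `|` B -> (forall x, D x -> A x -> B x -> False) ->
  D `<=` A \/ D `<=` B.
Proof.
move=> Dc oA oB DAB AB.
have [[a [Da Aa]]|noA] := pselect (exists a, D a /\ A a); last first.
  by right=> x Dx; have [Ax|//] := DAB x Dx; case: noA; exists x.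
left; have <- : D `&` A = D; last by move=> x [].
apply: Dc; first by exists a.
  by exists A.
exists (~` B); first exact: open_closedC.
apply/seteqP; split=> x [Dx].
  by move=> Ax; split=> // Bx; exact: AB Bx.
by move=> nBx; split=> //; have [|] := DAB x Dx.
Qed.

Lemma open_neq0 D (F : 'rV[R]_2 -> R) : open D -> smooth D F ->
  open [set x | D x /\ F x != 0].
Proof.
move=> Do sF; rewrite openE => x [Dx Fx].
have nD : nbhs x D by exact: open_nbhs_nbhs.
have nF : nbhs (F x) [set y | y != 0].
  by apply: open_nbhs_nbhs; split => //; exact: open_neq.
exact: filterI nD (smooth_continuous sF Dx nF).
Qed.

Lemma open_gt0 D (F : 'rV[R]_2 -> R) : open D -> smooth D F ->
  open [set x | D x /\ 0 < F x].
Proof.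
move=> Do sF; rewrite openE => x [Dx Fx].
have nD : nbhs x D by exact: open_nbhs_nbhs.
have nF : nbhs (F x) [set y | 0 < y].
  by apply: open_nbhs_nbhs; split => //; exact: open_gt.
exact: filterI nD (smooth_continuous sF Dx nF).
Qed.

Lemma constant_sign D (F : 'rV[R]_2 -> R) : open D -> connected D -> smooth D F ->
  (forall x, D x -> F x != 0) ->
  (forall x, D x -> 0 < F x) \/ (forall x, D x -> F x < 0).
Proof.
move=> Do Dc sF F0.
have [x Dx|x Dx|DP|DP] := @connected_cover D [set x | D x /\ 0 < F x]
    [set x | D x /\ 0 < - F x] Dc (open_gt0 Do sF) (open_gt0 Do (smooth_opp Do sF)).
- by have := F0 x Dx; rewrite neq_lt => /orP[Fx|Fx]; [right|left]; split;
    rewrite ?oppr_gt0.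
- by move=> [_ Fx] [_]; rewrite oppr_gt0 => /(lt_trans Fx); rewrite ltxx.
- by left=> x /DP[].
- by right=> x /DP[_]; rewrite oppr_gt0.
Qed.

End OneVariable.

(** * The quadratic space of signature (4,2) *)

Section Lorentz.
Variable R : realType.
Implicit Types (a b c x y f t q p : 'rV[R]_6) (A B : 'M[R]_6).

Lemma form42_sum a b :
  form42 a b = \sum_(i < 6) (if (i < 4)%N then 1 else -1) * (a 0 i * b 0 i).
Proof.
rewrite /form42 mxE; apply: eq_bigr => i _.
by rewrite mul_mx_diag !mxE mulrAC [RHS]mulrC.
Qed.

Lemma form42C a b : form42 a b = form42 b a.
Proof. by rewrite !form42_sum; apply: eq_bigr => i _; rewrite [a 0 i * _]mulrC. Qed.

Lemma form42Dl a b c : form42 (a + b) c = form42 a c + form42 b c.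
Proof. by rewrite /form42 !mulmxDl mxE. Qed.

Lemma form42Dr a b c : form42 c (a + b) = form42 c a + form42 c b.
Proof. by rewrite !(form42C c) form42Dl. Qed.

Lemma form42Zl (k : R) a b : form42 (k *: a) b = k * form42 a b.
Proof. by rewrite /form42 -!scalemxAl mxE. Qed.

Lemma form42Zr (k : R) a b : form42 a (k *: b) = k * form42 a b.
Proof. by rewrite !(form42C a) form42Zl. Qed.

Lemma form42Nl a b : form42 (- a) b = - form42 a b.
Proof. by rewrite -scaleN1r form42Zl mulN1r. Qed.

Lemma form42Nr a b : form42 a (- b) = - form42 a b.
Proof. by rewrite !(form42C a) form42Nl. Qed.

Lemma form420l a : form42 0 a = 0.
Proof. by rewrite -(scale0r 0) form42Zl mul0r. Qed.

Lemma form420r a : form42 a 0 = 0.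
Proof. by rewrite form42C form420l. Qed.

Definition form42_lin := (form42Dl, form42Dr, form42Zl, form42Zr, form42Nl,
  form42Nr, form420l, form420r).

Lemma gram42K : gram42 R *m gram42 R = 1%:M.
Proof.
rewrite /gram42 mulmx_diag -[RHS]diag_const_mx; congr diag_mx.
by apply/rowP => i; rewrite !mxE; case: ifP => _; rewrite ?mulr1 ?mulrNN ?mulr1.
Qed.

Lemma form42_wedge x y a b :
  form42 (x *m wedge a b) y = form42 a x * form42 b y - form42 b x * form42 a y.
Proof. by rewrite wedgeE !form42_lin. Qed.

Let i4 : 'I_6 := inord 4.
Let i5 : 'I_6 := inord 5.

(** Coordinates 4 and 5 carry the negative part of the form. *)
Lemma form42_spacelike x : x 0 i4 = 0 -> x 0 i5 = 0 ->
  0 <= form42 x x /\ (form42 x x = 0 -> x = 0).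
Proof.
move=> x4 x5.
have E : form42 x x = \sum_(i < 6) x 0 i ^+ 2.
  rewrite form42_sum; apply: eq_bigr => i _; rewrite -expr2.
  case: ifPn => [_|]; first by rewrite mul1r.
  rewrite -leqNgt => i_ge4.
  have -> : x 0 i = 0; last by rewrite expr0n mulr0.
  have [i_eq4|i_ne4] := eqVneq (i : nat) 4%N.
    by rewrite (_ : i = i4) //; apply/val_inj; rewrite /= inordK.
  rewrite (_ : i = i5) //; apply/val_inj; rewrite /= inordK //.
  by move: (ltn_ord i) i_ge4 i_ne4; case: (i : nat) => [|[|[|[|[|[|]]]]]].
rewrite E; split; first by apply: sumr_ge0 => i _; exact: sqr_ge0.
move=> s0; apply/rowP => i; rewrite mxE; apply/eqP; rewrite -sqrf_eq0.
by rewrite (psumr_eq0P _ s0) // => l _; exact: sqr_ge0.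
Qed.

(** The negative parts of a null pair are independent: a combination of f and t
    with negative part zero is isotropic and lies in a positive definite space,
    so it vanishes. *)
Lemma null_pair_det f t :
  form42 f f = 0 -> form42 f t = 0 -> form42 t t = 0 ->
  (forall al be : R, al *: f + be *: t = 0 -> al = 0 /\ be = 0) ->
  f 0 i4 * t 0 i5 - f 0 i5 * t 0 i4 != 0.
Proof.
move=> ff ft tt indep; apply/eqP => det0.
have null (al be : R) : al * f 0 i4 + be * t 0 i4 = 0 ->
    al * f 0 i5 + be * t 0 i5 = 0 -> al = 0 /\ be = 0.
  move=> n4 n5; apply: indep.
  have [||_] := @form42_spacelike (al *: f + be *: t); rewrite ?mxE //.
  by apply; rewrite !form42_lin (form42C t f) ff ft tt; ring.
have [| |/= t4 /eqP] := null (t 0 i4) (- f 0 i4).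
- ring.
- by rewrite -[RHS]oppr0 -det0; ring.
rewrite oppr_eq0 => /eqP f4.
have [| |/= t5 /eqP] := null (t 0 i5) (- f 0 i5).
- by rewrite -[RHS]det0; ring.
- ring.
rewrite oppr_eq0 => /eqP f5.
have [||/eqP] := null 1 0; rewrite ?oner_eq0 // ?f4 ?f5; ring.
Qed.

(** A vector y orthogonal to an isotropic plane can be corrected by an element of
    the plane so that its negative part vanishes, without changing (y, y): the
    form induced on the quotient of the orthogonal space by the plane is positive
    definite.  This makes the metric of the surface positive. *)
Lemma null_pair_perp f t y :
  form42 f f = 0 -> form42 f t = 0 -> form42 t t = 0 ->
  (forall al be : R, al *: f + be *: t = 0 -> al = 0 /\ be = 0) ->
  form42 y f = 0 -> form42 y t = 0 ->
  0 <= form42 y y /\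
  (form42 y y = 0 -> exists al be : R, y = al *: f + be *: t).
Proof.
move=> ff ft tt indep yf yt.
have det := null_pair_det ff ft tt indep.
set d := (X in X != 0) in det.
pose al := (y 0 i4 * t 0 i5 - y 0 i5 * t 0 i4) / d.
pose be := (f 0 i4 * y 0 i5 - f 0 i5 * y 0 i4) / d.
have [||ge0 eq0] := @form42_spacelike (y - (al *: f + be *: t)).
- by rewrite !mxE /al /be /d; field.
- by rewrite !mxE /al /be /d; field.
have E : form42 (y - (al *: f + be *: t)) (y - (al *: f + be *: t)) = form42 y y.
  rewrite !form42_lin (form42C t f) (form42C f y) (form42C t y) ff ft tt yf yt; ring.
rewrite -E; split=> // /eq0 /eqP; rewrite subr_eq0 => /eqP ->.
by exists al, be.
Qed.

(** The Gram matrix of (f, t, q, p) is invertible because (f, t) is an isotropic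
    pair dual, up to sign, to (q, p), whatever the values of (q, q), (q, p) and
    (p, p); a and b span the orthogonal complement. *)
Lemma frame_nondegenerate f t q p a b x :
  [/\ form42 f f = 0, form42 f t = 0 & form42 t t = 0] ->
  [/\ form42 f q = -1, form42 f p = 0, form42 t q = 0 & form42 t p = -1] ->
  [/\ form42 a f = 0, form42 a t = 0, form42 a q = 0 & form42 a p = 0] ->
  [/\ form42 b f = 0, form42 b t = 0, form42 b q = 0 & form42 b p = 0] ->
  [/\ form42 a b = 0, form42 a a != 0 & form42 b b != 0] ->
  [/\ form42 x f = 0, form42 x t = 0 & form42 x q = 0] ->
  [/\ form42 x p = 0, form42 x a = 0 & form42 x b = 0] -> x = 0.
Proof.
move=> [ff ft tt] [fq fp tq tp] [af at_ aq ap] [bf bt bq bp] [ab aa bb]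
  [xf xt xq] [xp xa xb].
pose s := [:: f; t; q; p; a; b].
pose M : 'M[R]_6 := \matrix_(i < 6) nth 0 s i.
have Mfree : row_free M.
  apply: inj_row_free => c; rewrite mulmx_sum_row.
  rewrite !big_ord_recl big_ord0 !rowK /= => cM.
  have pair y : form42 (\sum_(i < 6) c 0 i *: row i M) y = 0.
    by rewrite !big_ord_recl big_ord0 !rowK /= cM form420l.
  move: {cM} pair; rewrite !big_ord_recl big_ord0 !rowK /=.
  set c0 := c 0 _; set c1 := c 0 _; set c2 := c 0 _; set c3 := c 0 _;
    set c4 := c 0 _; set c5 := c 0 _ => pair.
  have c2_0 : c2 = 0.
    have := pair f; rewrite !form42_lin ff af bf (form42C t f) (form42C q f)
      (form42C p f) ft fq fp => E; rewrite -[LHS]opprK -[RHS]oppr0 -[in RHS]E; ring.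
  have c3_0 : c3 = 0.
    have := pair t; rewrite !form42_lin tt at_ bt (form42C q t)
      (form42C p t) ft tq tp => E; rewrite -[LHS]opprK -[RHS]oppr0 -[in RHS]E; ring.
  have c0_0 : c0 = 0.
    have := pair q; rewrite !form42_lin c2_0 c3_0 fq tq aq bq => E.
    by rewrite -[LHS]opprK -[RHS]oppr0 -[in RHS]E; ring.
  have c1_0 : c1 = 0.
    have := pair p; rewrite !form42_lin c2_0 c3_0 fp tp ap bp => E.
    by rewrite -[LHS]opprK -[RHS]oppr0 -[in RHS]E; ring.
  have c4_0 : c4 = 0.
    apply: (mulIf aa); have := pair a; rewrite !form42_lin c2_0 c3_0
      (form42C f) (form42C t) (form42C b) af at_ ab => E.
    by rewrite mul0r -[RHS]E; ring.
  have c5_0 : c5 = 0.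
    apply: (mulIf bb); have := pair b; rewrite !form42_lin c2_0 c3_0
      (form42C f) (form42C t) bf bt ab => E.
    by rewrite mul0r -[RHS]E; ring.
  apply/rowP => i; rewrite mxE.
  case: i => [[|[|[|[|[|[|n]]]]]] Hi] //;
    [rewrite -[RHS]c0_0|rewrite -[RHS]c1_0|rewrite -[RHS]c2_0|rewrite -[RHS]c3_0
    |rewrite -[RHS]c4_0|rewrite -[RHS]c5_0]; congr (c 0 _); exact/val_inj.
have xM : x *m gram42 R *m M^T = 0.
  apply/rowP => i; rewrite [RHS]mxE.
  have -> : (x *m gram42 R *m M^T) 0 i = form42 x (row i M).
    by rewrite /form42 [LHS]mxE [RHS]mxE; apply: eq_bigr => l _; rewrite !mxE.
  rewrite rowK.
  by case: i => [[|[|[|[|[|[|n]]]]]] Hi].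
have Munit : M^T \in unitmx by rewrite unitmx_tr -row_free_unit.
have : x *m gram42 R *m M^T *m invmx M^T *m gram42 R = 0 by rewrite xM !mul0mx.
by rewrite mulmxK // -mulmxA gram42K mulmx1.
Qed.

Lemma sub_col_mx2P f t x : reflect (exists al be : R, x = al *: f + be *: t)
  (x <= col_mx f t)%MS.
Proof.
apply: (iffP idP) => [/submxP[c ->]|[al [be ->]]].
  exists ((lsubmx c) 0 0), ((rsubmx c) 0 0).
  rewrite -{1}[c]hsubmxK mul_row_col.
  by rewrite {1}[lsubmx c]mx11_scalar {1}[rsubmx c]mx11_scalar !mul_scalar_mx.
by rewrite addmx_sub // scalemx_sub //; apply: (submx_trans _ (submx_refl _));
  rewrite -addsmxE ?addsmxSl ?addsmxSr.
Qed.

Lemma sub_perpP f t x :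
  reflect (form42 x f = 0 /\ form42 x t = 0) (x <= perp (col_mx f t))%MS.
Proof.
have E : x *m (gram42 R *m (col_mx f t)^T) =
    row_mx (form42 x f)%:M (form42 x t)%:M.
  rewrite tr_col_mx mulmxA mul_mx_row /form42.
  by congr row_mx; exact: mx11_scalar.
rewrite /perp; apply: (iffP sub_kermxP); rewrite E.
  rewrite -(row_mx0 R 1 1 1) => /eq_row_mx[/matrixP/(_ 0 0) + /matrixP/(_ 0 0)].
  by rewrite !mxE !eqxx !mulr1n.
by move=> [-> ->]; rewrite !raddf0 row_mx0.
Qed.

Lemma in_wedge2 m n (S : 'M[R]_(m, 6)) (T : 'M[R]_(n, 6)) s1 t1 s2 t2 :
  (s1 <= S)%MS -> (t1 <= T)%MS -> (s2 <= S)%MS -> (t2 <= T)%MS ->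
  in_wedge S T (wedge s1 t1 + wedge s2 t2).
Proof.
move=> sS1 tT1 sS2 tT2.
exists 2%N, (fun l => if l == 0 then s1 else s2), (fun l => if l == 0 then t1 else t2).
by split=> [l|l|]; [case: ifP|case: ifP|rewrite !big_ord_recl big_ord0 addr0].
Qed.

(** Everything that the proof needs to know about the elements of f /\ f^perp,
    f being spanned by f and t: they are skew, kill the plane, and map its
    orthogonal space into the plane. *)
Definition skew_on_perp f t A : Prop :=
  [/\ forall x y, form42 (x *m A) y = - form42 (y *m A) x,
      f *m A = 0 /\ t *m A = 0 &
      forall x y, form42 x f = 0 -> form42 x t = 0 ->
        form42 y f = 0 -> form42 y t = 0 -> form42 (x *m A) y = 0].

Lemma in_wedge_perp f t A :
  form42 f f = 0 -> form42 f t = 0 -> form42 t t = 0 ->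
  in_wedge (col_mx f t) (perp (col_mx f t)) A -> skew_on_perp f t A.
Proof.
move=> ff ft tt [k [s [r [sS rT ->]]]].
elim/big_rec: _ => [|l B _ [skB [fB tB] pB]].
  by split=> [x y||x y *]; rewrite ?mulmx0 ?form420l ?oppr0.
have /sub_col_mx2P[al [be ->]] := sS l.
have /sub_perpP[rf rt] := rT l.
split=> [x y||x y xf xt yf yt].
- rewrite [in LHS]mulmxDr [in RHS]mulmxDr [in LHS]form42Dl [in RHS]form42Dl (skB x).
  rewrite !form42_wedge opprD; congr (_ + _).
  by rewrite opprB (form42C _ y) (form42C _ y) (form42C _ x) (form42C _ x) mulrC
    [X in _ - X]mulrC.
- rewrite [f *m _]mulmxDr [t *m _]mulmxDr fB tB !addr0 !wedgeE rf rt !scale0r !subr0 !form42_lin.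
  by rewrite ff ft tt (form42C t f) ft !mulr0 addr0 scale0r.
- rewrite mulmxDr form42Dl pB // addr0 form42_wedge !form42_lin.
  rewrite (form42C f x) (form42C t x) (form42C f y) (form42C t y) xf xt yf yt.
  by rewrite !mulr0 addr0 mul0r mulr0 subr0.
Qed.

End Lorentz.

(** * Surfaces in curvature line coordinates *)

Section FormCalculus.
Variables (R : realType) (D : set 'rV[R]_2).
Hypothesis Do : open D.

Lemma partial_const_on (F : 'rV[R]_2 -> R) (c : R) l p :
  (forall x, D x -> F x = c) -> D p -> partial l F p = 0.
Proof.
move=> Fc Dp; rewrite /partial (eq_on_derive (G := cst c) _ Do Fc Dp).
exact: derive_cst.
Qed.

Lemma partial_form42 (a b : 'rV[R]_2 -> 'rV[R]_6) l p :
  smooth D a -> smooth D b -> D p ->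
  partial l (fun x => form42 (a x) (b x)) p =
  form42 (partial l a p) (b p) + form42 (a p) (partial l b p).
Proof.
move=> sa sb Dp.
by have [_] := is_derive_form42 (smooth_is_derive l sa Dp) (smooth_is_derive l sb Dp).
Qed.

Lemma partial_form42_cst (a b : 'rV[R]_2 -> 'rV[R]_6) (c : R) l p :
  smooth D a -> smooth D b -> (forall x, D x -> form42 (a x) (b x) = c) -> D p ->
  form42 (partial l a p) (b p) + form42 (a p) (partial l b p) = 0.
Proof.
by move=> sa sb abc Dp; rewrite -partial_form42 //; exact: partial_const_on abc Dp.
Qed.

Lemma partial_form42_cstr (a : 'rV[R]_2 -> 'rV[R]_6) (b : 'rV[R]_6) (c : R) l p :
  smooth D a -> (forall x, D x -> form42 (a x) b = c) -> D p ->
  form42 (partial l a p) b = 0.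
Proof.
move=> sa abc Dp.
have := partial_form42_cst l sa (smooth_cstmx Do b) abc Dp.
by rewrite [partial l (fun=> b) p]derive_cst form420r addr0.
Qed.

End FormCalculus.

(** Used for the equality of the mixed derivatives of the tangent plane congruence. *)
Lemma solve_mixed (R : nzRingType) (V : lmodType R) (a b c d : R) (x y z : V) :
  a *: x + c *: z = b *: y + d *: z -> (c - d) *: z = b *: y - a *: x.
Proof.
by move=> E; rewrite scalerBl -[c *: z](addKr (a *: x)) E addrA addrK addrC.
Qed.

(** The curvatures are indexed by the coordinate directions, so that exchanging the
    labels of the curvature directions is exchanging two indices. *)
Record principal_chart (R : realType) (D : set 'rV[R]_2) (q0 p0 : 'rV[R]_6)
    (fr tg : 'rV[R]_2 -> 'rV[R]_6) (k : 'I_2 -> 'rV[R]_2 -> R) : Prop := {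
  chart_domain : coordinate_domain D;
  chart_immersed : immersed_in D (space_form q0 p0) fr;
  chart_tangent : tangent_plane_congruence D (hyperplanes q0 p0) fr tg;
  chart_smooth : forall l, smooth D (k l);
  chart_rodrigues : forall l p, D p -> partial l tg p + k l p *: partial l fr p = 0;
  chart_umbilic_free : forall i j p, i != j -> D p -> k i p - k j p != 0 }.

Section Surface.
Variables (R : realType) (D : set 'rV[R]_2) (q0 p0 : 'rV[R]_6).
Variables (fr tg : 'rV[R]_2 -> 'rV[R]_6) (k : 'I_2 -> 'rV[R]_2 -> R).
Hypothesis S : principal_chart D q0 p0 fr tg k.
Implicit Types (p : 'rV[R]_2) (i j l : 'I_2).

Lemma chart_open : open D. Proof. by case: (chart_domain S). Qed.
Lemma fr_smooth : smooth D fr. Proof. by case: (chart_immersed S). Qed.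
Lemma tg_smooth : smooth D tg. Proof. by case: (chart_tangent S). Qed.
Lemma curvature_neq i j p : i != j -> D p -> k i p - k j p != 0.
Proof. exact: (chart_umbilic_free S). Qed.
Let Do := chart_open.

Lemma fiber_null p : D p ->
  [/\ form42 (fr p) (fr p) = 0, form42 (fr p) (tg p) = 0 & form42 (tg p) (tg p) = 0].
Proof.
move=> Dp; have [_ /(_ p Dp)[[_ ff] _ _] _] := chart_immersed S.
have [_ /(_ p Dp)[[_ tt] _ _] /(_ p Dp) tf _] := chart_tangent S.
by rewrite form42C in tf.
Qed.

Lemma fiber_normal p : D p ->
  [/\ form42 (fr p) q0 = -1, form42 (fr p) p0 = 0,
      form42 (tg p) q0 = 0 & form42 (tg p) p0 = -1].
Proof.
move=> Dp; have [_ /(_ p Dp)[_ fq fp] _] := chart_immersed S.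
by have [_ /(_ p Dp)[_ tq tp] _ _] := chart_tangent S.
Qed.

Lemma partial_tg l p : D p -> partial l tg p = - (k l p *: partial l fr p).
Proof. by move=> Dp; apply/eqP; rewrite -addr_eq0 (chart_rodrigues S). Qed.

Lemma tangent_normal l p : D p ->
  [/\ form42 (partial l fr p) (fr p) = 0, form42 (partial l fr p) (tg p) = 0,
      form42 (partial l fr p) q0 = 0 & form42 (partial l fr p) p0 = 0].
Proof.
move=> Dp; split.
- have ff x : D x -> form42 (fr x) (fr x) = 0 by move=> /fiber_null[].
  have := partial_form42_cst Do l fr_smooth fr_smooth ff Dp.
  rewrite [form42 (fr p) _]form42C -mulr2n -mulr_natl => /eqP.
  by rewrite mulf_eq0 pnatr_eq0 => /eqP.
- by have [_ _ _ /(_ p Dp l)] := chart_tangent S; rewrite form42C.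
- have fq x : D x -> form42 (fr x) q0 = -1 by move=> /fiber_normal[].
  exact: partial_form42_cstr fr_smooth fq Dp.
- have fp x : D x -> form42 (fr x) p0 = 0 by move=> /fiber_normal[].
  exact: partial_form42_cstr fr_smooth fp Dp.
Qed.

Lemma fiber_independent p (al be : R) : D p ->
  al *: fr p + be *: tg p = 0 -> al = 0 /\ be = 0.
Proof.
move=> Dp E; have [fq fp tq tp] := fiber_normal Dp.
split; apply/eqP.
  have := congr1 (fun x => form42 x q0) E; rewrite !form42_lin fq tq.
  by rewrite mulr0 addr0 mulrN1 => /eqP; rewrite oppr_eq0.
have := congr1 (fun x => form42 x p0) E; rewrite !form42_lin fp tp.
by rewrite mulr0 add0r mulrN1 => /eqP; rewrite oppr_eq0.
Qed.

Definition metric l p : R := form42 (partial l fr p) (partial l fr p).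

Lemma smooth_metric l : smooth D (metric l).
Proof. by apply: (smooth_form42 Do); apply/smooth_partial/fr_smooth. Qed.

Lemma metric_gt0 l p : D p -> 0 < metric l p.
Proof.
move=> Dp; have [ff ft tt] := fiber_null Dp.
have [yf yt yq yp] := tangent_normal l Dp.
have [ge0 eq0] := null_pair_perp ff ft tt (fun al be => @fiber_independent p al be Dp) yf yt.
rewrite lt_neqAle ge0 andbT eq_sym; apply/eqP => /eq0[al [be E]].
have [fq fp tq tp] := fiber_normal Dp.
move: yq yp; rewrite E !form42_lin fq fp tq tp !mulr0 addr0 add0r !mulrN1.
move=> /eqP; rewrite oppr_eq0 => /eqP al0 /eqP; rewrite oppr_eq0 => /eqP be0.
have [_ _ /(_ p Dp)/row_free_inj finj] := chart_immersed S.
have : (delta_mx 0 l : 'rV[R]_2) = 0.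
  apply: finj; rewrite mul0mx -rowE rowK E al0 be0 !scale0r addr0 //.
by move/rowP/(_ l); rewrite delta_row eqxx mxE => /eqP; rewrite oner_eq0.
Qed.

Lemma metric_neq0 l p : D p -> metric l p != 0.
Proof. by move=> Dp; rewrite gt_eqF // metric_gt0. Qed.

Lemma mixed_comm i j p : D p ->
  partial i (partial j fr) p = partial j (partial i fr) p.
Proof. by move=> Dp; exact: schwarz_mx i j Do fr_smooth Dp. Qed.

(** Differentiating (t, f_i) = 0 along j and (t, f_j) = 0 along i computes (t, f_ij)
    as k_j (f_i, f_j) and as k_i (f_i, f_j). *)
Lemma tangent_orthogonal i j p : i != j -> D p ->
  form42 (partial i fr p) (partial j fr p) = 0.
Proof.
move=> ij Dp.
have H l m : form42 (tg p) (partial m (partial l fr) p) =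
    k m p * form42 (partial m fr p) (partial l fr p).
  have tf x : D x -> form42 (tg x) (partial l fr x) = 0.
    by move=> Dx; have [_ _ _] := chart_tangent S; exact.
  have := partial_form42_cst Do m tg_smooth (smooth_partial l fr_smooth) tf Dp.
  by rewrite (partial_tg _ Dp) form42Nl form42Zl => /eqP; rewrite addrC subr_eq0 => /eqP.
have : (k i p - k j p) * form42 (partial i fr p) (partial j fr p) = 0.
  by rewrite mulrBl -H [X in _ - _ * X]form42C -H mixed_comm // subrr.
by move/eqP; rewrite mulf_eq0 (negbTE (curvature_neq ij Dp)) => /eqP.
Qed.

(** The equality of the mixed derivatives of t, by Rodrigues' equations. *)
Lemma mixed_partial i j p : i != j -> D p ->
  partial j (partial i fr) p =
  (k i p - k j p)^-1 *:
    (partial i (k j) p *: partial j fr p - partial j (k i) p *: partial i fr p).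
Proof.
move=> ij Dp.
have H l m : partial m (partial l tg) p =
   - (partial m (k l) p *: partial l fr p + k l p *: partial m (partial l fr) p).
  rewrite [LHS](eq_on_derive (G := fun x => - (k l x *: partial l fr x)) _ Do) //.
    have [_ ->] // := is_derive_oppmx (is_derive_scalemx
      (smooth_is_derive m (chart_smooth S l) Dp)
      (smooth_is_derive m (smooth_partial l fr_smooth) Dp)).
  by move=> x Dx; exact: partial_tg.
have := schwarz_mx i j Do tg_smooth Dp; rewrite (H j i) (H i j) => /eqP.
rewrite eqr_opp (mixed_comm i j Dp) => /eqP E.
by rewrite -(solve_mixed (esym E)) scalerA mulVf ?scale1r //; exact: curvature_neq.
Qed.

Lemma mixed_form i j p y : i != j -> D p ->
  form42 (partial j (partial i fr) p) y =
  (partial i (k j) p * form42 (partial j fr p) y -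
   partial j (k i) p * form42 (partial i fr p) y) / (k i p - k j p).
Proof.
move=> ij Dp; rewrite (mixed_partial ij Dp).
move: (partial i fr p) (partial j fr p) => x z.
by rewrite form42Zl form42Dl form42Nl !form42Zl mulrC.
Qed.

Lemma mixed_metric i j p : i != j -> D p ->
  form42 (partial j (partial i fr) p) (partial i fr p) =
  - (partial j (k i) p * metric i p / (k i p - k j p)).
Proof.
move=> ij Dp; rewrite (mixed_form _ ij Dp) /metric.
have := tangent_orthogonal ij Dp; move: (partial i fr p) (partial j fr p) => x z xz.
by rewrite [form42 z x]form42C xz mulr0 sub0r mulNr.
Qed.

(** The Codazzi equations in curvature line coordinates. *)
Lemma partial_metric i j p : i != j -> D p ->
  partial j (metric i) p = - 2 * (partial j (k i) p * metric i p / (k i p - k j p)).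
Proof.
move=> ij Dp; have sFi := smooth_partial i fr_smooth.
rewrite (partial_form42 j sFi sFi Dp).
have := mixed_metric ij Dp; rewrite -/(metric i p).
move: (partial j (partial i fr) p) (partial i fr p) => x z xz.
by rewrite [form42 z x]form42C xz -opprD -mulr2n mulNr mulr_natl.
Qed.

(** The first two products determine f_ii modulo f^perp: it is (f_i, f_i) q0 -
    k_i (f_i, f_i) p0.  In particular f_uu and f_vv are independent modulo f^perp. *)
Lemma second_partial i j p : i != j -> D p ->
  let Fii := partial i (partial i fr) p in
  [/\ form42 Fii (fr p) = - metric i p, form42 Fii (tg p) = k i p * metric i p,
      form42 Fii q0 = 0, form42 Fii p0 = 0 &
      form42 Fii (partial j fr p) =
        partial j (k i) p * metric i p / (k i p - k j p)].
Proof.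
move=> ij Dp Fii; rewrite /Fii {Fii}; have sFi := smooth_partial i fr_smooth.
have T x : D x -> _ := @tangent_normal i x.
split.
- have H x : D x -> form42 (partial i fr x) (fr x) = 0 by move=> /T[].
  have := partial_form42_cst Do i sFi fr_smooth H Dp.
  by move/eqP; rewrite addr_eq0 => /eqP.
- have H x : D x -> form42 (partial i fr x) (tg x) = 0 by move=> /T[].
  have := partial_form42_cst Do i sFi tg_smooth H Dp.
  rewrite (partial_tg _ Dp) /metric.
  move: (partial i (partial i fr) p) (partial i fr p) => x z.
  by rewrite form42Nr form42Zr => /eqP; rewrite subr_eq0 => /eqP.
- have H x : D x -> form42 (partial i fr x) q0 = 0 by move=> /T[].
  exact: partial_form42_cstr sFi H Dp.
- have H x : D x -> form42 (partial i fr x) p0 = 0 by move=> /T[].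
  exact: partial_form42_cstr sFi H Dp.
- have H x : D x -> form42 (partial i fr x) (partial j fr x) = 0.
    exact: tangent_orthogonal.
  have := partial_form42_cst Do i sFi (smooth_partial j fr_smooth) H Dp.
  move/eqP; rewrite addr_eq0 => /eqP ->.
  by rewrite (mixed_comm i j Dp) form42C (mixed_metric ij Dp) opprK.
Qed.

Lemma adapted_frame p x : D p ->
  [/\ form42 x (fr p) = 0, form42 x (tg p) = 0, form42 x q0 = 0 & form42 x p0 = 0] ->
  (forall l, form42 x (partial l fr p) = 0) -> x = 0.
Proof.
move=> Dp [xf xt xq xp] xl.
have ne : (0 : 'I_2) != 1 by [].
apply: (@frame_nondegenerate _ (fr p) (tg p) q0 p0 (partial 0 fr p) (partial 1 fr p)).
- exact: fiber_null.
- exact: fiber_normal.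
- exact: tangent_normal.
- exact: tangent_normal.
- by split; [exact: tangent_orthogonal|exact: metric_neq0|exact: metric_neq0].
- by [].
- by [].
Qed.

(** The orthogonal space of f, t, f_u, f_v is spanned by f and t, and q0, p0 read off
    the coordinates there. *)
Lemma fiber_coordinates p x : D p ->
  form42 x (fr p) = 0 -> form42 x (tg p) = 0 ->
  (forall l, form42 x (partial l fr p) = 0) ->
  x = - form42 x q0 *: fr p - form42 x p0 *: tg p.
Proof.
move=> Dp xf xt xl; apply/eqP; rewrite -subr_eq0; apply/eqP.
have [ff ft tt] := fiber_null Dp.
have [fq fp tq tp] := fiber_normal Dp.
have E y : form42 (x - (- form42 x q0 *: fr p - form42 x p0 *: tg p)) y =
    form42 x y + form42 x q0 * form42 (fr p) y + form42 x p0 * form42 (tg p) y.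
  by rewrite scaleNr form42Dl form42Nl form42Dl !form42Nl !form42Zl -opprD opprK addrA.
apply: (adapted_frame Dp).
  by split; rewrite E ?xf ?xt ?(form42C (tg p) (fr p)) ?ff ?ft ?tt ?fq ?fp ?tq ?tp; ring.
move=> l; have [lf lt _ _] := tangent_normal l Dp.
by rewrite E xl (form42C (tg p)) (form42C (fr p)) lf lt !mulr0 !addr0.
Qed.

End Surface.

(** * Closed forms with values in f /\ f^perp *)

Lemma form42_eq0 (R : realType) (x : 'rV[R]_6) : (forall c, form42 x c = 0) -> x = 0.
Proof.
move=> x0; have E : x *m gram42 R = 0.
  apply/rowP => l; rewrite [RHS]mxE -(x0 (delta_mx 0 l)) /form42.
  by rewrite trmx_delta -colE [RHS]mxE.
by rewrite -[x]mulmx1 -gram42K mulmxA E mul0mx.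
Qed.

(** The expansion of F in the frame (f, t, q, p, X, Y), up to a combination of f
    and t. *)
Lemma frame_remainder (R : realType) (f t q p X Y F : 'rV[R]_6) (k e g h E G : R) :
  E != 0 -> G != 0 -> form42 X X = E -> form42 Y Y = G ->
  [/\ form42 f q = -1, form42 f p = 0, form42 t q = 0 & form42 t p = -1] ->
  [/\ form42 X f = 0, form42 X t = 0, form42 X q = 0 & form42 X p = 0] ->
  [/\ form42 Y f = 0, form42 Y t = 0, form42 Y q = 0 & form42 Y p = 0] ->
  form42 X Y = 0 ->
  form42 F f = - e -> form42 F t = k * e -> form42 F X = g -> form42 F Y = h ->
  let z := F - (e *: q - (k * e) *: p + (g / E) *: X +
             (h / G) *: Y) in
  [/\ form42 z f = 0, form42 z t = 0, form42 z X = 0 & form42 z Y = 0].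
Proof.
move=> E0 G0 XX YY [fq fp tq tp] [Xf Xt Xq Xp] [Yf Yt Yq Yp] XY Ff Ft FX FY z.
have zE w : form42 z w = form42 F w - (e * form42 q w - k * e * form42 p w
   + g / E * form42 X w + h / G * form42 Y w).
  by rewrite /z form42Dl form42Nl !form42Dl form42Nl !form42Zl.
split; rewrite zE (form42C q) (form42C p) ?(form42C Y X)
  ?fq ?fp ?tq ?tp ?Xf ?Xt ?Xq ?Xp ?Yf ?Yt ?Yq ?Yp ?XY ?XX ?YY ?Ff ?Ft ?FX ?FY.
- ring.
- ring.
- by field; rewrite E0 G0.
- by field; rewrite E0 G0.
Qed.

Section LieApplicable.
Variables (R : realType) (D : set 'rV[R]_2) (q0 p0 : 'rV[R]_6).
Variables (fr tg : 'rV[R]_2 -> 'rV[R]_6) (k : 'I_2 -> 'rV[R]_2 -> R).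
Variable eta : 'I_2 -> 'rV[R]_2 -> 'M[R]_6.
Hypothesis S : principal_chart D q0 p0 fr tg k.
Hypothesis eta_smooth : forall l, smooth D (eta l).
Hypothesis eta_wedge : forall p, D p -> forall l,
  in_wedge (legendre_lift fr tg p) (perp (legendre_lift fr tg p)) (eta l p).
Implicit Types (p : 'rV[R]_2) (i j l m : 'I_2) (y z w c : 'rV[R]_6).

Let Do := chart_open S.
Let sfr := fr_smooth S.
Let stg := tg_smooth S.

(** A closed form is studied through the scalar functions (eta_l x, y), x and y
    running through the moving frame (f, t, f_u, f_v) and the constant vectors q0
    and p0. *)
Definition pairing l p w y : R := form42 (w *m eta l p) y.

Lemma eta_skew l p : D p -> skew_on_perp (fr p) (tg p) (eta l p).
Proof.
by move=> Dp; have [ff ft tt] := fiber_null S Dp; exact: in_wedge_perp (eta_wedge Dp l).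
Qed.

Lemma pairingC l p w y : D p -> pairing l p w y = - pairing l p y w.
Proof. by move=> Dp; have [+ _ _] := eta_skew l Dp; exact. Qed.

Lemma pairing_self l p y : D p -> pairing l p y y = 0.
Proof.
move=> Dp; have /eqP := pairingC l y y Dp.
by rewrite -addr_eq0 -mulr2n -mulr_natl mulf_eq0 pnatr_eq0 => /eqP.
Qed.

Lemma pairing_fiber l p y : D p -> pairing l p (fr p) y = 0 /\ pairing l p (tg p) y = 0.
Proof.
by move=> Dp; have [_ [fe te] _] := eta_skew l Dp; rewrite /pairing fe te form420l.
Qed.

Lemma pairing_perp l p w y : D p -> form42 w (fr p) = 0 -> form42 w (tg p) = 0 ->
  form42 y (fr p) = 0 -> form42 y (tg p) = 0 -> pairing l p w y = 0.
Proof. by move=> Dp; have [_ _] := eta_skew l Dp; exact. Qed.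

Lemma pairing_tangent l i j p : D p ->
  pairing l p (partial i fr p) (partial j fr p) = 0.
Proof.
move=> Dp; have [if_ it _ _] := tangent_normal S i Dp.
by have [jf jt _ _] := tangent_normal S j Dp; exact: pairing_perp.
Qed.

Lemma pairingDl l p w y c : pairing l p (w + y) c = pairing l p w c + pairing l p y c.
Proof. by rewrite /pairing mulmxDl form42Dl. Qed.

Lemma pairingZl l p (a : R) y c : pairing l p (a *: y) c = a * pairing l p y c.
Proof. by rewrite /pairing -scalemxAl form42Zl. Qed.

Lemma pairingNl l p y c : pairing l p (- y) c = - pairing l p y c.
Proof. by rewrite -scaleN1r pairingZl mulN1r. Qed.

Lemma pairing0l l p y : pairing l p 0 y = 0.
Proof. by rewrite /pairing mul0mx form420l. Qed.

Lemma smooth_pairing l (a b : 'rV[R]_2 -> 'rV[R]_6) :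
  smooth D a -> smooth D b -> smooth D (fun p => pairing l p (a p) (b p)).
Proof. by move=> sa sb; apply: (smooth_form42 Do) => //; exact: smooth_mulmx. Qed.

Lemma partial_pairing m l (a b : 'rV[R]_2 -> 'rV[R]_6) p :
  smooth D a -> smooth D b -> D p ->
  partial m (fun x => pairing l x (a x) (b x)) p =
  pairing l p (partial m a p) (b p) + form42 (a p *m partial m (eta l) p) (b p) +
  pairing l p (a p) (partial m b p).
Proof.
move=> sa sb Dp; rewrite /pairing.
rewrite (partial_form42 m (smooth_mulmx Do sa (eta_smooth l)) sb Dp).
have [_ E] := is_derive_mulmx (smooth_is_derive m sa Dp)
  (smooth_is_derive m (eta_smooth l) Dp).
by rewrite [X in form42 X]E form42Dl.
Qed.

(** The component of f_ii in the plane of f and t is killed by eta, so only the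
    components along q0, p0, f_i and f_j contribute. *)
Lemma second_partial_pairing l i j p c : i != j -> D p ->
  pairing l p (partial i (partial i fr) p) c =
  metric fr i p * (pairing l p q0 c - k i p * pairing l p p0 c)
  + form42 (partial i (partial i fr) p) (partial i fr p) / metric fr i p
      * pairing l p (partial i fr p) c
  + partial j (k i) p * metric fr i p / ((k i p - k j p) * metric fr j p)
      * pairing l p (partial j fr p) c.
Proof.
move=> ij Dp; have [Ff Ft _ _ Fj] := second_partial S ij Dp.
have XY := tangent_orthogonal S ij Dp.
have E0 := metric_neq0 S i Dp; have G0 := metric_neq0 S j Dp.
have [pf pt] := pairing_fiber l c Dp.
have span (x : 'rV[R]_6) : form42 x (fr p) = 0 -> form42 x (tg p) = 0 ->
    form42 x (partial i fr p) = 0 -> form42 x (partial j fr p) = 0 ->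
    pairing l p x c = 0.
  move=> xf xt xi xj; rewrite (fiber_coordinates S Dp xf xt).
    by rewrite pairingDl pairingNl !pairingZl pf pt !mulr0 subr0.
  move=> m; have [->//|/(other_index ij) ->//] := eqVneq m i.
have /= [zf zt zi zj] := frame_remainder E0 G0 erefl erefl (fiber_normal S Dp)
  (tangent_normal S i Dp) (tangent_normal S j Dp) XY Ff Ft erefl Fj.
have := span _ zf zt zi zj.
move: (partial i (partial i fr) p) (partial i fr p) (partial j fr p) => F X Y.
rewrite pairingDl pairingNl !pairingDl pairingNl !pairingZl => /eqP.
rewrite subr_eq0 => /eqP ->.
congr (_ + _ + _ * _); last by rewrite invfM mulrA.
by rewrite mulrBr mulrA [metric fr i p * k i p]mulrC.
Qed.

Hypothesis eta_closed : forall i j p, D p -> partial i (eta j) p = partial j (eta i) p.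

(** The terms in which eta is differentiated cancel because eta is closed. *)
Lemma closed_pairing i j (a b : 'rV[R]_2 -> 'rV[R]_6) p :
  smooth D a -> smooth D b -> D p ->
  partial i (fun x => pairing j x (a x) (b x)) p -
  partial j (fun x => pairing i x (a x) (b x)) p =
  pairing j p (partial i a p) (b p) + pairing j p (a p) (partial i b p)
  - (pairing i p (partial j a p) (b p) + pairing i p (a p) (partial j b p)).
Proof.
move=> sa sb Dp; rewrite (partial_pairing i j sa sb Dp) (partial_pairing j i sa sb Dp).
rewrite (eta_closed i j Dp).
move: (pairing j p _ _) (pairing j p _ _) (pairing i p _ _) (pairing i p _ _) (form42 _ _).
by move=> u v w z t; ring.
Qed.

Lemma closed_pairing_cst i j (a : 'rV[R]_2 -> 'rV[R]_6) c p :
  smooth D a -> D p ->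
  partial i (fun x => pairing j x (a x) c) p -
  partial j (fun x => pairing i x (a x) c) p =
  pairing j p (partial i a p) c - pairing i p (partial j a p) c.
Proof.
move=> sa Dp; rewrite (closed_pairing i j sa (smooth_cstmx Do c) Dp).
have d0 m : partial m (fun=> c) p = 0 by exact: derive_cst.
by rewrite !d0 /pairing !form420r !addr0.
Qed.

(** The preceding relation for the sections f and t, which eta kills, gives
    eta_j f_i = eta_i f_j and k_i eta_j f_i = k_j eta_i f_j; now k_i and k_j differ. *)
Lemma off_diagonal i j p : i != j -> D p -> partial i fr p *m eta j p = 0.
Proof.
move=> ij Dp; apply: form42_eq0 => c.
have fib0 l (x : 'rV[R]_2) : D x -> pairing l x (fr x) c = 0 by move=> /(pairing_fiber l c)[].
have tib0 l (x : 'rV[R]_2) : D x -> pairing l x (tg x) c = 0 by move=> /(pairing_fiber l c)[].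
have := closed_pairing_cst i j c sfr Dp.
rewrite (partial_const_on Do i (fib0 j) Dp) (partial_const_on Do j (fib0 i) Dp).
have := closed_pairing_cst i j c stg Dp.
rewrite (partial_const_on Do i (tib0 j) Dp) (partial_const_on Do j (tib0 i) Dp).
rewrite (partial_tg S i Dp) (partial_tg S j Dp) !pairingNl !pairingZl.
rewrite -/(pairing j p (partial i fr p) c).
have := curvature_neq S ij Dp.
move: (pairing _ _ _ _) (pairing _ _ _ _) => u v kn E1 /eqP E2.
move: E2; rewrite subrr eq_sym subr_eq0 => /eqP uv; apply: (mulfI kn).
by rewrite mulr0 -[RHS]oppr0 -[0 in RHS](subrr 0) E1 uv; ring.
Qed.

Lemma off_diagonal_pairing i j p c : i != j -> D p ->
  pairing j p (partial i fr p) c = 0.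
Proof. by move=> ij Dp; rewrite /pairing off_diagonal // form420l. Qed.

End LieApplicable.

(** * Integrability conditions on the diagonal of q *)

Section Algebra.
Variable R : realType.

Lemma diagonal_constant_alg (A A' B B' E G ki kj d e dA dA' : R) :
  G != 0 -> ki - kj != 0 -> E * (B - ki * B') + G * (A - kj * A') = 0 ->
  dA = - (E * ki * e) - d * E / ((ki - kj) * G) * B - d * A / (ki - kj) ->
  dA' = - (E * e) - d * E / ((ki - kj) * G) * B' - d * A' / (ki - kj) ->
  d * A' + ki * dA' - dA = 0.
Proof.
move=> G0 kn H -> ->.
have -> : d * A' + ki * (- (E * e) - d * E / ((ki - kj) * G) * B' - d * A' / (ki - kj))
   - (- (E * ki * e) - d * E / ((ki - kj) * G) * B - d * A / (ki - kj)) =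
   d / ((ki - kj) * G) * (E * (B - ki * B') + G * (A - kj * A')).
  by field; rewrite G0 kn.
by rewrite H mulr0.
Qed.

Lemma gauge_alg (A A' B B' E G ki kj di dj e dA dA' : R) :
  E != 0 -> G != 0 -> ki - kj != 0 ->
  dA = - (E * ki * e) - di * E / ((ki - kj) * G) * B - di * A / (ki - kj) ->
  dA' = - (E * e) - di * E / ((ki - kj) * G) * B' - di * A' / (ki - kj) ->
  e + ((dA - (dj * A' + kj * dA')) / (E * (ki - kj)) -
       (A - kj * A') * (- 2 * (di * E / (ki - kj)) * (ki - kj) + E * (di - dj))
        / (E * (ki - kj)) ^+ 2) =
  ((kj * B' - B) * di / G - (ki * A' - A) * dj / E) / (kj - ki) ^+ 2.
Proof.
move=> E0 G0 kn -> ->.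
have kn' : kj - ki != 0 by rewrite -opprB oppr_eq0.
by field; rewrite kn' kn E0 G0.
Qed.

Lemma relation_alg (P1 P2 T1 T2 T3 T4 u v : R) :
  P1 - P2 = T1 + T2 - (T3 + T4) -> P1 = 0 -> P2 = 0 -> T1 = - u -> T2 = 0 ->
  T3 = 0 -> T4 = v -> u + v = 0.
Proof.
move=> E P1E P2E T1E T2E T3E T4E; move: E; rewrite P1E P2E T1E T2E T3E T4E => E.
by apply/eqP; rewrite -oppr_eq0; apply/eqP; rewrite -[RHS](subrr 0) E; ring.
Qed.

Lemma diagonal_pairing_alg (a b a' b' u v w e g h kl : R) :
  b = - b' -> a = - a' -> v = 0 -> u = 0 ->
  w = e * (a - kl * b) + g * u + h * v -> w = - (e * (a' - kl * b')).
Proof. by move=> -> -> -> -> ->; ring. Qed.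

Lemma partial_pairing_alg (P1 P2 T1 T2 u g h v : R) :
  P1 - P2 = T1 - T2 -> P1 = 0 -> T1 = u + g * h + v -> h = 0 ->
  forall w, T2 = - w -> P2 = - u - v - w.
Proof.
move=> E P0 ET h0 w Ew; have -> : P2 = P1 - (P1 - P2) by ring.
by rewrite E P0 ET h0 Ew; ring.
Qed.

Lemma gauge_sym_alg (A A' B B' E G ki kj : R) :
  ki - kj != 0 -> G != 0 -> E != 0 ->
  E * (B - ki * B') + G * (A - kj * A') = 0 ->
  (A - kj * A') / (E * (ki - kj)) = (B - ki * B') / (G * (kj - ki)).
Proof.
move=> kn G0 E0 H; have kn' : kj - ki != 0 by rewrite -opprB oppr_eq0.
apply/eqP; rewrite -subr_eq0; apply/eqP.
transitivity ((E * (B - ki * B') + G * (A - kj * A')) / (E * G * (ki - kj))).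
  by field; rewrite ?E0 ?G0 ?kn ?kn'.
by rewrite H mul0r.
Qed.

Lemma gauge_quotient_alg (A A' E di dj dE dA dA' ki kj : R) :
  E != 0 -> ki - kj != 0 ->
  (A - kj * A') * (- (E * (di - dj) + (ki - kj) * dE) / (E * (ki - kj)) ^+ 2)
  + (E * (ki - kj))^-1 * (dA - (kj * dA' + A' * dj)) =
  (dA - (dj * A' + kj * dA')) / (E * (ki - kj)) -
  (A - kj * A') * (dE * (ki - kj) + E * (di - dj)) / (E * (ki - kj)) ^+ 2.
Proof. by move=> E0 kn; field; rewrite E0 kn. Qed.

Lemma image_alg (n m : nat) (f g : 'rV[R]_n) (A B : 'M[R]_(n, m))
    (x y : 'rV[R]_m) (a b s t cq cp dq dp : R) :
  g *m A = 0 -> f *m B = 0 -> g *m B = - dq *: x - dp *: y ->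
  f *m A = - cq *: x - cp *: y ->
  (a *: f + b *: g) *m (s *: A + t *: B) =
  (- (a * s * cq + b * t * dq)) *: x + (- (a * s * cp + b * t * dp)) *: y.
Proof.
move=> gA fB gB fA; rewrite mulmxDl !mulmxDr -!scalemxAl -!scalemxAr gA fB gB fA.
by apply/matrixP => i j; rewrite !mxE; ring.
Qed.

Lemma trace_alg (x y s t k l cq cp dq dp : R) :
  - (x * s * cq + y * t * dq) +
  - (- (x * k) * s * cp + - (y * l) * t * dp) =
  (k * cp - cq) * (s * x) + (l * dp - dq) * (t * y).
Proof. ring. Qed.

End Algebra.

(** The coefficient of f /\ t in the component along i of the normal form of a closed
    form, Q i being q(d_i, d_i). *)
Definition twist (R : realType) (fr : 'rV[R]_2 -> 'rV[R]_6)
    (k Q : 'I_2 -> 'rV[R]_2 -> R) (i j : 'I_2) (p : 'rV[R]_2) : R :=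
  (Q i p * partial i (k j) p / metric fr i p -
   Q j p * partial i (k i) p / metric fr j p) / (k i p - k j p) ^+ 2.

Lemma lincomb2_mxE (R : nzRingType) m n (a b : R) (A B : 'M[R]_(m, n)) i j :
  (a *: A + b *: B) i j = a * A i j + b * B i j.
Proof. by rewrite !mxE. Qed.

Lemma lincomb2_opp (R : nzRingType) (V : lmodType R) (a b c d : R) (x y : V) :
  a *: - (c *: x) + b *: - (d *: y) = (- (a * c)) *: x + (- (b * d)) *: y.
Proof. by rewrite !scalerN !scalerA !scaleNr. Qed.

Lemma is_derive_col_mx (R : realType) m1 m2 n (F : 'rV[R]_2 -> 'M[R]_(m1, n))
    (G : 'rV[R]_2 -> 'M[R]_(m2, n)) (p v : 'rV[R]_2) A B :
  is_derive p v F A -> is_derive p v G B ->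
  is_derive p v (fun x => col_mx (F x) (G x)) (col_mx A B).
Proof.
move=> /is_derive_mxP dF /is_derive_mxP dG; apply/is_derive_mxP => a b.
have E x : col_mx (F x) (G x) a b =
    match fintype.split a with inl l => F x l b | inr l => G x l b end by rewrite mxE.
rewrite (funext E) mxE.
by case: (fintype.split a) => l.
Qed.

Lemma mul_row2_col_mx (R : nzRingType) n (v : 'rV[R]_2) (x y : 'rV[R]_n) :
  v *m (col_mx x y : 'M[R]_(2, n)) = v 0 0 *: x + v 0 1 *: y.
Proof.
have E : v = row_mx (v 0 0)%:M (v 0 1)%:M :> 'rV_(1 + 1).
  apply/rowP => m; rewrite mxE; case: splitP => l ml; rewrite ord1 mxE eqxx mulr1n;
    congr (v 0 _); apply/val_inj; rewrite /= ml ord1 //.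
rewrite {1}E; have := mul_row_col (v 0 0)%:M (v 0 1)%:M x y.
by rewrite !mul_scalar_mx.
Qed.

Section Integrability.
Variables (R : realType) (D : set 'rV[R]_2) (q0 p0 : 'rV[R]_6).
Variables (fr tg : 'rV[R]_2 -> 'rV[R]_6) (k : 'I_2 -> 'rV[R]_2 -> R).
Variable eta : 'I_2 -> 'rV[R]_2 -> 'M[R]_6.
Hypothesis S : principal_chart D q0 p0 fr tg k.
Hypothesis eta_smooth : forall l, smooth D (eta l).
Hypothesis eta_wedge : forall p, D p -> forall l,
  in_wedge (legendre_lift fr tg p) (perp (legendre_lift fr tg p)) (eta l p).
Hypothesis eta_closed : forall i j p, D p -> partial i (eta j) p = partial j (eta i) p.
Implicit Types (p : 'rV[R]_2) (i j l m : 'I_2) (y z w c : 'rV[R]_6).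

Let Do := chart_open S.
Let sfr := fr_smooth S.
Local Notation pairing := (pairing eta).

Definition tangent_pairing c l p : R := pairing l p (partial l fr p) c.
Local Notation coefq := (tangent_pairing q0).
Local Notation coefp := (tangent_pairing p0).

Let off_diagonal0 := off_diagonal_pairing S eta_smooth eta_wedge eta_closed.

Lemma smooth_tangent_pairing c l : smooth D (tangent_pairing c l).
Proof.
by apply: (smooth_pairing S eta_smooth); [exact: smooth_partial|exact: smooth_cstmx].
Qed.

Lemma mixed_pairing i j p c : i != j -> D p ->
  pairing i p (partial j (partial i fr) p) c =
  - (partial j (k i) p * tangent_pairing c i p / (k i p - k j p)).
Proof.
move=> ij Dp; have ji : j != i by rewrite eq_sym.
have := off_diagonal0 c ji Dp.
rewrite (mixed_partial S ij Dp) /tangent_pairing.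
move: (partial i fr p) (partial j fr p) => X Y Y0.
by rewrite pairingZl pairingDl pairingNl !pairingZl Y0 mulr0 sub0r mulrN mulrC.
Qed.

(** The relation of closedness for the pair (f_i, f_j).  It says that two expressions
    of the function called gauge below agree. *)
Lemma diagonal_relation i j p : i != j -> D p ->
  metric fr i p * (coefq j p - k i p * coefp j p) +
  metric fr j p * (coefq i p - k j p * coefp i p) = 0.
Proof.
move=> ij Dp; have ji : j != i by rewrite eq_sym.
have skew := pairingC S eta_wedge.
have H l m : l != m -> pairing m p (partial l (partial l fr) p) (partial m fr p) =
   - (metric fr l p * (coefq m p - k l p * coefp m p)).
  move=> lm; have := second_partial_pairing S eta_wedge m (partial m fr p) lm Dp.
  have := off_diagonal0 (partial m fr p) lm Dp.
  have := pairing_self S eta_wedge m (partial m fr p) Dp.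
  have := skew m p q0 (partial m fr p) Dp; have := skew m p p0 (partial m fr p) Dp.
  exact: diagonal_pairing_alg.
have zero m l h x : D x -> pairing m x (partial l fr x) (partial h fr x) = 0.
  exact: pairing_tangent S eta_wedge _ _ _ _.
have T2 : pairing j p (partial i fr p) (partial i (partial j fr) p) = 0.
  exact: off_diagonal0 ij Dp.
have T3 : pairing i p (partial j (partial i fr) p) (partial j fr p) = 0.
  by rewrite (skew _ _ _ _ Dp) (off_diagonal0 _ ji Dp) oppr0.
have T4 : pairing i p (partial i fr p) (partial j (partial j fr) p) =
    metric fr j p * (coefq i p - k j p * coefp i p).
  by rewrite (skew _ _ _ _ Dp) (H j i ji) opprK.
have E := closed_pairing S eta_smooth eta_closed i j (smooth_partial i sfr)
  (smooth_partial j sfr) Dp.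
exact: relation_alg E (partial_const_on Do i (zero j i j) Dp)
  (partial_const_on Do j (zero i i j) Dp) (H i j ij) T2 T3 T4.
Qed.

(** The relation of closedness for the pair (f_i, c). *)
Lemma partial_tangent_pairing i j p c : i != j -> D p ->
  partial j (tangent_pairing c i) p =
  - (metric fr i p * (pairing j p q0 c - k i p * pairing j p p0 c))
  - partial j (k i) p * metric fr i p / ((k i p - k j p) * metric fr j p)
     * tangent_pairing c j p
  - partial j (k i) p * tangent_pairing c i p / (k i p - k j p).
Proof.
move=> ij Dp.
have zero x : D x -> pairing j x (partial i fr x) c = 0.
  by move=> Dx; exact: off_diagonal0 ij Dx.
have E := closed_pairing_cst S eta_smooth eta_closed i j c (smooth_partial i sfr) Dp.
have T1 := second_partial_pairing S eta_wedge j c ij Dp.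
have Z := partial_pairing_alg E (partial_const_on Do i zero Dp) T1
  (off_diagonal0 c ij Dp) (mixed_pairing c ij Dp).
exact: Z.
Qed.

(** This is q(d_l, d_l), see q_tensor_diagonal. *)
Definition diagonal l p : R := k l p * coefp l p - coefq l p.
(** The function a for which eta + d (a f /\ t) is in the normal form described at
    the beginning; it is symmetric in i and j by diagonal_relation. *)
Definition gauge i j p : R :=
  (coefq i p - k j p * coefp i p) / (metric fr i p * (k i p - k j p)).

Let dcoefq i j p : i != j -> D p -> partial j (coefq i) p =
  - (metric fr i p * k i p * pairing j p q0 p0)
  - partial j (k i) p * metric fr i p / ((k i p - k j p) * metric fr j p) * coefq j p
  - partial j (k i) p * coefq i p / (k i p - k j p).
Proof.
move=> ij Dp; rewrite (partial_tangent_pairing _ ij Dp).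
rewrite (pairing_self S eta_wedge _ _ Dp) (pairingC S eta_wedge _ p0 _ Dp).
by rewrite mulrN opprK add0r mulrA.
Qed.

Let dcoefp i j p : i != j -> D p -> partial j (coefp i) p =
  - (metric fr i p * pairing j p q0 p0)
  - partial j (k i) p * metric fr i p / ((k i p - k j p) * metric fr j p) * coefp j p
  - partial j (k i) p * coefp i p / (k i p - k j p).
Proof.
move=> ij Dp; rewrite (partial_tangent_pairing _ ij Dp).
by rewrite (pairing_self S eta_wedge _ _ Dp) mulr0 subr0.
Qed.

Lemma smooth_diagonal l : smooth D (diagonal l).
Proof.
apply: (smooth_add Do); last by apply: (smooth_opp Do); exact: smooth_tangent_pairing.
by apply: (smooth_mul Do); [exact: chart_smooth S l|exact: smooth_tangent_pairing].
Qed.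

(** By the two relations above for q0 and p0, the derivative is a multiple of the
    left-hand side of diagonal_relation. *)
Lemma diagonal_constant i j p : i != j -> D p -> partial j (diagonal i) p = 0.
Proof.
move=> ij Dp.
have dk := smooth_is_derive j (chart_smooth S i) Dp.
have dq := smooth_is_derive j (smooth_tangent_pairing q0 i) Dp.
have dp := smooth_is_derive j (smooth_tangent_pairing p0 i) Dp.
have [_ dE] := is_derive_add (is_derive_mul dk dp) (is_derive_opp dq).
have H := diagonal_constant_alg (metric_neq0 S j Dp) (curvature_neq S ij Dp)
  (diagonal_relation ij Dp) (dcoefq ij Dp) (dcoefp ij Dp).
rewrite [LHS]dE -[RHS]H; congr (_ - _).
by rewrite addrC [coefp i p * _]mulrC.
Qed.

Lemma smooth_gauge i j : i != j -> smooth D (gauge i j).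
Proof.
move=> ij; have sk := chart_smooth S.
apply: (smooth_mul Do).
  apply: (smooth_add Do); first exact: smooth_tangent_pairing.
  apply: (smooth_opp Do); apply: (smooth_mul Do); first exact: sk.
  exact: smooth_tangent_pairing.
apply: (smooth_inv Do).
  apply: (smooth_mul Do); first exact: smooth_metric S i.
  by apply: (smooth_add Do); [exact: sk|apply: (smooth_opp Do); exact: sk].
by move=> p Dp; rewrite mulf_neq0 ?(metric_neq0 S) ?(curvature_neq S).
Qed.

Lemma gauge_sym i j p : i != j -> D p -> gauge i j p = gauge j i p.
Proof.
move=> ij Dp; have := diagonal_relation ij Dp.
have := metric_neq0 S i Dp; have := metric_neq0 S j Dp.
have := curvature_neq S ij Dp.
rewrite /gauge; exact: gauge_sym_alg.
Qed.

(** The coefficient (eta_j q0, p0) of f /\ t in eta_j becomes, after adding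
    d (a f /\ t), a function of the diagonal of q alone. *)
Lemma twist_gauge i j p : i != j -> D p ->
  pairing j p q0 p0 + partial j (gauge i j) p = twist fr k diagonal j i p.
Proof.
move=> ij Dp.
have dk l := smooth_is_derive j (chart_smooth S l) Dp.
have dq := smooth_is_derive j (smooth_tangent_pairing q0 i) Dp.
have dp := smooth_is_derive j (smooth_tangent_pairing p0 i) Dp.
have dm := smooth_is_derive j (smooth_metric S i) Dp.
have E0 := metric_neq0 S i Dp; have G0 := metric_neq0 S j Dp.
have kn := curvature_neq S ij Dp.
have den0 := mulf_neq0 E0 kn.
have [_ dE] := is_derive_mul
  (is_derive_add dq (is_derive_opp (is_derive_mul (dk j) dp)))
  (is_derive_inv den0 (is_derive_mul dm (is_derive_add (dk i) (is_derive_opp (dk j))))).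
have := gauge_alg (partial j (k j) p) E0 G0 kn (dcoefq ij Dp) (dcoefp ij Dp).
rewrite -(partial_metric S ij Dp) /twist /diagonal => <-; congr (_ + _).
rewrite [LHS]dE.
exact: gauge_quotient_alg E0 kn.
Qed.

(** The relation of closedness for the constant pair (q0, p0). *)
Lemma twist_closed i j p : i != j -> D p ->
  partial i (fun x => pairing j x q0 p0) p = partial j (fun x => pairing i x q0 p0) p.
Proof.
move=> ij Dp; apply/eqP; rewrite -subr_eq0.
rewrite (closed_pairing_cst S eta_smooth eta_closed i j p0 (smooth_cstmx Do q0) Dp).
have d0 m : partial m (fun=> q0) p = 0 by exact: derive_cst.
by rewrite !d0 !pairing0l subrr.
Qed.

(** The gauge contributes its two mixed derivatives, which are equal. *)
Lemma twist_integrable i j p : i != j -> D p ->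
  partial j (twist fr k diagonal i j) p = partial i (twist fr k diagonal j i) p.
Proof.
move=> ij Dp; have ji : j != i by rewrite eq_sym.
have H l m : l != m -> partial l (twist fr k diagonal m l) p =
    partial l (fun x => pairing m x q0 p0) p + partial l (partial m (gauge l m)) p.
  move=> lm; have spair : smooth D (fun x => pairing m x q0 p0).
    by apply: (smooth_pairing S eta_smooth); exact: smooth_cstmx.
  have sg := smooth_partial m (smooth_gauge lm).
  have [_ <-] := is_derive_add (smooth_is_derive l spair Dp) (smooth_is_derive l sg Dp).
  by apply: (eq_on_derive _ Do) => // x Dx; rewrite (twist_gauge lm Dx).
have G : partial j (partial i (gauge j i)) p = partial i (partial j (gauge i j)) p.
  rewrite (schwarz j i Do (smooth_gauge ji) Dp).
  apply: (eq_on_derive _ Do) => // x Dx.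
  by apply: (eq_on_derive _ Do) => // y Dy; exact: gauge_sym.
exact: etrans (H j i ji) (etrans (congr2 +%R (esym (twist_closed ij Dp)) G) (esym (H i j ij))).
Qed.

Lemma row_free_fiber p : D p -> row_free (legendre_lift fr tg p).
Proof.
move=> Dp; apply: inj_row_free => v E.
have mul : v *m legendre_lift fr tg p = v 0 0 *: fr p + v 0 1 *: tg p.
  exact: mul_row2_col_mx.
have {E} [v0 v1] := fiber_independent S Dp (etrans (esym mul) E).
by apply/rowP; apply: cases2; rewrite mxE.
Qed.

Lemma is_derive_gradient_mx (r s : nat) (F : 'rV[R]_2 -> 'M[R]_(r, s)) p (v : 'rV[R]_2) :
  smooth D F -> D p ->
  is_derive p v F (v 0 0 *: partial 0 F p + v 0 1 *: partial 1 F p).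
Proof.
move=> sF Dp; have sE a b := (smooth_mxP F Do).1 sF a b.
apply/is_derive_mxP => a b; rewrite lincomb2_mxE.
have E l : partial l F p a b = partial l (fun x => F x a b) p.
  by rewrite (partial_mx (smooth_derivable sF Dp)) mxE.
have := is_derive_gradient v Do (sE a b) Dp.
by move/is_derive_eq; apply; congr (_ * _ + _ * _); exact: esym (E _).
Qed.

Lemma derive_legendre_lift p (v : 'rV[R]_2) : D p ->
  'D_v (legendre_lift fr tg) p =
  col_mx (v 0 0 *: partial 0 fr p + v 0 1 *: partial 1 fr p)
    ((- (v 0 0 * k 0 p)) *: partial 0 fr p + (- (v 0 1 * k 1 p)) *: partial 1 fr p).
Proof.
move=> Dp; have dfr := is_derive_gradient_mx v sfr Dp.
have := is_derive_gradient_mx v (tg_smooth S) Dp.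
rewrite (partial_tg S 0 Dp) (partial_tg S 1 Dp) lincomb2_opp => dtg.
by have [_] := is_derive_col_mx dfr dtg.
Qed.

(** As eta maps f^perp into the plane of f and t, the trace that defines q can be read
    off from the products with q0 and p0. *)
Lemma tangent_image l p : D p -> partial l fr p *m eta l p =
  - coefq l p *: fr p - coefp l p *: tg p.
Proof.
move=> Dp; have H m : form42 (partial l fr p *m eta l p) (partial m fr p) = 0 :=
  pairing_tangent S eta_wedge l l m Dp.
have fib w := pairing_fiber S eta_wedge l w Dp.
apply: (fiber_coordinates S Dp) => //.
  by have := pairingC S eta_wedge l (partial l fr p) (fr p) Dp; rewrite (fib _).1 oppr0; exact.
by have := pairingC S eta_wedge l (partial l fr p) (tg p) Dp; rewrite (fib _).2 oppr0; exact.
Qed.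

Lemma trace_frame (F : 'M[R]_(1 + 1, 6)) (A : 'M[R]_6) (x y f g : 'rV[R]_6)
    (a b c d : R) :
  F = col_mx x y -> row_free F ->
  f *m A = a *: x + b *: y -> g *m A = c *: x + d *: y ->
  \tr (col_mx f g *m A *m pinvmx F) = a + d.
Proof.
move=> FE Ff fA gA; rewrite mul_col_mx fA gA.
have -> : col_mx (a *: x + b *: y) (c *: x + d *: y) =
    block_mx a%:M b%:M c%:M d%:M *m col_mx x y.
  by rewrite mul_block_col !mul_scalar_mx.
by rewrite -FE mulmxKp // mxtrace_block !mxtrace_scalar.
Qed.

Lemma q_tensor_diagonal p (X Y : 'rV[R]_2) : D p ->
  q_tensor (legendre_lift fr tg) eta p X Y =
  diagonal 0 p * (X 0 0 * Y 0 0) + diagonal 1 p * (X 0 1 * Y 0 1).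
Proof.
move=> Dp; rewrite /q_tensor (derive_legendre_lift Y Dp) /form1_at.
have ne01 : (0 : 'I_2) != 1 by []. have ne10 : (1 : 'I_2) != 0 by [].
have -> : \sum_(i < 2) X 0 i *: eta i p = X 0 0 *: eta 0 p + X 0 1 *: eta 1 p.
  rewrite !big_ord_recl big_ord0 addr0; congr (_ + X 0 _ *: eta _ p); exact/val_inj.
have img (a b : R) : (a *: partial 0 fr p + b *: partial 1 fr p) *m
    (X 0 0 *: eta 0 p + X 0 1 *: eta 1 p) =
    (- (a * X 0 0 * coefq 0 p + b * X 0 1 * coefq 1 p)) *: fr p
    + (- (a * X 0 0 * coefp 0 p + b * X 0 1 * coefp 1 p)) *: tg p.
  have := tangent_image 0 Dp; have := tangent_image 1 Dp.
  have := off_diagonal S eta_smooth eta_wedge eta_closed ne01 Dp.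
  have := off_diagonal S eta_smooth eta_wedge eta_closed ne10 Dp.
  exact: image_alg.
have tr := trace_frame (erefl : legendre_lift fr tg p = _) (row_free_fiber Dp)
  (img (Y 0 0) (Y 0 1)) (img (- (Y 0 0 * k 0 p)) (- (Y 0 1 * k 1 p))).
exact: etrans tr (trace_alg _ _ _ _ _ _ _ _ _ _).
Qed.

End Integrability.

(** * Demoulin's equation as an integrability condition *)

Section DemoulinAlgebra.
Variable R : realType.

(** Both sides with all derivatives carried out.  A and B are the square roots of Ei
    and Ej; ai, aj, bi, bj are the derivatives of the curvatures a and b, s and t
    their mixed derivatives; u', v', g, h are the remaining first derivatives, and
    the Codazzi equations have been substituted for the others. *)
Lemma demoulin_identity_alg (al be u v a b ai aj bi bj Ei Ej u' v' s t g h A B : R) :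
  u != 0 -> v != 0 -> a - b != 0 -> A != 0 -> B != 0 ->
  Ei = A ^+ 2 -> Ej = B ^+ 2 ->
  (al * u ^+ 2 * bi / Ei - - (be * v ^+ 2) * ai / Ej) *
  (- (2 * (a - b) * (aj - bj)) / (a - b) ^+ 2 ^+ 2) +
  (a - b) ^- 2 *
  (al * u ^+ 2 * bi * (- (-2 * (aj * Ei / (a - b))) / Ei ^+ 2) +
   (Ei)^-1 *
   (al * u ^+ 2 * t + bi * (al * (2 * u * 0) + u ^+ 2 * 0)) -
   (- (be * v ^+ 2) * ai * (- g / Ej ^+ 2) +
    (Ej)^-1 *
    (- (be * v ^+ 2) * s + ai * - (be * (2 * v * v') + v ^+ 2 * 0)))) -
  ((- (be * v ^+ 2) * aj / Ej - al * u ^+ 2 * bj / Ei) *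
   (- (2 * (b - a) * (bi - ai)) / (b - a) ^+ 2 ^+ 2) +
   (b - a) ^- 2 *
   (- (be * v ^+ 2) * aj *
    (- (-2 * (bi * Ej / (b - a))) / Ej ^+ 2) +
    (Ej)^-1 *
    (- (be * v ^+ 2) * s + aj * - (be * (2 * v * 0) + v ^+ 2 * 0)) -
    (al * u ^+ 2 * bj * (- h / Ei ^+ 2) +
     (Ei)^-1 *
     (al * u ^+ 2 * t + bj * (al * (2 * u * u') + u ^+ 2 * 0))))) =
  2 * u * v / (A * B * (a - b)) *
  (be *
   (v / u * (A / B) *
    (ai * (- (aj - bj) / (a - b) ^+ 2) + (a - b)^-1 * s) +
    ai / (a - b) *
    (v / u *
     (A * (- (g / (2 * B)) / B ^+ 2) +
      B^-1 * (-2 * (aj * Ei / (a - b)) / (2 * A))) +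
     A / B * (v * (- 0 / u ^+ 2) + (u)^-1 * v'))) +
   al *
   (u / v * (B / A) *
    (bj * (- (ai - bi) / (a - b) ^+ 2) + (a - b)^-1 * t) +
    bj / (a - b) *
    (u / v *
     (B * (- (h / (2 * A)) / A ^+ 2) +
      A^-1 * (-2 * (bi * Ej / (b - a)) / (2 * B))) +
     B / A * (u * (- 0 / v ^+ 2) + (v)^-1 * u')))).
Proof.
move=> u0 v0 ab0 A0 B0 -> ->.
have ba0 : b - a != 0 by rewrite -opprB oppr_eq0.
field.
by rewrite u0 v0 ab0 ba0 A0 B0.
Qed.

End DemoulinAlgebra.

Section DemoulinIdentity.
Variables (R : realType) (p wi wj : 'rV[R]_2).
Variables (u v a b ai aj bi bj Ei Ej : 'rV[R]_2 -> R) (al be : R).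
Variables (u' v' s t g h : R).

Let T1 x := (al * u x ^+ 2 * bi x / Ei x - - (be * v x ^+ 2) * ai x / Ej x)
  / (a x - b x) ^+ 2.
Let T2 x := (- (be * v x ^+ 2) * aj x / Ej x - al * u x ^+ 2 * bj x / Ei x)
  / (b x - a x) ^+ 2.
Let P x := v x / u x * (Num.sqrt (Ei x) / Num.sqrt (Ej x)) * (ai x / (a x - b x)).
Let Q x := u x / v x * (Num.sqrt (Ej x) / Num.sqrt (Ei x)) * (bj x / (a x - b x)).

(** T1 and T2 are the two functions twist for the diagonal (al u^2, - be v^2), and P, Q
    are the functions differentiated in Demoulin's equation. *)
Lemma demoulin_identity_at :
  u p != 0 -> v p != 0 -> a p - b p != 0 -> 0 < Ei p -> 0 < Ej p ->
  is_derive p wj u 0 -> is_derive p wj v v' ->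
  is_derive p wj a (aj p) -> is_derive p wj b (bj p) ->
  is_derive p wj ai s -> is_derive p wj bi t ->
  is_derive p wj Ei (- 2 * (aj p * Ei p / (a p - b p))) -> is_derive p wj Ej g ->
  is_derive p wi u u' -> is_derive p wi v 0 ->
  is_derive p wi a (ai p) -> is_derive p wi b (bi p) ->
  is_derive p wi aj s -> is_derive p wi bj t ->
  is_derive p wi Ej (- 2 * (bi p * Ej p / (b p - a p))) -> is_derive p wi Ei h ->
  'D_wj T1 p - 'D_wi T2 p =
  2 * u p * v p / (Num.sqrt (Ei p) * Num.sqrt (Ej p) * (a p - b p)) *
    (be * 'D_wj P p + al * 'D_wi Q p).
Proof.
move=> u0 v0 ab0 Ei0 Ej0 uj vj daj dbj aij bij Eij Ejj ui vi dai dbi aji bji Eji Eii.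
have Ei_neq : Ei p != 0 by rewrite gt_eqF.
have Ej_neq : Ej p != 0 by rewrite gt_eqF.
have A0 : Num.sqrt (Ei p) != 0 by rewrite gt_eqF // sqrtr_gt0.
have B0 : Num.sqrt (Ej p) != 0 by rewrite gt_eqF // sqrtr_gt0.
have ba0 : b p - a p != 0 by rewrite -opprB oppr_eq0.
have ab2 : (a p - b p) ^+ 2 != 0 by rewrite expf_neq0.
have ba2 : (b p - a p) ^+ 2 != 0 by rewrite expf_neq0.
have [_ dT1] := is_derive_mul (is_derive_add
  (is_derive_mul (is_derive_mul (is_derive_mul (is_derive_csts p wj al) (is_derive_exp2 uj)) bij)
     (is_derive_inv Ei_neq Eij))
  (is_derive_opp (is_derive_mul (is_derive_mul (is_derive_opp
     (is_derive_mul (is_derive_csts p wj be) (is_derive_exp2 vj))) aij)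
     (is_derive_inv Ej_neq Ejj))))
  (is_derive_inv ab2 (is_derive_exp2 (is_derive_add daj (is_derive_opp dbj)))).
have [_ dT2] := is_derive_mul (is_derive_add
  (is_derive_mul (is_derive_mul (is_derive_opp
     (is_derive_mul (is_derive_csts p wi be) (is_derive_exp2 vi))) aji)
     (is_derive_inv Ej_neq Eji))
  (is_derive_opp (is_derive_mul (is_derive_mul (is_derive_mul (is_derive_csts p wi al)
     (is_derive_exp2 ui)) bji) (is_derive_inv Ei_neq Eii))))
  (is_derive_inv ba2 (is_derive_exp2 (is_derive_add dbi (is_derive_opp dai)))).
have [_ dP] := is_derive_mul (is_derive_mul
  (is_derive_mul vj (is_derive_inv u0 uj))
  (is_derive_mul (is_derive_sqrt Ei0 Eij) (is_derive_inv B0 (is_derive_sqrt Ej0 Ejj))))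
  (is_derive_mul aij (is_derive_inv ab0 (is_derive_add daj (is_derive_opp dbj)))).
have [_ dQ] := is_derive_mul (is_derive_mul
  (is_derive_mul ui (is_derive_inv v0 vi))
  (is_derive_mul (is_derive_sqrt Ej0 Eji) (is_derive_inv A0 (is_derive_sqrt Ei0 Eii))))
  (is_derive_mul bji (is_derive_inv ab0 (is_derive_add dai (is_derive_opp dbi)))).
have {}dT1 : 'D_wj T1 p = _ := dT1.
have {}dT2 : 'D_wi T2 p = _ := dT2.
have {}dP : 'D_wj P p = _ := dP.
have {}dQ : 'D_wi Q p = _ := dQ.
rewrite dT1 dT2 dP dQ.
have EiE : Ei p = Num.sqrt (Ei p) ^+ 2 by rewrite sqr_sqrtr // ltW.
have EjE : Ej p = Num.sqrt (Ej p) ^+ 2 by rewrite sqr_sqrtr // ltW.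
rewrite {dT1 dT2 dP dQ uj vj daj dbj aij bij Eij Ejj ui vi dai dbi aji bji Eji Eii}.
set A := Num.sqrt (Ei p) in EiE A0 *; set B := Num.sqrt (Ej p) in EjE B0 *.
exact: demoulin_identity_alg.
Qed.

End DemoulinIdentity.

Section ChartIdentity.
Variables (R : realType) (D : set 'rV[R]_2) (q0 p0 : 'rV[R]_6).
Variables (fr tg : 'rV[R]_2 -> 'rV[R]_6) (k : 'I_2 -> 'rV[R]_2 -> R).
Hypothesis S : principal_chart D q0 p0 fr tg k.
Variables (i j : 'I_2) (u v : 'rV[R]_2 -> R) (al be : R) (Q : 'I_2 -> 'rV[R]_2 -> R).
Hypothesis ij : i != j.
Hypotheses (u_smooth : smooth D u) (v_smooth : smooth D v).
Hypotheses (u_neq0 : forall p, D p -> u p != 0) (v_neq0 : forall p, D p -> v p != 0).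
Hypotheses (u_const : forall p, D p -> partial j u p = 0)
  (v_const : forall p, D p -> partial i v p = 0).
Hypotheses (Qi : forall p, D p -> Q i p = al * u p ^+ 2)
  (Qj : forall p, D p -> Q j p = - (be * v p ^+ 2)).

(** The left-hand side of Demoulin's equation multiplied by be, with eps^2 = al / be. *)
Definition demoulin_lhs (p : 'rV[R]_2) : R :=
  be * partial j (fun x => v x / u x * (Num.sqrt (metric fr i x) / Num.sqrt (metric fr j x))
             * (partial i (k i) x / (k i x - k j x))) p +
  al * partial i (fun x => u x / v x * (Num.sqrt (metric fr j x) / Num.sqrt (metric fr i x))
             * (partial j (k j) x / (k i x - k j x))) p.

(** The integrability condition of the closed form is Demoulin's equation, up to a
    factor without zeros. *)
Lemma twist_demoulin p : D p ->
  partial j (twist fr k Q i j) p - partial i (twist fr k Q j i) p =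
  2 * u p * v p / (Num.sqrt (metric fr i p) * Num.sqrt (metric fr j p) * (k i p - k j p))
   * demoulin_lhs p.
Proof.
move=> Dp; have Do := chart_open S; have ji : j != i by rewrite eq_sym.
have dk l m := smooth_is_derive l (chart_smooth S m) Dp.
have ddk l m n := smooth_is_derive l (smooth_partial m (chart_smooth S n)) Dp.
have dm l m := smooth_is_derive l (smooth_metric S m) Dp.
have dE l m : l != m -> is_derive p (delta_mx 0 m) (metric fr l)
    (- 2 * (partial m (k l) p * metric fr l p / (k l p - k m p))).
  by move=> lm; rewrite -(partial_metric S lm Dp).
have uj := smooth_is_derive j u_smooth Dp; rewrite u_const // in uj.
have vi := smooth_is_derive i v_smooth Dp; rewrite v_const // in vi.
have aji := ddk i j i; rewrite (schwarz i j Do (chart_smooth S i) Dp) in aji.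
have bji := ddk i j j; rewrite (schwarz i j Do (chart_smooth S j) Dp) in bji.
rewrite -(demoulin_identity_at al be (u_neq0 Dp) (v_neq0 Dp) (curvature_neq S ij Dp)
  (metric_gt0 S i Dp) (metric_gt0 S j Dp) uj (smooth_is_derive j v_smooth Dp)
  (dk j i) (dk j j) (ddk j i i) (ddk j i j) (dE i j ij) (dm j j)
  (smooth_is_derive i u_smooth Dp) vi (dk i i) (dk i j) aji bji (dE j i ji) (dm i i)).
congr (_ - _); apply: (eq_on_derive _ Do) => // x Dx; rewrite /twist Qi // Qj //.
Qed.

End ChartIdentity.

(** * The closed form with a prescribed diagonal of q *)

Section WedgeAlgebra.
Variable R : realType.
Implicit Types (a b c : 'rV[R]_6) (A B : 'M[R]_6).

Lemma wedgeDl a b c : wedge (a + b) c = wedge a c + wedge b c.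
Proof.
by rewrite /wedge raddfD /= !mulmxDr mulmxDl opprD addrACA.
Qed.

Lemma wedgeC a b : wedge a b = - wedge b a.
Proof. by rewrite /wedge opprB. Qed.

Lemma wedgeDr a b c : wedge c (a + b) = wedge c a + wedge c b.
Proof. by rewrite wedgeC wedgeDl opprD -!wedgeC. Qed.

Lemma wedgeZl (x : R) a b : wedge (x *: a) b = x *: wedge a b.
Proof.
by rewrite /wedge linearZ /= -!scalemxAr -!scalemxAl scalerBr.
Qed.

Lemma wedgeZr (x : R) a b : wedge a (x *: b) = x *: wedge a b.
Proof. by rewrite wedgeC wedgeZl -scalerN -wedgeC. Qed.

Lemma wedgeNr a b : wedge a (- b) = - wedge a b.
Proof. by rewrite -scaleN1r wedgeZr scaleN1r. Qed.

Lemma wedgeNl a b : wedge (- a) b = - wedge a b.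
Proof. by rewrite -scaleN1r wedgeZl scaleN1r. Qed.

Lemma mulmx_eq0_rows A B : (forall c, c *m A *m B = 0) -> A *m B = 0.
Proof. by move=> H; apply/row_matrixP => r; rewrite row_mul rowE H row0. Qed.

Lemma lie_bracket_lincomb A B (x y z w : R) : A *m B = 0 -> B *m A = 0 ->
  lie_bracket (x *: A + y *: B) (z *: A + w *: B) = 0.
Proof.
move=> AB BA; rewrite /lie_bracket !mulmxDl !mulmxDr -!scalemxAl -!scalemxAr AB BA.
by rewrite !scaler0 !addr0 !add0r !scalerA [z * x]mulrC [w * y]mulrC subrr.
Qed.

Lemma weight_alg (q a b m : R) : a - b != 0 -> m != 0 ->
  a * (- (m * (q / ((a - b) * m))) * (-1 + b * 0)) -
  - (m * (q / ((a - b) * m))) * (0 + b * -1) = q.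
Proof. by move=> ab0 m0; field; rewrite ab0 m0. Qed.

Lemma partial_weight_alg (q a b da db m : R) : a - b != 0 -> m != 0 ->
  q * (- ((a - b) * (- 2 * (da * m / (a - b))) + m * (da - db)) / ((a - b) * m) ^+ 2) +
  ((a - b) * m)^-1 * 0 = - (q / ((a - b) * m) * (db + da) / (b - a)).
Proof.
move=> ab0 m0; have ba0 : b - a != 0 by rewrite -opprB oppr_eq0.
by field; rewrite ab0 ba0 m0.
Qed.

Lemma twist_weight_alg (q r a b da db m n : R) : a - b != 0 -> m != 0 -> n != 0 ->
  (q * db / m - r * da / n) / (a - b) ^+ 2 =
  (r / ((b - a) * n) * da + q / ((a - b) * m) * db) / (a - b).
Proof.
move=> ab0 m0 n0; have ba0 : b - a != 0 by rewrite -opprB oppr_eq0.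
by field; rewrite ab0 ba0 m0 n0.
Qed.

(** f, t, X, Y, Z stand for f, t, f_i, f_j, f_ij.  The two sides are compared in the basis
    f /\ t, f /\ X, f /\ Y, t /\ X, t /\ Y. *)
Lemma closed_form_alg (f t X Y Z : 'rV[R]_6)
    (a b ai aj bi bj Bi Bj Ti Tj dBi dBj dT : R) :
  a - b != 0 ->
  Z = (a - b)^-1 *: (bi *: Y - aj *: X) ->
  Ti = (Bj * ai + Bi * bi) / (a - b) -> Tj = (Bi * bj + Bj * aj) / (b - a) ->
  dBj = - (Bj * (ai + bi) / (a - b)) -> dBi = - (Bi * (bj + aj) / (b - a)) ->
  (wedge (dBj *: (t + a *: f) + Bj *: (- (a *: X) + (ai *: f + a *: X))) Y +
   wedge (Bj *: (t + a *: f)) Z) +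
  (wedge (dT *: f + Tj *: X) t + wedge (Tj *: f) (- (a *: X))) =
  (wedge (dBi *: (t + b *: f) + Bi *: (- (b *: Y) + (bj *: f + b *: Y))) X +
   wedge (Bi *: (t + b *: f)) Z) +
  (wedge (dT *: f + Ti *: Y) t + wedge (Ti *: f) (- (b *: Y))).
Proof.
move=> ab0 -> -> -> -> ->.
have ba0 : b - a != 0 by rewrite -opprB oppr_eq0.
rewrite !(wedgeDl, wedgeDr, wedgeZl, wedgeZr, wedgeNl, wedgeNr) (wedgeC X t) (wedgeC Y t).
move: (wedge t X) (wedge t Y) (wedge f X) (wedge f Y) (wedge f t) (wedge X Y) (wedge Y X)
  (wedge X X) (wedge Y Y) => M1 M2 M3 M4 M5 M6 M7 M8 M9.
by apply/matrixP => r s; rewrite !mxE; field; rewrite ?ab0 ?ba0.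
Qed.

End WedgeAlgebra.

Definition other (l : 'I_2) : 'I_2 := if l == 0 then 1 else 0.

Lemma otherE i j : i != j -> other i = j.
Proof. by move: i j; do 2!apply: cases2. Qed.

Lemma other_neq l : l != other l.
Proof. by move: l; apply: cases2. Qed.

Section Construction.
Variables (R : realType) (D : set 'rV[R]_2) (q0 p0 : 'rV[R]_6).
Variables (fr tg : 'rV[R]_2 -> 'rV[R]_6) (k : 'I_2 -> 'rV[R]_2 -> R).
Hypothesis S : principal_chart D q0 p0 fr tg k.
Variable Q : 'I_2 -> 'rV[R]_2 -> R.
Hypothesis Q_smooth : forall l, smooth D (Q l).
Hypothesis Q_const : forall i j p, i != j -> D p -> partial j (Q i) p = 0.
Hypothesis Q_integrable : forall i j p, i != j -> D p ->
  partial j (twist fr k Q i j) p = partial i (twist fr k Q j i) p.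
Implicit Types (p : 'rV[R]_2) (i j l m : 'I_2).

Let Do := chart_open S.
Let sfr := fr_smooth S.
Let stg := tg_smooth S.

(** The coefficient c or b of the normal form, determined by q(d_l, d_l) = Q l. *)
Definition weight l p : R := Q l p / ((k l p - k (other l) p) * metric fr l p).

(** The closed form with prescribed diagonal of q in the gauge where the coefficients
    of the curvature sphere t + k_l f next to f_l vanish. *)
Definition normalized_form l p : 'M[R]_6 :=
  wedge (weight l p *: (tg p + k (other l) p *: fr p)) (partial l fr p) +
  wedge (twist fr k Q l (other l) p *: fr p) (tg p).

Lemma weight_den_neq0 l p : D p -> (k l p - k (other l) p) * metric fr l p != 0.
Proof.
by move=> Dp; exact: mulf_neq0 (curvature_neq S (other_neq l) Dp) (metric_neq0 S l Dp).
Qed.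

Lemma smooth_weight l : smooth D (weight l).
Proof.
apply: (smooth_mul Do) => //; apply: (smooth_inv Do); last exact: weight_den_neq0.
apply: (smooth_mul Do); last exact: smooth_metric S l.
apply: (smooth_add Do); first exact: chart_smooth S l.
by apply: (smooth_opp Do); exact: chart_smooth S _.
Qed.

Lemma smooth_twist i j : i != j -> smooth D (twist fr k Q i j).
Proof.
move=> ij; have sk := chart_smooth S.
have sinv l : smooth D (fun p => (metric fr l p)^-1).
  by apply: (smooth_inv Do); [exact: smooth_metric S l|move=> p Dp; have := metric_neq0 S l Dp].
have term l m n : smooth D (fun p => Q l p * partial m (k n) p / metric fr l p).
  apply: (smooth_mul Do) => //; apply: (smooth_mul Do) => //.
  by apply: smooth_partial; exact: sk.
apply: (smooth_mul Do).
  by apply: (smooth_add Do); [exact: term|apply: (smooth_opp Do); exact: term].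
apply: (smooth_inv Do) => [|p Dp]; last by rewrite expf_neq0 // (curvature_neq S ij Dp).
have sd : smooth D (fun p => k i p - k j p).
  by apply: (smooth_add Do); [exact: sk|apply: (smooth_opp Do); exact: sk].
apply: (@smooth_ext _ _ _ (fun p => (k i p - k j p) * (k i p - k j p))) => //.
exact: (smooth_mul Do).
Qed.

Lemma smooth_normalized_form l : smooth D (normalized_form l).
Proof.
apply: (smooth_addmx Do); apply: (smooth_wedge Do) => //.
- apply: (smooth_scalemx Do); first exact: smooth_weight.
  apply: (smooth_addmx Do) => //; apply: (smooth_scalemx Do) => //.
  exact: chart_smooth S _.
- exact: smooth_partial.
- by apply: (smooth_scalemx Do) => //; exact: smooth_twist (other_neq l).
Qed.

Lemma normalized_form_wedge l p : D p ->
  in_wedge (legendre_lift fr tg p) (perp (legendre_lift fr tg p)) (normalized_form l p).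
Proof.
move=> Dp; have [ff ft tt] := fiber_null S Dp.
have [lf lt _ _] := tangent_normal S l Dp.
have in_fiber (x y : R) : ((x *: fr p + y *: tg p)%R <= legendre_lift fr tg p)%MS.
  by apply: (introT (sub_col_mx2P (fr p) (tg p) _)); exists x, y.
have in_perp z : form42 z (fr p) = 0 -> form42 z (tg p) = 0 ->
    (z <= perp (legendre_lift fr tg p))%MS.
  by move=> zf zt; exact: (introT (sub_perpP (fr p) (tg p) z) (conj zf zt)).
apply: in_wedge2.
- by rewrite scalerDr scalerA addrC; exact: in_fiber.
- exact: in_perp.
- by have := in_fiber (twist fr k Q l (other l) p) 0; rewrite scale0r addr0.
- by apply: in_perp; rewrite // form42C.
Qed.

Lemma tangent_normalized_form l p : D p ->
  partial l fr p *m normalized_form l p =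
  (- (metric fr l p * weight l p)) *: (tg p + k (other l) p *: fr p).
Proof.
move=> Dp; have [lf lt _ _] := tangent_normal S l Dp.
rewrite /normalized_form mulmxDr !wedgeE /metric.
move: lf lt; move: (partial l fr p) => X Xf Xt.
rewrite !form42Zl form42Dl form42Zl (form42C (tg p)) (form42C (fr p)) Xt Xf.
by rewrite !mulr0 addr0 mulr0 !scale0r subr0 sub0r addr0 scalerA scaleNr.
Qed.

Lemma tangent_normalized_form_off i j p : i != j -> D p ->
  partial i fr p *m normalized_form j p = 0.
Proof.
move=> ij Dp; have [lf lt _ _] := tangent_normal S i Dp.
have := tangent_orthogonal S ij Dp.
rewrite /normalized_form mulmxDr !wedgeE.
move: lf lt; move: (partial i fr p) (partial j fr p) => X Y Xf Xt XY.
rewrite !form42Zl form42Dl form42Zl (form42C (tg p)) (form42C (fr p)) (form42C Y) Xt Xf XY.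
by rewrite !mulr0 addr0 mulr0 !scale0r !subr0 addr0.
Qed.

Lemma normalized_form_mul0 i j p : i != j -> D p -> normalized_form i p *m normalized_form j p = 0.
Proof.
move=> ij Dp; apply: mulmx_eq0_rows => c.
have [ff ft tt] := fiber_null S Dp.
have [_ [fe te] _] := in_wedge_perp ff ft tt (normalized_form_wedge j Dp).
have Ye := tangent_normalized_form_off ij Dp.
move: (normalized_form j p) fe te Ye => B fe te Ye.
rewrite /normalized_form [c *m _]mulmxDr !wedgeE.
rewrite [_ *m B]mulmxDl mulmxBl mulmxBl -!scalemxAl mulmxDl -!scalemxAl.
by rewrite fe te Ye !(scaler0, addr0, subr0).
Qed.

Lemma diagonal_normalized_form l p : D p ->
  diagonal q0 p0 fr k normalized_form l p = Q l p.
Proof.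
move=> Dp; have [fq fp tq tp] := fiber_normal S Dp.
rewrite /diagonal /tangent_pairing /pairing (tangent_normalized_form l Dp).
rewrite !form42Zl !form42Dl !form42Zl fq fp tq tp /weight.
have := weight_den_neq0 l Dp; rewrite mulf_eq0 negb_or => /andP[kn m0].
exact: weight_alg.
Qed.

(** The constancy of Q l in the direction m, rewritten by the Codazzi equations. *)
Lemma partial_weight l m p : l != m -> D p ->
  partial m (weight l) p =
  - (weight l p * (partial m (k m) p + partial m (k l) p) / (k m p - k l p)).
Proof.
move=> lm Dp; have ol := otherE lm.
have kn := curvature_neq S lm Dp; have m0 := metric_neq0 S l Dp.
have dE := smooth_is_derive m (smooth_metric S l) Dp.
rewrite (partial_metric S lm Dp) in dE.
have dQ := smooth_is_derive m (Q_smooth l) Dp; rewrite (Q_const lm Dp) in dQ.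
have dk n := smooth_is_derive m (chart_smooth S n) Dp.
have [_ dw] := is_derive_mul dQ (is_derive_inv (mulf_neq0 kn m0)
  (is_derive_mul (is_derive_add (dk l) (is_derive_opp (dk m))) dE)).
rewrite /weight ol; apply: etrans dw _.
exact: partial_weight_alg.
Qed.

Lemma twist_weight l m p : l != m -> D p ->
  twist fr k Q l m p =
  (weight m p * partial l (k l) p + weight l p * partial l (k m) p) / (k l p - k m p).
Proof.
move=> lm Dp; have ml : m != l by rewrite eq_sym.
rewrite /weight (otherE lm) (otherE ml).
exact: twist_weight_alg (curvature_neq S lm Dp) (metric_neq0 S l Dp) (metric_neq0 S m Dp).
Qed.

Lemma is_derive_normalized_form i j p : i != j -> D p ->
  is_derive p (delta_mx 0 i) (normalized_form j)
  ((wedge (partial i (weight j) p *: (tg p + k i p *: fr p) +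
           weight j p *: (- (k i p *: partial i fr p) +
             (partial i (k i) p *: fr p + k i p *: partial i fr p))) (partial j fr p) +
    wedge (weight j p *: (tg p + k i p *: fr p)) (partial i (partial j fr) p)) +
   (wedge (partial i (twist fr k Q j i) p *: fr p + twist fr k Q j i p *: partial i fr p) (tg p)
    + wedge (twist fr k Q j i p *: fr p) (- (k i p *: partial i fr p)))).
Proof.
move=> ij Dp; have ji : j != i by rewrite eq_sym.
have dfr := smooth_is_derive i sfr Dp.
have dtg := smooth_is_derive i stg Dp; rewrite (partial_tg S i Dp) in dtg.
have dk := smooth_is_derive i (chart_smooth S i) Dp.
have dw := smooth_is_derive i (smooth_weight j) Dp.
have dt := smooth_is_derive i (smooth_twist ji) Dp.
have dd := smooth_is_derive i (smooth_partial j sfr) Dp.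
rewrite /normalized_form (otherE ji).
apply: is_derive_addmx; apply: is_derive_wedge => //.
  exact: is_derive_scalemx dw (is_derive_addmx dtg (is_derive_scalemx dk dfr)).
exact: is_derive_scalemx dt dfr.
Qed.

(** The coefficient of f /\ t in d eta vanishes by the integrability condition; the
    other four vanish by partial_weight and twist_weight. *)
Lemma normalized_form_closed i j p : D p ->
  partial i (normalized_form j) p = partial j (normalized_form i) p.
Proof.
move=> Dp; have [->//|ij] := eqVneq i j; have ji : j != i by rewrite eq_sym.
have [_ di] := is_derive_normalized_form ij Dp; have [_ dj] := is_derive_normalized_form ji Dp.
apply: etrans di _; apply: etrans _ (esym dj).
rewrite (mixed_comm S i j Dp) (Q_integrable ij Dp).
apply: closed_form_alg (curvature_neq S ij Dp) (mixed_partial S ij Dp)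
  (twist_weight ij Dp) (twist_weight ji Dp) (partial_weight ji Dp) (partial_weight ij Dp).
Qed.

Lemma normalized_form_bracket p (X Y : 'rV[R]_2) : D p ->
  2 *: lie_bracket (form1_at normalized_form p X) (form1_at normalized_form p Y) = 0.
Proof.
move=> Dp.
have E Z : form1_at normalized_form p Z = Z 0 0 *: normalized_form 0 p + Z 0 1 *: normalized_form 1 p.
  rewrite /form1_at !big_ord_recl big_ord0 addr0.
  by congr (_ + Z 0 _ *: normalized_form _ p); exact/val_inj.
rewrite !E lie_bracket_lincomb ?scaler0 //; exact: normalized_form_mul0.
Qed.

End Construction.

(** * Signature of diagonal forms *)

Section DiagonalForms.
Variable R : realType.
Implicit Types (a b : R) (X Y : 'rV[R]_2).

Definition diag_form a b X Y : R := a * (X 0 0 * Y 0 0) + b * (X 0 1 * Y 0 1).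

Lemma diag_formN a b : (fun X Y => - diag_form a b X Y) = diag_form (- a) (- b).
Proof.
by apply/funext => X; apply/funext => Y; rewrite /diag_form opprD !mulNr.
Qed.

Lemma nondegenerate_diag a b : Defs.nondegenerate (diag_form a b) <-> a != 0 /\ b != 0.
Proof.
have e l m : (delta_mx 0 l : 'rV[R]_2) 0 m = (m == l)%:R by rewrite mxE eqxx.
split=> [nd|[a0 b0] X XY].
  split; apply/eqP => z.
    have /rowP/(_ 0) : (delta_mx 0 0 : 'rV[R]_2) = 0.
      by apply: nd => Y; rewrite /diag_form z !e /= !mul0r mulr0 addr0.
    by rewrite e mxE => /eqP; rewrite oner_eq0.
  have /rowP/(_ 1) : (delta_mx 0 1 : 'rV[R]_2) = 0.
    by apply: nd => Y; rewrite /diag_form z !e /= !mul0r mulr0 addr0.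
  by rewrite e mxE => /eqP; rewrite oner_eq0.
apply/rowP; apply: cases2; rewrite mxE.
  have /eqP := XY (delta_mx 0 0); rewrite /diag_form !e /= mulr1 !mulr0 addr0.
  by rewrite mulf_eq0 (negbTE a0) => /eqP.
have /eqP := XY (delta_mx 0 1); rewrite /diag_form !e /= mulr1 !mulr0 add0r.
by rewrite mulf_eq0 (negbTE b0) => /eqP.
Qed.

Lemma sig_pos0 a b : sig_pos (diag_form a b) 0.
Proof.
exists 0 => [|X]; first by rewrite /row_free mxrank0.
by move=> /submxP[d ->]; rewrite mulmx0 eqxx.
Qed.

Lemma sig_pos1P a b : sig_pos (diag_form a b) 1 <-> 0 < a \/ 0 < b.
Proof.
have line (l : 'I_2) : 0 < (if l == 0 then a else b) -> sig_pos (diag_form a b) 1.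
  move=> pos; exists (delta_mx 0 l).
    by rewrite /row_free mxrank_delta.
  move=> X /sub_rVP[c ->]; rewrite scaler_eq0 negb_or => /andP[c0 _].
  have c2 : 0 < c ^+ 2 by rewrite lt_neqAle eq_sym sqrf_eq0 c0 sqr_ge0.
  rewrite /diag_form !mxE !eqxx /=; move: l pos; apply: cases2 => /= pos;
    by rewrite !mulr0 !mulr1 ?mulr0 ?addr0 ?add0r -expr2 mulr_gt0.
split=> [[W Wf pos]|[a0|b0]]; [|exact: (line 0)|exact: (line 1)].
have W0 : W != 0 by rewrite -mxrank_eq0 (eqP Wf).
have := pos W (submx_refl _) W0; rewrite /diag_form -!expr2 => H.
have [a0|a0] := ltP 0 a; first by left.
have [b0|b0] := ltP 0 b; first by right.
have := ler_wnM2r a0 (sqr_ge0 (W 0 0)); have := ler_wnM2r b0 (sqr_ge0 (W 0 1)).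
by move: H; rewrite !mul0r ![_ ^+ 2 * _]mulrC => H1 H2 H3; lra.
Qed.

Lemma sig_pos2P a b : sig_pos (diag_form a b) 2 <-> 0 < a /\ 0 < b.
Proof.
have e l m : (delta_mx 0 l : 'rV[R]_2) 0 m = (m == l)%:R by rewrite mxE eqxx.
split=> [[W Wf pos]|[a0 b0]].
  have Wfull : row_full W by rewrite row_full_unit -row_free_unit.
  have dn l : (delta_mx 0 l : 'rV[R]_2) != 0.
    by apply/eqP => /rowP/(_ l)/eqP; rewrite e eqxx mxE oner_eq0.
  split.
    by have := pos _ (submx_full _ Wfull) (dn 0); rewrite /diag_form !e /= !mulr1 !mulr0 addr0.
  by have := pos _ (submx_full _ Wfull) (dn 1); rewrite /diag_form !e /= !mulr1 !mulr0 add0r.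
exists 1%:M => [|X _ X0]; first by rewrite row_free_unit unitmx1.
rewrite /diag_form -!expr2.
have [x0|x0] := eqVneq (X 0 0) 0; last first.
  rewrite ltr_pwDl //; last by rewrite mulr_ge0 ?sqr_ge0 // ltW.
  by rewrite mulr_gt0 // lt_neqAle eq_sym sqrf_eq0 x0 sqr_ge0.
have x1 : X 0 1 != 0.
  by apply: contra X0 => /eqP x1; apply/eqP/rowP; apply: cases2; rewrite mxE.
by rewrite x0 expr0n mulr0 add0r mulr_gt0 // lt_neqAle eq_sym sqrf_eq0 x1 sqr_ge0.
Qed.

(** The plane has no subspace of dimension greater than 2. *)
Lemma sig_pos3 (q : 'rV[R]_2 -> 'rV[R]_2 -> R) n : ~ sig_pos q n.+3.
Proof.
move=> [W /eqP Wf _]; have := rank_leq_col W; rewrite Wf //.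
Qed.

Lemma sig_pos_sign a b a' b' n : (0 < a) = (0 < a') -> (0 < b) = (0 < b') ->
  sig_pos (diag_form a b) n <-> sig_pos (diag_form a' b') n.
Proof.
move=> ea eb; case: n => [|[|[|n]]].
- by split=> _; exact: sig_pos0.
- by rewrite (sig_pos1P a b) (sig_pos1P a' b') ea eb.
- by rewrite (sig_pos2P a b) (sig_pos2P a' b') ea eb.
- by split=> /sig_pos3.
Qed.

Lemma sig_neg_sign a b a' b' n : (a < 0) = (a' < 0) -> (b < 0) = (b' < 0) ->
  sig_neg (diag_form a b) n <-> sig_neg (diag_form a' b') n.
Proof.
by move=> ea eb; rewrite /sig_neg !diag_formN; apply: sig_pos_sign; rewrite !oppr_gt0.
Qed.

(** Non-degeneracy, and in the next lemma non-vanishing, are properties of the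
    signature; so they hold everywhere as soon as they hold at one point. *)
Lemma nondegenerate_sig a b : Defs.nondegenerate (diag_form a b) <->
  [\/ sig_pos (diag_form a b) 2, sig_neg (diag_form a b) 2 |
      sig_pos (diag_form a b) 1 /\ sig_neg (diag_form a b) 1].
Proof.
rewrite /sig_neg diag_formN.
split=> [/nondegenerate_diag|].
  rewrite !neq_lt => -[/orP[a0|a0] /orP[b0|b0]].
  - by apply: Or32; apply/sig_pos2P; rewrite !oppr_gt0.
  - by apply: Or33; split; apply/sig_pos1P; rewrite ?oppr_gt0; [right|left].
  - by apply: Or33; split; apply/sig_pos1P; rewrite ?oppr_gt0; [left|right].
  - by apply: Or31; apply/sig_pos2P.
move=> H; apply/nondegenerate_diag; move: H => [/sig_pos2P[a0 b0]|/sig_pos2P|].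
- by rewrite !gt_eqF.
- by rewrite !oppr_gt0 => -[a0 b0]; rewrite !lt_eqF.
- move=> [/sig_pos1P + /sig_pos1P]; rewrite !oppr_gt0.
  by move=> [a0|b0] [a1|b1]; rewrite ?(gt_eqF a0) ?(lt_eqF a1) ?(gt_eqF b0) ?(lt_eqF b1) //;
    [have := lt_trans a0 a1|have := lt_trans b0 b1]; rewrite ltxx.
Qed.

Lemma nonzero_sig a b : a != 0 \/ b != 0 <->
  sig_pos (diag_form a b) 1 \/ sig_neg (diag_form a b) 1.
Proof.
rewrite /sig_neg diag_formN; split=> [[]|].
- by rewrite neq_lt => /orP[a0|a0]; [right|left]; apply/sig_pos1P; rewrite ?oppr_gt0; left.
- by rewrite neq_lt => /orP[b0|b0]; [right|left]; apply/sig_pos1P; rewrite ?oppr_gt0; right.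
move=> [/sig_pos1P[a0|b0]|/sig_pos1P]; rewrite ?oppr_gt0.
- by left; rewrite gt_eqF.
- by right; rewrite gt_eqF.
- by move=> [a0|b0]; [left|right]; rewrite lt_eqF.
Qed.

End DiagonalForms.

(** * The equivalence *)

Section Signs.
Variable R : realType.

Lemma demoulin_factor_neq0 (x y a b d : R) : x != 0 -> y != 0 -> 0 < a -> 0 < b ->
  d != 0 -> 2 * x * y / (Num.sqrt a * Num.sqrt b * d) != 0.
Proof.
move=> x0 y0 a0 b0 d0; rewrite !(mulf_neq0, invr_neq0) ?pnatr_eq0 //.
  by rewrite gt_eqF // sqrtr_gt0.
by rewrite gt_eqF // sqrtr_gt0.
Qed.

Lemma sign_scale (a x y : R) : 0 < x -> 0 < y ->
  (0 < a * x) = (0 < a * y) /\ (a * x < 0) = (a * y < 0).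
Proof. by move=> x0 y0; rewrite !pmulr_lgt0 // !pmulr_llt0. Qed.

End Signs.

Section Equivalence.
Variables (R : realType) (D : set 'rV[R]_2) (q0 p0 : 'rV[R]_6).
Variables (fr tg : 'rV[R]_2 -> 'rV[R]_6) (k : 'I_2 -> 'rV[R]_2 -> R).
Hypothesis S : principal_chart D q0 p0 fr tg k.
Implicit Types (p : 'rV[R]_2) (i j l m : 'I_2) (Q : 'I_2 -> 'rV[R]_2 -> R).

Let Do := chart_open S.
Let cD := chart_domain S.
Let F := legendre_lift fr tg.

(** The conditions on the diagonal of q under which it comes from a closed form. *)
Definition diagonal_data Q : Prop :=
  [/\ forall l, smooth D (Q l),
      forall i j p, i != j -> D p -> partial j (Q i) p = 0 &
      forall i j p, i != j -> D p ->
        partial j (twist fr k Q i j) p = partial i (twist fr k Q j i) p].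

Lemma lie_applicable_diagonal_data eta : lie_applicable_by D F eta ->
  exists2 Q, diagonal_data Q &
    forall p, D p -> q_tensor F eta p = diag_form (Q 0 p) (Q 1 p).
Proof.
move=> [[eta_smooth eta_wedge] closed _ _ _].
have eta_closed i j p : D p -> partial i (eta j) p = partial j (eta i) p.
  move=> Dp; have /eqP := closed p Dp; rewrite subr_eq0 => /eqP E.
  move: i; apply: cases2; move: j; apply: cases2; [exact: erefl|exact: E|exact: esym E|exact: erefl].
exists (diagonal q0 p0 fr k eta).
  split=> [l|i j p ij Dp|i j p ij Dp].
  - exact: (smooth_diagonal S eta_smooth).
  - exact: (diagonal_constant S eta_smooth eta_wedge eta_closed).
  - exact: (twist_integrable S eta_smooth eta_wedge eta_closed).
move=> p Dp; apply/funext => X; apply/funext => Y.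
exact: (q_tensor_diagonal S eta_smooth eta_wedge eta_closed).
Qed.

(** The signature of q depends only on the signs of its diagonal entries. *)
Lemma diagonal_data_lie_applicable Q : diagonal_data Q ->
  (exists p, D p /\ (Q 0 p != 0 \/ Q 1 p != 0)) ->
  (forall l p r, D p -> D r ->
     (0 < Q l p) = (0 < Q l r) /\ (Q l p < 0) = (Q l r < 0)) ->
  exists2 eta, lie_applicable_by D F eta &
    forall p, D p -> q_tensor F eta p = diag_form (Q 0 p) (Q 1 p).
Proof.
move=> [sQ cQ iQ] [p1 [Dp1 Q1]] sign.
have qE p : D p -> q_tensor F (normalized_form fr tg k Q) p = diag_form (Q 0 p) (Q 1 p).
  move=> Dp; apply/funext => X; apply/funext => Y.
  rewrite (q_tensor_diagonal S (smooth_normalized_form S sQ)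
    (fun x Dx l => normalized_form_wedge S Q l Dx) (normalized_form_closed S sQ cQ iQ) X Y Dp).
  by rewrite !(diagonal_normalized_form S).
exists (normalized_form fr tg k Q) => //; split.
- split=> [l|p Dp l]; first exact: (smooth_normalized_form S sQ).
  exact: (normalized_form_wedge S Q l Dp).
- move=> p Dp; apply/eqP; rewrite subr_eq0; apply/eqP.
  exact: (normalized_form_closed S sQ cQ iQ).
- by move=> p Dp X Y; exact: (normalized_form_bracket S Q X Y Dp).
- have e l m : (delta_mx 0 l : 'rV[R]_2) 0 m = (m == l)%:R by rewrite mxE eqxx.
  case: Q1 => Q1; [exists p1, (delta_mx 0 0), (delta_mx 0 0)|
    exists p1, (delta_mx 0 1), (delta_mx 0 1)]; split=> //; rewrite qE // /diag_form !e /=;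
    by rewrite !mulr1 !mulr0 ?addr0 ?add0r; apply/eqP.
- move=> p r Dp Dr n; rewrite !qE //.
  have [s0 t0] := sign 0 p r Dp Dr; have [s1 t1] := sign 1 p r Dp Dr.
  by split; [exact: sig_pos_sign|exact: sig_neg_sign].
Qed.

Lemma sqrt_of_coordinate i j (q : 'rV[R]_2 -> R) (s : R) : i != j ->
  smooth D q -> (forall p, D p -> partial j q p = 0) -> s * s = 1 ->
  (forall p, D p -> 0 < s * q p) ->
  exists u : 'rV[R]_2 -> R, [/\ smooth D u, forall p, D p -> u p != 0,
    forall p, D p -> partial j u p = 0 & forall p, D p -> q p = s * u p ^+ 2].
Proof.
move=> ij sq q0' ss pos; exists (fun p => Num.sqrt (s * q p)).
have sm : smooth D (fun p => s * q p) by apply: (smooth_mul Do) => //; exact: smooth_cst.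
split=> [|p Dp|p Dp|p Dp].
- exact: (smooth_sqrt Do).
- by rewrite gt_eqF // sqrtr_gt0 pos.
- have dq := smooth_is_derive j sq Dp; rewrite q0' // in dq.
  have [_ du] := is_derive_sqrt (pos p Dp) (is_derive_mul (is_derive_csts p _ s) dq).
  by apply: etrans du _; rewrite !mulr0 addr0 mul0r.
- by rewrite sqr_sqrtr ?(ltW (pos p Dp)) // mulrA ss mul1r.
Qed.

(** The functions U, V are u, v regarded as functions of one variable; be = 1 or -1,
    whence eps^2 = be al = al / be. *)
Lemma diagonal_data_labelled Q i j (u v : 'rV[R]_2 -> R) (al be : R) (eps : R[i]) :
  i != j -> diagonal_data Q ->
  smooth D u -> smooth D v ->
  (forall p, D p -> u p != 0) -> (forall p, D p -> v p != 0) ->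
  (forall p, D p -> partial j u p = 0) -> (forall p, D p -> partial i v p = 0) ->
  (forall p, D p -> Q i p = al * u p ^+ 2) ->
  (forall p, D p -> Q j p = - (be * v p ^+ 2)) ->
  be * be = 1 -> eps ^+ 2 = (be * al)%:C%C ->
  demoulin_labelled D fr i j (k i) (k j) eps.
Proof.
move=> ij [_ _ iQ] su sv u0 v0 uj vi Qi Qj be2 eps2.
have ji : j != i by rewrite eq_sym.
have [U sU uE] := function_of_coordinate cD su ji uj.
have [V sV vE] := function_of_coordinate cD sv ij vi.
exists U, V; split=> [|p Dp|p Dp|E G P Q' p Dp].
- by [].
- by rewrite -uE // u0.
- by rewrite -vE // v0.
have := twist_demoulin S ij su sv u0 v0 uj vi Qi Qj Dp.
rewrite (iQ i j p ij Dp) subrr => /esym/eqP.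
(* The factor that relates integrability to Demoulin's equation has no zeros. *)
have c0 := demoulin_factor_neq0 (u0 p Dp) (v0 p Dp) (metric_gt0 S i Dp)
  (metric_gt0 S j Dp) (curvature_neq S ij Dp).
rewrite mulf_eq0 (negbTE c0) /= => /eqP.
rewrite /demoulin_lhs.
set Pd := partial j _ p; set Qd := partial i _ p => PQ.
rewrite eps2 -rmorphM -rmorphD /=.
have -> : partial j P p = Pd.
  by apply: (eq_on_derive _ Do) => // x Dx; rewrite /P -uE // -vE.
have -> : partial i Q' p = Qd.
  by apply: (eq_on_derive _ Do) => // x Dx; rewrite /Q' -uE // -vE.
rewrite (_ : _ + _ = 0) ?rmorph0 //.
by rewrite -[Pd]mul1r -be2 -!mulrA -mulrDr PQ mulr0.
Qed.

(** The closed form with q = al U^2 du^2 - V^2 dv^2 in the given labelling, where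
    eps^2 = al; both kinds of surfaces are covered, according to al. *)
Lemma labelled_lie_applicable i j (al : R) (eps : R[i]) :
  i != j -> eps ^+ 2 = al%:C%C -> demoulin_labelled D fr i j (k i) (k j) eps ->
  exists2 eta, lie_applicable_by D F eta &
    if al == 0 then forall p, D p -> ~ Defs.nondegenerate (q_tensor F eta p)
    else forall p, D p -> Defs.nondegenerate (q_tensor F eta p).
Proof.
move=> ij eps2 [U [V [[sU sV] U0 V0 eqn]]].
have ji : j != i by rewrite eq_sym.
pose u p := U (p 0 i); pose v p := V (p 0 j).
have su : smooth D u := smooth_of_smooth1 Do sU.
have sv : smooth D v := smooth_of_smooth1 Do sV.
have uj p : D p -> partial j u p = 0 by exact: partial_coord Do ji sU.
have vi p : D p -> partial i v p = 0 by exact: partial_coord Do ij sV.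
pose Q l p : R := if l == i then al * u p ^+ 2 else - (1 * v p ^+ 2).
have Qi p : D p -> Q i p = al * u p ^+ 2 by rewrite /Q eqxx.
have Qj p : D p -> Q j p = - (1 * v p ^+ 2) by rewrite /Q (negbTE ji).
have sqr2 (w : 'rV[R]_2 -> R) : smooth D w -> smooth D (fun p => w p ^+ 2).
  move=> sw; apply: (@smooth_ext _ _ _ (fun p => w p * w p)) => //.
  exact: smooth_mul.
have integ p : D p -> partial j (twist fr k Q i j) p = partial i (twist fr k Q j i) p.
  move=> Dp; apply/eqP; rewrite -subr_eq0.
  rewrite (twist_demoulin S ij su sv U0 V0 uj vi Qi Qj Dp).
  have /eqP := eqn p Dp; rewrite eps2 -rmorphM -rmorphD /= fmorph_eq0 => /eqP E.
  by rewrite /demoulin_lhs mul1r [X in _ * X]E mulr0.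
have mQ : diagonal_data Q.
  split=> [l|l m p lm Dp|l m p lm Dp].
  - rewrite /Q; case: (l == i).
      by apply: (smooth_mul Do); [exact: smooth_cst|exact: sqr2].
    by apply: (smooth_opp Do); apply: (smooth_mul Do); [exact: smooth_cst|exact: sqr2].
  - have [li|li] := eqVneq l i.
      have mj : m = j by apply: (other_index ij); rewrite -li eq_sym.
      have du := smooth_is_derive m su Dp; rewrite mj uj // in du.
      have [_ d] := is_derive_mul (is_derive_csts p _ al) (is_derive_exp2 du).
      rewrite mj /Q li eqxx; apply: etrans d _; rewrite !mulr0 addr0 //.
    have mi : m = i.
      by apply: (other_index ji); rewrite -(other_index ij li) eq_sym.
    have dv := smooth_is_derive m sv Dp; rewrite mi vi // in dv.
    have [_ d] := is_derive_opp (is_derive_mul (is_derive_csts p _ 1) (is_derive_exp2 dv)).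
    rewrite mi /Q (negbTE li); apply: etrans d _; rewrite !mulr0 addr0 oppr0 //.
  - have [li|li] := eqVneq l i.
      have mj : m = j by apply: (other_index ij); rewrite -li eq_sym.
      by rewrite li mj integ.
    have mi : m = i.
      by apply: (other_index ji); rewrite -(other_index ij li) eq_sym.
    by rewrite mi (other_index ij li) integ.
have u2 p : D p -> 0 < u p ^+ 2 by move=> Dp; rewrite lt_neqAle eq_sym sqrf_eq0 U0 // sqr_ge0.
have v2 p : D p -> 0 < v p ^+ 2 by move=> Dp; rewrite lt_neqAle eq_sym sqrf_eq0 V0 // sqr_ge0.
have Qi0 p : D p -> (Q i p != 0) = (al != 0).
  by move=> Dp; rewrite Qi // mulf_eq0 [u p ^+ 2 == 0]gt_eqF ?u2 // orbF.
have Qj0 p : D p -> Q j p != 0.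
  by move=> Dp; rewrite Qj // mul1r oppr_eq0 gt_eqF ?v2.
have [p1 Dp1] : D !=set0 by have [_] := cD.
have [||eta la qE] := diagonal_data_lie_applicable mQ.
- exists p1; split=> //; have := Qj0 p1 Dp1.
  by move: (j); apply: cases2 => H; [left|right].
- move=> l p r Dp Dr; have [->|/(other_index ij) ->] := eqVneq l i.
    by rewrite !Qi //; apply: sign_scale; exact: u2.
  by rewrite !Qj // !mul1r -!(mulN1r (_ ^+ 2)); apply: sign_scale; exact: v2.
exists eta => //.
have nd p : D p -> Defs.nondegenerate (q_tensor F eta p) <-> al != 0.
  move=> Dp; rewrite qE //; split.
    move=> /nondegenerate_diag[n0 n1]; rewrite -(Qi0 p Dp).
    by move: (i) n0 n1; apply: cases2.
  move=> al0; apply/nondegenerate_diag.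
  have := Qi0 p Dp; rewrite al0 => ni; have := Qj0 p Dp.
  by move: (i) (j) ij ni; do 2!apply: cases2.
by case: ifPn => [/eqP al0|al0] p Dp; [move=> /(nd p Dp); rewrite al0 eqxx|apply/(nd p Dp)].
Qed.

Lemma constant_nondegenerate (q : 'rV[R]_2 -> 'rV[R]_2 -> 'rV[R]_2 -> R)
    (a b : 'rV[R]_2 -> R) p r :
  (forall p, D p -> q p = diag_form (a p) (b p)) -> constant_signature D q ->
  D p -> D r -> Defs.nondegenerate (q p) -> Defs.nondegenerate (q r).
Proof.
move=> qE sig Dp Dr; have := sig p r Dp Dr; rewrite !qE // => H.
have [[P1 _] [N1 _]] := H 1%N; have [[P2 _] [N2 _]] := H 2%N.
move=> /nondegenerate_sig nd; apply/nondegenerate_sig.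
by case: nd => [/P2|/N2|[/P1 ? /N1 ?]]; [apply: Or31|apply: Or32|apply: Or33].
Qed.

Lemma constant_nonzero (q : 'rV[R]_2 -> 'rV[R]_2 -> 'rV[R]_2 -> R)
    (a b : 'rV[R]_2 -> R) p r :
  (forall p, D p -> q p = diag_form (a p) (b p)) -> constant_signature D q ->
  D p -> D r -> a p != 0 \/ b p != 0 -> a r != 0 \/ b r != 0.
Proof.
move=> qE sig Dp Dr; have := sig p r Dp Dr 1%N; rewrite !qE // => -[[P1 _] [N1 _]].
by move=> /nonzero_sig nz; apply/nonzero_sig; case: nz => [/P1|/N1]; [left|right].
Qed.

(** A function without zeros has constant sign on the connected set D. *)
Lemma sign_choice (q : 'rV[R]_2 -> R) : smooth D q -> (forall p, D p -> q p != 0) ->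
  exists2 s : R, s * s = 1 & forall p, D p -> 0 < s * q p.
Proof.
move=> sq q0'; have [_ _ Dc _] := cD.
have [pos|neg] := constant_sign Do Dc sq q0'.
  by exists 1 => [|p Dp]; rewrite mul1r // pos.
by exists (-1) => [|p Dp]; rewrite ?mulrNN ?mulr1 // mulN1r oppr_gt0 neg.
Qed.

Lemma dense_point (P : 'rV[R]_2 -> Prop) : on_dense_open_subset D P ->
  exists2 r, D r & P r.
Proof.
move=> [A [_ OD DO OP]]; have [_ [p1 Dp1] _ _] := cD.
have [r [Or _]] := DO p1 Dp1 setT filterT.
by exists r; [exact: OD|exact: OP].
Qed.

(** Constancy of the signature spreads non-degeneracy from one point to all of D, so
    the entries of q are, up to constant signs, squares of functions U and V. *)
Lemma Omega_labelled : Omega_surface D F -> exists eps : R[i],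
  (eps = 1 \/ eps = 'i) /\ demoulin_labelled D fr 0 1 (k 0) (k 1) eps.
Proof.
move=> [et la /dense_point[r Dr ndr]].
have [Q mQ qE] := lie_applicable_diagonal_data la.
have [_ _ _ _ sig] := la.
have nd p : D p -> Q 0 p != 0 /\ Q 1 p != 0.
  move=> Dp; apply/nondegenerate_diag; rewrite -qE //.
  exact: constant_nondegenerate qE sig Dr Dp ndr.
have [sQ cQ _] := mQ.
have ne01 : (0 : 'I_2) != 1 by []. have ne10 : (1 : 'I_2) != 0 by [].
have [s0 ss0 pos0] := sign_choice (sQ 0) (fun p Dp => (nd p Dp).1).
have [s1 ss1 pos1] := sign_choice (sQ 1) (fun p Dp => (nd p Dp).2).
have [u [su u0 uj Q0]] := sqrt_of_coordinate ne01 (sQ 0) (fun p => cQ 0 1 p ne01) ss0 pos0.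
have [v [sv v0 vi Q1]] := sqrt_of_coordinate ne10 (sQ 1) (fun p => cQ 1 0 p ne10) ss1 pos1.
have Q1' p : D p -> Q 1 p = - (- s1 * v p ^+ 2) by move=> Dp; rewrite mulNr opprK Q1.
have label eps : eps ^+ 2 = (- s1 * s0)%:C%C -> demoulin_labelled D fr 0 1 (k 0) (k 1) eps.
  by move=> E; apply: (diagonal_data_labelled ne01 mQ su sv u0 v0 uj vi Q0 Q1') => //;
    rewrite mulrNN.
have : (- s1 * s0) ^+ 2 == 1 by rewrite exprMn sqrrN !expr2 ss0 ss1 mulr1.
rewrite sqrf_eq1 => /orP[/eqP E|/eqP E]; [exists 1|exists 'i]; split; auto; apply: label.
  by rewrite E expr1n.
by rewrite E sqrCi rmorphN1.
Qed.

(** At each point exactly one diagonal entry of q vanishes; as D is connected, it is the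
    same one everywhere, and it decides which labelling is to be used. *)
Lemma Omega0_labelled : Omega0_surface D F ->
  demoulin_labelled D fr 0 1 (k 0) (k 1) 0 \/ demoulin_labelled D fr 1 0 (k 1) (k 0) 0.
Proof.
move=> [et la /dense_point[r Dr ndr]].
have [Q mQ qE] := lie_applicable_diagonal_data la.
have [_ _ _ [p1 [X [Y [Dp1 /eqP nz]]]] sig] := la.
have [sQ cQ _] := mQ; have [_ _ Dc _] := cD.
have nz1 : Q 0 p1 != 0 \/ Q 1 p1 != 0.
  have [a0|] := eqVneq (Q 0 p1) 0; last by left.
  have [b0|] := eqVneq (Q 1 p1) 0; last by right.
  by move: nz; rewrite qE // /diag_form a0 b0 !mul0r addr0 eqxx.
have nzD p : D p -> Q 0 p != 0 \/ Q 1 p != 0.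
  by move=> Dp; exact: constant_nonzero qE sig Dp1 Dp nz1.
have degD p : D p -> Q 0 p != 0 -> Q 1 p != 0 -> False.
  move=> Dp a0 b0; apply: ndr; apply: (constant_nondegenerate qE sig Dp Dr).
  by rewrite qE //; apply/nondegenerate_diag.
have label i j : i != j -> (forall p, D p -> Q i p = 0) -> (forall p, D p -> Q j p != 0) ->
    demoulin_labelled D fr i j (k i) (k j) 0.
  move=> ij Qi0 Qj0; have ji : j != i by rewrite eq_sym.
  have [s ss pos] := sign_choice (sQ j) Qj0.
  have [v [sv v0 vi Qj]] := sqrt_of_coordinate ji (sQ j) (fun p => cQ j i p ji) ss pos.
  (* With al = 0 any function U without zeros is suitable. *)
  pose one : 'rV[R]_2 -> R := fun=> 1.
  have one0 p : D p -> one p != 0 by move=> _; exact: oner_neq0.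
  have one_const p : D p -> partial j one p = 0.
    by move=> Dp; apply: (partial_const_on Do j (c := 1)) Dp.
  have Qi p : D p -> Q i p = 0 * one p ^+ 2 by move=> Dp; rewrite Qi0 // mul0r.
  have Qj' p : D p -> Q j p = - (- s * v p ^+ 2) by move=> Dp; rewrite mulNr opprK Qj.
  apply: (diagonal_data_labelled ij mQ (smooth_cst Do 1) sv one0 v0 one_const vi Qi Qj').
    by rewrite mulrNN.
  by rewrite mulr0 expr0n.
have cover : D `<=` [set p | D p /\ Q 0 p != 0] `|` [set p | D p /\ Q 1 p != 0].
  by move=> p Dp; have [|] := nzD p Dp; [left|right].
have apart p : D p -> [set p | D p /\ Q 0 p != 0] p -> [set p | D p /\ Q 1 p != 0] p -> False.
  by move=> Dp [_ a0] [_ b0]; exact: degD a0 b0.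
have [A|B] := connected_cover Dc (open_neq0 Do (sQ 0)) (open_neq0 Do (sQ 1)) cover apart.
- right; apply: label => // p Dp; last by have [] := A p Dp.
  by apply/eqP/negPn/negP => /(degD p Dp); apply; have [] := A p Dp.
- left; apply: label => // p Dp; last by have [] := B p Dp.
  by apply/eqP/negPn/negP => a0; apply: (degD p Dp a0); have [] := B p Dp.
Qed.

Lemma Omega_of_labelled i j (eps : R[i]) : i != j -> eps = 1 \/ eps = 'i ->
  demoulin_labelled D fr i j (k i) (k j) eps -> Omega_surface D F.
Proof.
move=> ij eps1.
have [al al0 eps2] : exists2 al : R, al != 0 & eps ^+ 2 = al%:C%C.
  case: eps1 => ->; first by exists 1; rewrite ?oner_eq0 ?expr1n.
  by exists (-1); rewrite ?oppr_eq0 ?oner_eq0 // sqrCi rmorphN1.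
move=> /(labelled_lie_applicable ij eps2)[et la]; rewrite (negbTE al0) => nd.
by exists et => //; exists D; split => //; exact: subset_closure.
Qed.

Lemma Omega0_of_labelled i j : i != j ->
  demoulin_labelled D fr i j (k i) (k j) 0 -> Omega0_surface D F.
Proof.
move=> ij; have eps2 : (0 : R[i]) ^+ 2 = (0 : R)%:C%C by rewrite expr0n.
move=> /(labelled_lie_applicable ij eps2)[et la]; rewrite eqxx => nd.
by exists et => //; exists D; split => //; exact: subset_closure.
Qed.

End Equivalence.

Theorem mainTheorem1 (R : realType) (D : set 'rV[R]_2) (q0 p0 : 'rV[R]_6)
    (fr tg : 'rV[R]_2 -> 'rV[R]_6) (k1 k2 : 'rV[R]_2 -> R) :
  coordinate_domain D ->
  space_form_data q0 p0 ->
  immersed_in D (space_form q0 p0) fr ->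
  tangent_plane_congruence D (hyperplanes q0 p0) fr tg ->
  curvature_line_coordinates D fr tg k1 k2 ->
  (forall p, D p -> k1 p <> k2 p) ->
  (Omega_surface D (legendre_lift fr tg) <->
     exists eps : R[i], (eps = 1 \/ eps = 'i) /\ demoulin_surface D fr k1 k2 eps) /\
  (Omega0_surface D (legendre_lift fr tg) <->
     demoulin_surface D fr k1 k2 0).
Proof.
move=> cD _ frQ tgP [sk1 sk2 rod1 rod2] k12.
pose k (l : 'I_2) := if l == 0 then k1 else k2.
have S : principal_chart D q0 p0 fr tg k.
  split; [exact: cD|exact: frQ|exact: tgP| | |].
  - by apply: cases2; [exact: sk1|exact: sk2].
  - by apply: cases2; [exact: rod1|exact: rod2].
  - move=> i j p; move: i; apply: cases2; move: j; apply: cases2 => // _ Dp;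
      rewrite subr_eq0; apply/eqP; [exact: k12|exact/nesym/k12].
have ne01 : (0 : 'I_2) != 1 by []. have ne10 : (1 : 'I_2) != 0 by [].
split; split.
- by move=> /(Omega_labelled S)[eps [eps1 dl]]; exists eps; split=> //; left.
- move=> [eps [eps1 [dl|dl]]].
    exact: (Omega_of_labelled S ne01 eps1 dl).
  exact: (Omega_of_labelled S ne10 eps1 dl).
- exact: (Omega0_labelled S).
- move=> [dl|dl].
    exact: (Omega0_of_labelled S ne01 dl).
  exact: (Omega0_of_labelled S ne10 dl).
Qed.
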